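(* Let $\alpha$ be an irreducible, ergodic and nonexpansive automorphism of a compact connected abelian group $X$, and let $Y$ be an irreducible shift of finite type with finite or countably infinite alphabet. Then every continuous equivariant map $\phi:Y\to X$ sends $Y$ to a finite set.
   Context: A continuous automorphism $\alpha$ of a compact abelian group $X$ is irreducible if every closed $\alpha$-invariant subgroup of $X$ other than $X$ itself is finite. Ergodicity is with respect to Haar measure; nonexpansive means not expansive. Let $A$ be a finite or countably infinite set and $P=(P(a,a'))_{a,a'\in A}$ a transition matrix with entries in $\{0,1\}$. The associated shift of finite type is $X_P=\{x=(x_n)\in A^{\mathbb{Z}}:P(x_n,x_{n+1})=1\text{ for every }n\in\mathbb{Z}\}$, with the topology induced by the product of discrete topologies and the shift $T$, $(Tx)_n=x_{n+1}$. It is irreducible if for every $a,a'\in A$ there exist $n\ge1$ and elements $a_0=a,a_1,\dots,a_n=a'$ in $A$ with $P(a_i,a_{i+1})=1$ for $i=0,\dots,n-1$. A map $\phi:Y\to X$ is equivariant if $\phi\circ T=\alpha\circ\phi$. *)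

(* Defs.v *)
From HB Require Import structures.
From mathcomp Require Import all_boot all_order all_algebra.
From mathcomp Require Import all_classical all_reals all_analysis.

Set Implicit Arguments.
Unset Strict Implicit.
Unset Printing Implicit Defensive.

Import GRing.Theory.
Local Open Scope classical_set_scope.
Local Open Scope ring_scope.

(* [g_sigma_algebraType] is only a measurable type over a pointed carrier;
   a topological abelian group is pointed at its neutral element. *)
Definition pointed_group (X : topologicalZmodType) : Type := X.
HB.instance Definition _ (X : topologicalZmodType) :=
  Choice.on (pointed_group X).
HB.instance Definition _ (X : topologicalZmodType) :=
  isPointed.Build (pointed_group X) (0 : X).

Notation borel_group X := (@g_sigma_algebraType (pointed_group X) (@open X)).

Section CompactAbelianGroup.
Variable X : topologicalZmodType.

Variable R : realType.
Implicit Types (mu : probability (borel_group X) R) (alpha : X -> X).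

Definition borel_set (B : set X) : Prop := measurable (B : set (borel_group X)).

Definition translation_invariant mu : Prop :=
  forall (x : X) (B : set X), borel_set B -> mu ((fun y => x + y) @` B) = mu B.

(* For a Borel probability measure on a compact Hausdorff space. *)
Definition regular_measure mu : Prop :=
  forall B : set X, borel_set B ->
    mu B = ereal_inf [set mu U | U in [set U : set X | open U /\ B `<=` U]] /\
    mu B = ereal_sup [set mu K | K in [set K : set X | compact K /\ K `<=` B]].

Definition haar_measure mu : Prop :=
  translation_invariant mu /\ regular_measure mu.

Definition ergodic mu alpha : Prop :=
  forall B : set X, borel_set B -> alpha @^-1` B = B ->
    mu B = 0%E \/ mu B = 1%E.

(* For bijective [alpha] this is the image of [U] under the [n]-th power
   of [alpha], as [Negz m] is [- m.+1]. *)
Definition zpower_image alpha (n : int) (U : set X) : set X :=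
  match n with
  | Posz m => iter m alpha @` U
  | Negz m => iter m.+1 alpha @^-1` U
  end.

Definition expansive alpha : Prop :=
  exists2 U : set X, nbhs 0 U &
    \bigcap_(n in [set: int]) zpower_image alpha n U = [set 0].

Definition irreducible_automorphism alpha : Prop :=
  forall H : set X, zmod_closed (mem H) -> closed H -> alpha @` H = H ->
    H <> [set: X] -> finite_set H.

End CompactAbelianGroup.

Definition compact_connected_group (X : topologicalZmodType) : Prop :=
  [/\ hausdorff_space X, compact [set: X] & connected [set: X]].

Notation full_shift A := {ptws int -> discrete_topology A}.

Section ShiftOfFiniteType.
Variable A : countType.

Definition shift_map (x : full_shift A) : full_shift A := fun n => x (n + 1).

Variable P : rel A.

Definition sft : set (full_shift A) :=
  [set x | forall n : int, P (x n) (x (n + 1))].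

Definition irreducible_matrix : Prop :=
  forall a a' : A, exists s : seq A, [/\ s <> [::], path P a s & last a s = a'].

End ShiftOfFiniteType.

(* Main.v *)
Require Import Defs.
From mathcomp Require Import all_boot all_order all_algebra.
From mathcomp Require Import all_classical all_reals all_analysis.
From mathcomp Require Import measurable_realfun spectral complex ring lra zify.

(** Call a point [x] of [X] homoclinic if [alpha^n x] tends to [0] as [n] tends
    to both infinities.  The theorem reduces to the fact that [0] is the only
    homoclinic point ([homoclinic_trivial]).

    The reduction ([coding_finite]).  Fix a loop in the graph of [P] and the
    periodic point [q] that runs around it.  By irreducibility, the points of the
    shift that agree with a translate of [q] far to the left and with another
    translate of [q] far to the right are dense.  There are finitely many pairs of
    translates, and two points with the same pair have images whose difference is
    homoclinic: along each residue class of times, both orbits converge to the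
    same periodic point, at which [phi] is continuous.  Hence [phi] takes finitely
    many values on a dense set, and finite sets are closed.

    The absence of homoclinic points.  A character is represented by a real
    function [r] that is additive and continuous modulo the integers.  Suppose
    that [r] is a nontrivial character.  The points on which [r] is fixed modulo
    the integers along the whole orbit form a closed invariant subgroup; by
    irreducibility it is finite or everything, and either case produces a nonzero
    integer polynomial [f] such that [r] is integral on [f(alpha) X]
    ([relation_exists]).  Such an [f] of minimal size has, up to constants, no
    proper factor ([minimal_relation_prime]), because the image of [X] under a
    factor is again finite or everything.  Write [S] for the shift of two-sided
    real sequences.
    - Since [alpha] is not expansive, there is a nonzero point whose orbit stays so
      close to [0] that the real lift [s] of [r] along it satisfies [f(S) s = 0]
      exactly.  So [f] kills a nonzero bounded sequence ([neutral_sequence]).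
    - Along the orbit of a homoclinic point [x], the lift [t] of [r] tends to [0],
      and [f(S) t] is integer-valued; it therefore has finite support, and it is
      given by an integer polynomial [V].  Summation by parts against [s]
      ([pairing_act]) turns [f(S) s = 0] into [V(S) s = 0].
    - By Bezout, [f] and [V] have a common factor, so [c V = q f] for some nonzero
      integer [c].  Then [c t] differs from a finitely supported integer sequence
      by a sequence that tends to [0] and is killed by [f]; such a sequence is
      zero ([vanishing_killed]).  So [c t] is integral, which puts [c x] in a finite
      invariant subgroup, where only [0] is homoclinic.  Hence [c x = 0], and [x]
      itself lies in a finite invariant subgroup, the torsion of exponent [c].

    The existence of a nontrivial character ([nontrivial_character]) is the
    Peter-Weyl theorem for compact abelian groups.  A maximizing sequence for the
    gain of a convolution operator on functions of mean zero converges to an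
    eigenfunction.  The eigenspace has finite dimension and is invariant under the
    commuting translations, hence these have a common complex eigenvector, on
    which a translation by [a] acts by a complex number that is multiplicative and
    continuous in [a]. *)

Set Implicit Arguments.
Unset Strict Implicit.
Unset Printing Implicit Defensive.

Import Order.TTheory GRing.Theory Num.Theory.
Import numFieldNormedType.Exports.
Import ComplexField.Normc.

Local Open Scope classical_set_scope.
Local Open Scope ring_scope.

(** * Invariant means on a compact abelian group *)

(** The properties of the Haar integral on continuous functions from which
    everything about characters is derived; in particular no measure on the
    product group is involved. *)
Record invariant_mean (R : realType) (X : topologicalZmodType)
    (I : (X -> R) -> R) : Prop := InvariantMean {
  meanD : forall f g : X -> R, continuous f -> continuous g ->
    I (fun x => f x + g x) = I f + I g;
  meanZ : forall (c : R) (f : X -> R), continuous f -> I (fun x => c * f x) = c * I f;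
  mean_ge0 : forall f : X -> R, continuous f -> (forall x, 0 <= f x) -> 0 <= I f;
  mean1 : I (fun=> 1) = 1;
  mean_translate : forall (a : X) (f : X -> R), continuous f -> I (fun x => f (x + a)) = I f }.

Section GroupLimits.
Variables (X : topologicalZmodType) (T : Type) (F : set_system T).
Hypothesis FF : Filter F.

Lemma cvg_addg (f g : T -> X) (a b : X) :
  f @ F --> a -> g @ F --> b -> (fun t => f t + g t) @ F --> a + b.
Proof.
by move=> fa gb; apply: continuous2_cvg => //; exact: (@add_continuous X (a, b)).
Qed.

Lemma cvg_oppg (f : T -> X) (a : X) : f @ F --> a -> (fun t => - f t) @ F --> - a.
Proof. by move=> fa; apply: continuous_cvg fa; exact: opp_continuous. Qed.

Lemma cvg_subg (f g : T -> X) (a b : X) :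
  f @ F --> a -> g @ F --> b -> (fun t => f t - g t) @ F --> a - b.
Proof. by move=> fa gb; apply: cvg_addg => //; exact: cvg_oppg. Qed.

End GroupLimits.

Lemma near_subg (X : topologicalZmodType) (V : set X) (x : X) :
  nbhs (0 : X) V -> \forall t \near x, V (t - x).
Proof.
have : (fun t : X => t - x) @ x --> (0 : X).
  by rewrite -(subrr x); apply: cvg_subg; [exact: cvg_id|exact: cvg_cst].
exact.
Qed.

Section HaarIntegral.
Variables (R : realType) (X : topologicalZmodType).
Hypothesis cptX : compact [set: X].
Variable mu : probability (borel_group X) R.
Hypothesis mu_inv : translation_invariant mu.

Definition haar_integral (f : X -> R) : R :=
  \int[mu]_x (f : borel_group X -> R) x.

Lemma continuous_borel_measurable (f : X -> R) :
  continuous f -> measurable_fun setT (f : borel_group X -> R).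
Proof.
move=> cf; apply: (measurability _ (RGenOpens.measurableE R)).
move=> _ [_ [a [b ->] <-]]; rewrite setTI; apply: sub_sigma_algebra.
by apply: open_comp; [move=> x _; exact: cf|exact: interval_open].
Qed.

Lemma continuous_borel_integrable (f : X -> R) : continuous f ->
  mu.-integrable setT (EFin \o (f : borel_group X -> R)).
Proof.
move=> cf; apply: measurable_bounded_integrable => //.
- apply: (le_lt_trans (probability_le1 mu _)); rewrite ?ltry //.
- exact: continuous_borel_measurable.
- have : compact (f @` setT).
    by apply: continuous_compact => //; exact: continuous_subspaceT.
  move=> /compact_bounded [M [Mr HM]]; exists M; split => // r Mr' x _.
  by apply: HM => //; exists x.
Qed.

Let translate (a : X) : borel_group X -> borel_group X := fun x : X => x + a.

Let translate_measurable (a : X) : measurable_fun setT (translate a).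
Proof.
apply: (@measurability _ _ (borel_group X) (borel_group X) setT _ (@open X)) => // _ [B oB <-].
rewrite setTI; apply: sub_sigma_algebra.
have : open ((fun x : X => x + a) @^-1` B); last by [].
by apply: open_comp => // x _; apply: cvg_addg; [exact: cvg_id|exact: cvg_cst].
Qed.

Lemma haar_integral_invariant : invariant_mean haar_integral.
Proof.
split.
- move=> f g cf cg; apply: RintegralD => //; exact: continuous_borel_integrable.
- by move=> c f cf; apply: RintegralZl => //; exact: continuous_borel_integrable.
- by move=> f cf f0; apply: Rintegral_ge0.
- rewrite /haar_integral Rintegral_cst// mul1r -[RHS]/(fine 1%E).
  by congr fine; exact: probability_setT.
- move=> a f cf; rewrite /haar_integral /Rintegral; congr fine.
  have mt := translate_measurable a.
  transitivity (\int[pushforward mu (translate a)]_x ((f : borel_group X -> R) x)%:E)%E.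
    rewrite integral_pushforward //=.
    + by apply/measurable_EFinP; exact: continuous_borel_measurable.
    + apply: (@continuous_borel_integrable (fun x => f (x + a))) => x.
      apply: (@continuous_comp _ _ _ (fun x : X => x + a) f); last exact: cf.
      by apply: cvg_addg; [exact: cvg_id|exact: cvg_cst].
  apply: eq_measure_integral => //= A mA _.
  transitivity (mu ((fun y : X => - a + y) @` A)); last exact: mu_inv.
  congr (mu _); apply/seteqP; split => x.
    by move=> Axa; exists ((x : X) + a) => //; rewrite addrC addrK.
  by move=> [y Ay <-]; rewrite /= /translate addrAC addNr add0r.
Qed.

End HaarIntegral.

(** * Continuous functions on a compact abelian group *)

Section RealContinuity.
Variables (R : realType) (T : topologicalType).
Implicit Types f g : T -> R.

Lemma ctsD f g : continuous f -> continuous g -> continuous (fun x => f x + g x).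
Proof. by move=> cf cg x; apply: cvgD; [exact: cf|exact: cg]. Qed.

Lemma ctsN f : continuous f -> continuous (fun x => - f x).
Proof. by move=> cf x; apply: cvgN; exact: cf. Qed.

Lemma ctsB f g : continuous f -> continuous g -> continuous (fun x => f x - g x).
Proof. by move=> cf cg; apply: ctsD => //; exact: ctsN. Qed.

Lemma ctsM f g : continuous f -> continuous g -> continuous (fun x => f x * g x).
Proof. by move=> cf cg x; apply: cvgM; [exact: cf|exact: cg]. Qed.

Lemma cts_cst (c : R) : continuous (fun _ : T => c).
Proof. by move=> x; exact: cvg_cst. Qed.

Lemma ctsZ (c : R) f : continuous f -> continuous (fun x => c * f x).
Proof. by move=> cf; apply: ctsM => //; exact: cts_cst. Qed.

Lemma cts_sum (J : Type) (s : seq J) (F : J -> T -> R) :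
  (forall j, continuous (F j)) -> continuous (fun x => \sum_(j <- s) F j x).
Proof.
move=> cF; elim: s => [|j s IH].
  by rewrite (_ : (fun _ => _) = fun=> 0); [exact: cts_cst|apply/funext => x; rewrite big_nil].
rewrite (_ : (fun _ => _) = fun x => F j x + \sum_(j <- s) F j x).
  exact: ctsD.
by apply/funext => x; rewrite big_cons.
Qed.

Lemma cts_comp (S : topologicalType) (h : S -> T) f :
  continuous h -> continuous f -> continuous (fun x => f (h x)).
Proof. by move=> ch cf x; apply: (@continuous_comp _ _ _ h f); [exact: ch|exact: cf]. Qed.

Lemma cts_fst_comp (S : topologicalType) f :
  continuous f -> continuous (fun p : T * S => f p.1).
Proof.
by move=> cf p; apply: (@continuous_comp _ _ _ fst f); [exact: cvg_fst|exact: cf].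
Qed.

Lemma cts_snd_comp (S : topologicalType) f :
  continuous f -> continuous (fun p : S * T => f p.2).
Proof.
by move=> cf p; apply: (@continuous_comp _ _ _ snd f); [exact: cvg_snd|exact: cf].
Qed.

End RealContinuity.

Lemma compact_nbhs_cover (T : topologicalType) (K : set T) (U : T -> set T) :
  compact K -> (forall x, K x -> nbhs x (U x)) ->
  exists s : seq T, forall y, K y -> exists2 a, a \in s & U a y.
Proof.
move=> /compact_near_coveringP cK KU.
pose F := filter_from [set: seq T] (fun s0 => [set s : seq T | {subset s0 <= s}]).
have FF : ProperFilter F.
  apply: filter_from_proper; last by move=> s0 _; exists s0.
  apply: filter_from_filter; first by exists [::].
  move=> s1 s2 _ _; exists (s1 ++ s2) => // s sub; split=> x xs; apply: sub;
    by rewrite mem_cat xs ?orbT.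
have := cK (seq T) F (fun s y => exists2 a, a \in s & U a y) _.
move=> H; have {H} : F [set s : seq T | K `<=` fun y => exists2 a, a \in s & U a y].
  apply: H => x Kx; exists (U x, [set s : seq T | x \in s]) => /=.
    split; first exact: KU.
    by exists [:: x] => // s; apply; rewrite mem_head.
  by move=> [y s] [/= Uy xs]; exists x.
by move=> /filter_ex[s Hs]; exists s.
Qed.

Section CompactGroup.
Variables (R : realType) (X : topologicalZmodType).
Hypothesis hausX : hausdorff_space X.
Hypothesis cptX : compact [set: X].

Lemma cts_addg (T : topologicalType) (h k : T -> X) :
  continuous h -> continuous k -> continuous (fun x => h x + k x).
Proof. by move=> ch ck x; apply: cvg_addg; [exact: ch|exact: ck]. Qed.

Lemma cts_oppg (T : topologicalType) (h : T -> X) :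
  continuous h -> continuous (fun x => - h x).
Proof. by move=> ch x; apply: cvg_oppg; exact: ch. Qed.

Lemma cts_id (T : topologicalType) : continuous (fun x : T => x).
Proof. by move=> x. Qed.

Lemma cts_fst (S T : topologicalType) : continuous (fun p : S * T => p.1).
Proof. by move=> x; exact: cvg_fst. Qed.

Lemma cts_snd (S T : topologicalType) : continuous (fun p : S * T => p.2).
Proof. by move=> x; exact: cvg_snd. Qed.

Lemma cts_cstg (T : topologicalType) (a : X) : continuous (fun _ : T => a).
Proof. by move=> x; exact: cvg_cst. Qed.

(** Uniform continuity in the first variable, uniformly in the second one: the
    local statement at each point of the product is spread by compactness. *)
Lemma compact_group_uniform2 (Y : topologicalType) (F : X -> Y -> R) (e : R) :
  compact [set: Y] -> continuous (fun p : X * Y => F p.1 p.2) -> 0 < e ->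
  \forall v \near (0 : X), forall x y, `|F (x + v) y - F x y| <= e.
Proof.
move=> cY cF e0.
have /compact_near_coveringP cov : compact ([set: X] `*` [set: Y]).
  exact: compact_setX.
have := cov X (nbhs (0 : X))
  (fun v (p : X * Y) => `|F (p.1 + v) p.2 - F p.1 p.2| <= e) _.
move=> H; have {H} : \forall v \near (0 : X),
    [set: X] `*` [set: Y] `<=` (fun p : X * Y => `|F (p.1 + v) p.2 - F p.1 p.2| <= e).
  apply: H => p _.
  pose G (q : (X * Y) * X) := F (q.1.1 + q.2) q.1.2 - F q.1.1 q.1.2.
  have cG : continuous G.
    apply: ctsB.
      apply: (@cts_comp _ _ _ (fun q : (X * Y) * X => (q.1.1 + q.2, q.1.2)) (fun p => F p.1 p.2)) => //.
      move=> q; apply: cvg_pair.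
        apply: cvg_addg; last exact: cvg_snd.
        apply: (@continuous_comp _ _ _ fst fst); exact: cvg_fst.
      apply: (@continuous_comp _ _ _ fst snd); [exact: cvg_fst|exact: cvg_snd].
    apply: (@cts_comp _ _ _ fst (fun p => F p.1 p.2)) => //; exact: cts_fst.
  have G0 : G @ (p, 0 : X) --> (0 : R).
    have <- : G (p, 0) = 0 by rewrite /G/= addr0 subrr.
    exact: cG.
  by move/cvgr0Pnorm_le: G0 => /(_ _ e0).
by apply: filterS => v Hv x y; apply: (Hv (x, y)).
Qed.

Lemma compact_group_uniform (f : X -> R) (e : R) : continuous f -> 0 < e ->
  \forall v \near (0 : X), forall x, `|f (x + v) - f x| <= e.
Proof.
move=> cf e0; have := @compact_group_uniform2 X (fun x _ => f x) e cptX _ e0.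
move=> H; have {H} : \forall v \near (0 : X), forall x y : X, `|f (x + v) - f x| <= e.
  by apply: H; apply: (@cts_comp _ _ _ fst f) => //; exact: cts_fst.
by apply: filterS => v Hv x; apply: (Hv x x).
Qed.

(** Multiplying a Urysohn function by its reflection makes it symmetric without
    enlarging its support. *)
Lemma symmetric_bump (V : set X) : nbhs (0 : X) V -> exists u : X -> R,
  [/\ continuous u, forall x, 0 <= u x, u 0 = 1, forall x, u (- x) = u x
    & forall x, u x != 0 -> V x].
Proof.
move=> V0; have sep : uniform_separator (~` V^°) [set (0 : X)].
  apply: (iffLR (@normal_separatorP R X)).
  - exact: (compact_normal hausX cptX).
  - by apply: open_closedC; exact: open_interior.
  - exact/accessible_closed_set1/hausdorff_accessible.
  - by apply/seteqP; split => // x [nV x0]; apply: nV; rewrite (x0 : x = 0).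
have /uniform_separatorP - /(_ R) [f [cf f01 f0 f1]] := sep.
have fr x : 0 <= f x <= 1 by have : range f (f x) by [exists x]; move=> /f01; rewrite /= in_itv.
exists (fun x => f x * f (- x)); split.
- apply: ctsM => //; apply: cts_comp => //; exact: opp_continuous.
- by move=> x; apply: mulr_ge0; [case/andP: (fr x)|case/andP: (fr (- x))].
- by have f00 : f 0 = 1 by [apply: f1; exists 0]; rewrite oppr0 f00 mulr1.
- by move=> x; rewrite opprK mulrC.
- move=> x; rewrite mulf_eq0 negb_or => /andP[fx _].
  apply: interior_subset; apply: contrapT => nVx; move/eqP: fx; apply.
  by apply: f0; exists x.
Qed.

End CompactGroup.

(** * Quadrature and iterated means *)

Section Mean.
Variables (R : realType) (X : topologicalZmodType).
Hypothesis hausX : hausdorff_space X.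
Hypothesis cptX : compact [set: X].
Variable I : (X -> R) -> R.
Hypothesis HI : invariant_mean I.

Implicit Types (f g : X -> R) (c e : R).

Lemma mean0 : I (fun=> 0) = 0.
Proof.
by rewrite -[RHS](mul0r (I (fun=> 0))) -(meanZ HI); [congr I; apply/funext => x; rewrite mul0r|exact: cts_cst].
Qed.

Lemma mean_cst c : I (fun=> c) = c.
Proof.
rewrite -[RHS]mulr1 -(mean1 HI) -(meanZ HI); last exact: cts_cst.
by congr I; apply/funext => x; rewrite mulr1.
Qed.

Lemma meanB f g : continuous f -> continuous g ->
  I (fun x => f x - g x) = I f - I g.
Proof.
move=> cf cg; rewrite -mulN1r -(meanZ HI)// -(meanD HI)//; last exact: ctsZ.
by congr I; apply/funext => x; rewrite mulN1r.
Qed.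

Lemma mean_le f g : continuous f -> continuous g -> (forall x, f x <= g x) ->
  I f <= I g.
Proof.
move=> cf cg fg; rewrite -subr_ge0 -meanB//; apply: (mean_ge0 HI); first exact: ctsB.
by move=> x; rewrite subr_ge0.
Qed.

Lemma mean_sum (J : Type) (s : seq J) (F : J -> X -> R) :
  (forall j, continuous (F j)) ->
  I (fun x => \sum_(j <- s) F j x) = \sum_(j <- s) I (F j).
Proof.
move=> cF; elim: s => [|j s IH].
  by rewrite big_nil -[RHS]mean0; congr I; apply/funext => x; rewrite big_nil.
rewrite big_cons -IH -(meanD HI)//; last exact: cts_sum.
by congr I; apply/funext => x; rewrite big_cons.
Qed.

Lemma mean_norm_le f g : continuous f -> continuous g ->
  (forall x, `|f x| <= g x) -> `|I f| <= I g.
Proof.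
move=> cf cg fg; rewrite ler_norml -mulN1r -(meanZ HI)//.
apply/andP; split; apply: mean_le => //; first exact: ctsZ.
  by move=> x; rewrite mulN1r; case/ler_normlP: (fg x); rewrite lerNl.
by move=> x; case/ler_normlP: (fg x).
Qed.

Lemma mean_dist_le f g e : continuous f -> continuous g ->
  (forall x, `|f x - g x| <= e) -> `|I f - I g| <= e.
Proof.
move=> cf cg fg; rewrite -meanB// -(mean_cst e).
by apply: mean_norm_le => //; [exact: ctsB|exact: cts_cst].
Qed.

Lemma finite_translates_cover (W : set X) : nbhs (0 : X) W ->
  exists s : seq X, forall x, exists2 a, a \in s & W (x - a).
Proof.
move=> W0.
have [|s Hs] := compact_nbhs_cover (U := fun a => [set x | W (x - a)]) cptX.
  by move=> a _; exact: near_subg.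
by exists s => x; exact: Hs.
Qed.

(** Finitely many translates of a neighbourhood cover the group, so a finite sum
    of translates of [f] is bounded below by a positive constant. *)
Lemma mean_gt0 f x0 : continuous f -> (forall x, 0 <= f x) -> f x0 != 0 ->
  0 < I f.
Proof.
move=> cf f0 fx0; have fx0p : 0 < f x0 by rewrite lt_neqAle eq_sym fx0 f0.
have cfa (a : X) : continuous (fun x => f (x + a)).
  by apply: cts_comp => // x; apply: cvg_addg; [exact: cvg_id|exact: cvg_cst].
have h2 : f x0 / 2 < f (0 + x0) by rewrite add0r; lra.
have [s scov] := finite_translates_cover (cvgr_gt _ (cfa x0 0) _ h2).
rewrite lt_neqAle (mean_ge0 HI)// andbT eq_sym; apply/negP => /eqP If0.
have : f x0 / 2 <= I (fun x => \sum_(a <- s) f (x + (x0 - a))).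
  rewrite -[leLHS]mean_cst; apply: mean_le; [exact: cts_cst|exact: cts_sum|].
  move=> x; have [a sa fa] := scov x; rewrite (big_rem a)//= -addrA [- a + _]addrC in fa *.
  by apply: le_trans (ltW fa) _; rewrite lerDl sumr_ge0.
rewrite mean_sum// big1; first lra.
by move=> a _; rewrite (mean_translate HI).
Qed.

(** A partition of unity by translates of a bump function yields one quadrature
    formula that serves all functions varying by at most [e] along [V]. *)
Lemma mean_quadrature (V : set X) : nbhs (0 : X) V ->
  exists (s : seq X) (w : X -> R),
  [/\ forall a, 0 <= w a, \sum_(a <- s) w a = 1 &
    forall (g : X -> R) e, continuous g ->
      (forall a x, V (x - a) -> `|g x - g a| <= e) ->
      `|I g - \sum_(a <- s) w a * g a| <= e].
Proof.
move=> V0; have [u [cu u0 u01 _ uV]] := symmetric_bump R hausX cptX V0.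
have u0gt0 : 0 < u 0 by rewrite u01.
have [s scov] := finite_translates_cover (cvgr_gt _ (cu 0) _ u0gt0).
pose S x := \sum_(a <- s) u (x - a).
have cua a : continuous (fun x => u (x - a)).
  apply: (@cts_comp _ _ _ (fun x : X => x - a)) => // x.
  by apply: cvg_subg; [exact: cvg_id|exact: cvg_cst].
have cS : continuous S by exact: cts_sum.
have S0 x : 0 < S x.
  have [a sa ua] := scov x.
  by rewrite /S (big_rem a)//=; apply: ltr_pwDl => //; exact: sumr_ge0.
pose p a x := u (x - a) / S x.
have cp a : continuous (p a).
  apply: ctsM => // x; apply: cvgV; [by rewrite gt_eqF|exact: cS].
have p0 a x : 0 <= p a x by rewrite divr_ge0// ltW.
have p1 x : \sum_(a <- s) p a x = 1.
  rewrite (_ : \sum_(a <- s) p a x = S x / S x); last by rewrite /S mulr_suml.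
  by rewrite divff// gt_eqF.
exists s, (fun a => I (p a)); split.
- by move=> a; exact: (mean_ge0 HI).
- by rewrite -mean_sum// -[RHS](mean1 HI); congr I; apply/funext.
- move=> g e cg gV.
  have -> : I g = \sum_(a <- s) I (fun x => p a x * g x).
    rewrite -mean_sum; last by move=> a; exact: ctsM.
    by congr I; apply/funext => x; rewrite -mulr_suml p1 mul1r.
  rewrite -sumrB; apply: le_trans (ler_norm_sum _ _ _) _.
  have -> : e = \sum_(a <- s) e * I (p a).
    by rewrite -mulr_sumr -mean_sum// (_ : (fun x => _) = fun=> 1) ?(mean1 HI) ?mulr1//; apply/funext.
  apply: ler_sum => a _.
  rewrite [X in _ - X]mulrC -!(meanZ HI)// -meanB//; [|exact: ctsM|exact: ctsZ].
  apply: mean_norm_le; [by apply: ctsB; [exact: ctsM|exact: ctsZ]|exact: ctsZ|].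
  move=> x; rewrite [g a * _]mulrC -mulrBr normrM (ger0_norm (p0 _ _)) mulrC.
  have [->|pn0] := eqVneq (p a x) 0; first by rewrite !mulr0.
  apply: ler_wpM2r => //; apply: gV; apply: uV.
  by apply: contraNneq pn0 => e0; rewrite /p e0 mul0r.
Qed.

Lemma cts_mean2 (F : X -> X -> R) : continuous (fun p : X * X => F p.1 p.2) ->
  continuous (fun x => I (F x)).
Proof.
move=> cF x; apply/cvgrPdist_le => e e0.
have cFx y : continuous (F y).
  apply: (@cts_comp _ _ _ (fun z => (y, z)) (fun p => F p.1 p.2)) => // z.
  by apply: cvg_pair; [exact: cvg_cst|exact: cvg_id].
have := compact_group_uniform2 cptX cptX cF e0.
move=> H; have : \forall t \near x, forall y, `|F x y - F t y| <= e.
  apply: filterS (near_subg x H) => t Ht y.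
  by have := Ht x y; rewrite [x + _]addrC subrK distrC.
by apply: filterS => t Ht; apply: mean_dist_le.
Qed.

Lemma cts_swap (F : X -> X -> R) : continuous (fun p : X * X => F p.1 p.2) ->
  continuous (fun p : X * X => F p.2 p.1).
Proof.
move=> cF; apply: (@cts_comp _ _ _ (fun p : X * X => (p.2, p.1)) (fun p => F p.1 p.2)) => // z.
by apply: cvg_pair; [exact: cvg_snd|exact: cvg_fst].
Qed.

Lemma cts_section (F : X -> X -> R) y : continuous (fun p : X * X => F p.1 p.2) ->
  continuous (F y).
Proof.
move=> cF; apply: (@cts_comp _ _ _ (fun z => (y, z)) (fun p => F p.1 p.2)) => // z.
by apply: cvg_pair; [exact: cvg_cst|exact: cvg_id].
Qed.

(** Both iterated means are close to the same weighted sum, once a quadrature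
    formula is chosen according to the uniform continuity of [F] in its first
    variable. *)
Lemma mean_fubini (F : X -> X -> R) : continuous (fun p : X * X => F p.1 p.2) ->
  I (fun x => I (F x)) = I (fun y => I (fun x => F x y)).
Proof.
move=> cF; have cF' := cts_swap cF.
apply/eqP; rewrite -subr_eq0 -normr_le0; apply/ler_addgt0Pr => e e0.
have e20 : 0 < e / 2 by rewrite divr_gt0.
have H := compact_group_uniform2 cptX cptX cF e20.
have [s [w [w0 w1 Hw]]] := mean_quadrature H.
have Fe a x : (forall x0 y, `|F (x0 + (x - a)) y - F x0 y| <= e / 2) ->
   forall y, `|F x y - F a y| <= e / 2.
  by move=> /(_ a) Ha y; have := Ha y; rewrite [a + _]addrC subrK.
(* quadrature in the outer variable *)
have h1 : `|I (fun x => I (F x)) - \sum_(a <- s) w a * I (F a)| <= e / 2.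
  apply: Hw; first exact: cts_mean2.
  by move=> a x /Fe Hax; apply: mean_dist_le; [exact: (@cts_section F x cF)|exact: (@cts_section F a cF)|].
(* the same quadrature, for each value of the outer variable *)
have h2 : `|I (fun y => I (fun x => F x y)) - I (fun y => \sum_(a <- s) w a * F a y)| <= e / 2.
  apply: mean_dist_le.
  - exact: (cts_mean2 cF').
  - by apply: cts_sum => a; apply: ctsZ; exact: (@cts_section F a cF).
  - move=> y; apply: (Hw (fun x => F x y)); first exact: (@cts_section (fun y x => F x y) y cF').
    by move=> a x /Fe Hax; exact: Hax.
have h3 : I (fun y => \sum_(a <- s) w a * F a y) = \sum_(a <- s) w a * I (F a).
  rewrite mean_sum; last by move=> a; apply: ctsZ; exact: (@cts_section F a cF).
  by apply: eq_bigr => a _; rewrite (meanZ HI)//; exact: (@cts_section F a cF).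
rewrite add0r (splitr e); rewrite h3 distrC in h2.
apply: le_trans (lerD h1 h2); exact: ler_distD.
Qed.
End Mean.

(** * Equicontinuity and the Cauchy-Schwarz inequality *)

Section UniformCluster.
Variables (R : realType) (X : topologicalZmodType).
Hypothesis cptX : compact [set: X].

(** A substitute for the sequential theorem of Ascoli on a space that need not be
    metrizable: Tychonoff gives a pointwise cluster point, and equicontinuity makes
    the approximation uniform because finitely many points control all others. *)
Lemma equicontinuous_cluster (h_ : nat -> X -> R) (M : R) :
  (forall n x, `|h_ n x| <= M) ->
  (forall e, 0 < e -> \forall v \near (0 : X), forall n x, `|h_ n (x + v) - h_ n x| <= e) ->
  exists2 h : X -> R, continuous h &
    forall e N, 0 < e -> exists2 n, (N <= n)%N & forall x, `|h_ n x - h x| <= e.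
Proof.
move=> hM hV.
have cA := @tychonoff X (fun _ => R) (fun _ => [set` `[- M, M]%R]) (fun _ => @segment_compact R _ _).
have FA : (h_ @ \oo) [set f : forall i : X, R | forall i, f i \in `[- M, M]%R].
  by exists 0%N => // n _ x; rewrite /= in_itv /= -ler_norml.
have [h [_ clh]] := cA (h_ @ \oo) _ FA.
have Fh : Filter (nbhs (h : {ptws X -> R})) by exact: nbhs_filter.
have near_h (s : seq X) e N : 0 < e ->
    exists2 n, (N <= n)%N & forall x, x \in s -> `|h_ n x - h x| < e.
  move=> e0.
  have hs : nbhs (h : {ptws X -> R}) [set f : forall i : X, R | forall x, x \in s -> `|f x - h x| < e].
    elim: s => [|a s IH].
      by apply: filterE => f x.
    have ha : nbhs (h : {ptws X -> R}) [set f : forall i : X, R | `|f a - h a| < e].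
      have := @proj_continuous X (fun=> R) a h.
      move=> /cvgrPdist_lt /(_ e e0); apply: filterS => f.
      by rewrite distrC.
    apply: (@filterS _ (nbhs (h : {ptws X -> R})) Fh _ _ _ (filterI IH ha)).
    by move=> f [fs fa] x; rewrite inE => /orP[/eqP->//|/fs].
  have FN : (h_ @ \oo) (h_ @` [set n | (N <= n)%N]).
    by exists N => // n Nn; exists n.
  by have [_ [[n Nn <-] Hn]] := clh _ _ FN hs; exists n.
have hVh e : 0 < e -> \forall v \near (0 : X), forall x, `|h (x + v) - h x| <= e.
  move=> e0; apply: filterS (hV e e0) => v Hv x.
  apply/ler_addgt0Pr => d d0; have d2 : 0 < d / 2 by rewrite divr_gt0.
  have [n _ Hn] := near_h [:: x; x + v] _ 0%N d2.
  have := Hn x; have := Hn (x + v); rewrite !inE !eqxx orbT => /(_ isT) + /(_ isT).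
  have := Hv n x; rewrite !(ler_norml, ltr_norml).
  move=> /andP[? ?] /andP[? ?] /andP[? ?]; apply/andP; split; lra.
exists h.
  move=> x; apply/cvgrPdist_le => e e0.
  apply: filterS (near_subg x (hVh e e0)) => t /(_ x).
  by rewrite [x + _]addrC subrK distrC.
move=> e N e0; have e3 : 0 < e / 3 by rewrite divr_gt0.
have [|s Hs] := compact_nbhs_cover (U := fun a => [set x |
    (forall n, `|h_ n x - h_ n a| <= e / 3) /\ `|h x - h a| <= e / 3]) cptX.
  move=> a _; apply: filterS (near_subg a (filterI (hV _ e3) (hVh _ e3))).
  move=> x [H1 H2]; split.
    by move=> n; have := H1 n a; rewrite [a + _]addrC subrK.
  by have := H2 a; rewrite [a + _]addrC subrK.
have [n Nn Hn] := near_h s _ N e3.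
exists n => // x; have [a sa [/(_ n) H1 H2]] := Hs x I.
move: H1 H2 (Hn a sa); rewrite !(ler_norml, ltr_norml).
move=> /andP[? ?] /andP[? ?] /andP[? ?]; apply/andP; split; lra.
Qed.

End UniformCluster.

Section L2.
Variables (R : realType) (X : topologicalZmodType).
Hypothesis hausX : hausdorff_space X.
Hypothesis cptX : compact [set: X].
Variable I : (X -> R) -> R.
Hypothesis HI : invariant_mean I.
Implicit Types (f g : X -> R) (c e : R).

Definition inner f g := I (fun x => f x * g x).

Lemma innerC f g : inner f g = inner g f.
Proof. by congr I; apply/funext => x; rewrite mulrC. Qed.

Lemma innerDl f g h : continuous f -> continuous g -> continuous h ->
  inner (fun x => f x + g x) h = inner f h + inner g h.
Proof.
move=> cf cg ch; rewrite /inner -(meanD HI); [|exact: ctsM..].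
by congr I; apply/funext => x; rewrite mulrDl.
Qed.

Lemma innerZl c f h : continuous f -> continuous h ->
  inner (fun x => c * f x) h = c * inner f h.
Proof.
move=> cf ch; rewrite /inner -(meanZ HI); last exact: ctsM.
by congr I; apply/funext => x; rewrite mulrA.
Qed.

Lemma inner_ge0 f : continuous f -> 0 <= inner f f.
Proof. by move=> cf; apply: (mean_ge0 HI); [exact: ctsM|move=> x; rewrite -expr2 sqr_ge0]. Qed.

Lemma inner_eq0 f : continuous f -> inner f f = 0 -> forall x, f x = 0.
Proof.
move=> cf ff0 x; apply/eqP; apply: contraTT isT => fx.
have : 0 < inner f f.
  apply: (mean_gt0 cptX HI (x0 := x)); [exact: ctsM| |by rewrite mulf_neq0].
  by move=> y; rewrite -expr2 sqr_ge0.
by rewrite ff0 ltxx.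
Qed.

(** The expansion behind both the Cauchy-Schwarz inequality and the estimate of
    near maximizers. *)
Lemma innerBZ c f g : continuous f -> continuous g ->
  inner (fun x => f x - c * g x) (fun x => f x - c * g x) =
  inner f f - c * inner f g *+ 2 + c ^+ 2 * inner g g.
Proof.
move=> cf cg.
have E : inner (fun x => f x - c * g x) (fun x => f x - c * g x)
   = I (fun x => f x * f x + ((- 2 * c) * (f x * g x) + c ^+ 2 * (g x * g x))).
  by congr I; apply/funext => x; ring.
have cfg := ctsM cf cg; have cff := ctsM cf cf; have cgg := ctsM cg cg.
rewrite E (meanD HI)// ?(meanD HI)// ?(meanZ HI)//; do ?[exact: ctsZ|apply: ctsD].
by rewrite /inner; ring.
Qed.

Lemma cauchy_schwarz f g : continuous f -> continuous g ->
  inner f g ^+ 2 <= inner f f * inner g g.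
Proof.
move=> cf cg; have [g0|gn0] := eqVneq (inner g g) 0.
  have -> : inner f g = 0; last by rewrite g0 mulr0 expr0n.
  rewrite -[RHS](mean0 HI); congr I; apply/funext => x.
  by rewrite (inner_eq0 cg g0) mulr0.
have gp : 0 < inner g g by rewrite lt_neqAle eq_sym gn0 inner_ge0.
have : 0 <= inner (fun x => f x - (inner f g / inner g g) * g x)
                  (fun x => f x - (inner f g / inner g g) * g x).
  by apply: inner_ge0; apply: ctsB => //; exact: ctsZ.
rewrite innerBZ//.
(* the coefficient is that of the orthogonal projection of [f] on [g] *)
have -> : inner f f - inner f g / inner g g * inner f g *+ 2 +
   (inner f g / inner g g) ^+ 2 * inner g g = inner f f - inner f g ^+ 2 / inner g g.
  by field.
by rewrite subr_ge0 ler_pdivrMr.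
Qed.
End L2.

(** * Convolution operators *)

Section Convolution.
Variables (R : realType) (X : topologicalZmodType).
Hypothesis hausX : hausdorff_space X.
Hypothesis cptX : compact [set: X].
Variable I : (X -> R) -> R.
Hypothesis HI : invariant_mean I.
Variable k : X -> R.
Hypothesis ck : continuous k.
Implicit Types (f g h : X -> R) (c e : R).

Local Notation inner := (inner I).

Definition convol g (x : X) := I (fun y => k (x - y) * g y).

Let cts_k (T : topologicalType) (a b : T -> X) :
  continuous a -> continuous b -> continuous (fun t => k (a t - b t)).
Proof.
by move=> ca cb; apply: cts_comp => // t; apply: cvg_subg; [exact: ca|exact: cb].
Qed.

Let cts_k2 : continuous (fun p : X * X => k (p.1 - p.2)).
Proof. by apply: (@cts_k _ fst snd); [exact: cts_fst|exact: cts_snd]. Qed.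

Let cts_kr x : continuous (fun y => k (x - y)).
Proof. by apply: (@cts_k _ (fun=> x) id); [exact: cts_cstg|exact: cts_id]. Qed.

Let cts_kl y : continuous (fun x => k (x - y)).
Proof. by apply: (@cts_k _ id (fun=> y)); [exact: cts_id|exact: cts_cstg]. Qed.

Let cts_integrand g x : continuous g -> continuous (fun y => k (x - y) * g y).
Proof.
by move=> cg; apply: ctsM.
Qed.

Lemma conv_cts g : continuous g -> continuous (convol g).
Proof.
move=> cg; apply: (cts_mean2 cptX HI (F := fun x y => k (x - y) * g y)).
apply: ctsM; first exact: cts_k2.
exact: cts_snd_comp.
Qed.

Lemma convD f g : continuous f -> continuous g ->
  convol (fun x => f x + g x) = fun x => convol f x + convol g x.
Proof.
move=> cf cg; apply/funext => x; rewrite /convol -(meanD HI); [|exact: cts_integrand..].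
by congr I; apply/funext => y; rewrite mulrDr.
Qed.

Lemma convZ c f : continuous f -> convol (fun x => c * f x) = fun x => c * convol f x.
Proof.
move=> cf; apply/funext => x; rewrite /convol -(meanZ HI); last exact: cts_integrand.
by congr I; apply/funext => y; rewrite mulrCA.
Qed.

Lemma convBZ c f g : continuous f -> continuous g ->
  convol (fun x => f x - c * g x) = fun x => convol f x - c * convol g x.
Proof.
move=> cf cg; have -> : (fun x => f x - c * g x) = (fun x => f x + (- c) * g x).
  by apply/funext => x; rewrite mulNr.
rewrite convD//; last exact: ctsZ.
by rewrite convZ//; apply/funext => x; rewrite mulNr.
Qed.

Lemma conv_translate a g : continuous g ->
  convol (fun x => g (x + a)) = fun x => convol g (x + a).
Proof.
move=> cg; apply/funext => x; rewrite /convol.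
rewrite -(mean_translate HI a (f := fun y => k (x + a - y) * g y)); last exact: cts_integrand.
by congr I; apply/funext => y; rewrite opprD addrACA subrr addr0.
Qed.

Lemma conv_mean g : continuous g -> I (convol g) = I k * I g.
Proof.
move=> cg; rewrite (mean_fubini hausX cptX HI (F := fun x y => k (x - y) * g y)).
  rewrite -(meanZ HI)//; congr I; apply/funext => y.
  rewrite mulrC -(mean_translate HI (- y) ck) -(meanZ HI).
    by congr I; apply/funext => x; rewrite mulrC.
  exact: cts_kl.
apply: ctsM; first exact: cts_k2.
exact: cts_snd_comp.
Qed.

Lemma conv_sym f g : (forall x, k (- x) = k x) -> continuous f -> continuous g ->
  inner (convol f) g = inner f (convol g).
Proof.
move=> ks cf cg; rewrite /inner.
pose F x y := k (x - y) * f y * g x.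
have cF : continuous (fun p : X * X => F p.1 p.2).
  apply: ctsM; last exact: cts_fst_comp.
  apply: ctsM; first exact: cts_k2.
  exact: cts_snd_comp.
transitivity (I (fun x => I (F x))).
  congr I; apply/funext => x; rewrite mulrC -(meanZ HI); last exact: cts_integrand.
  by congr I; apply/funext => y; rewrite mulrC.
rewrite (mean_fubini hausX cptX HI cF); congr I; apply/funext => y.
rewrite -(meanZ HI); last exact: cts_integrand.
by congr I; apply/funext => x; rewrite /F -(ks (x - y)) opprB; ring.
Qed.

(** A modulus of continuity of the kernel is one for every convolution of a
    function in the unit ball; this is the compactness of the operator. *)
Lemma conv_modulus g x z e : continuous g -> (forall y, `|k (x - y) - k (z - y)| <= e) ->
  (convol g x - convol g z) ^+ 2 <= e ^+ 2 * inner g g.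
Proof.
move=> cg ke; have cd : continuous (fun y => k (x - y) - k (z - y)).
  exact: ctsB.
have -> : convol g x - convol g z = inner (fun y => k (x - y) - k (z - y)) g.
  rewrite -(meanB HI); [|exact: cts_integrand..].
  by congr I; apply/funext => y; rewrite mulrBl.
apply: le_trans (cauchy_schwarz cptX HI cd cg) _.
apply: ler_wpM2r; first exact: (inner_ge0 HI).
rewrite -(mean_cst HI (e ^+ 2)); apply: (mean_le HI); [exact: ctsM|exact: cts_cst|].
move=> y; rewrite -expr2 -[_ ^+ 2]real_normK ?num_real// lerXn2r ?nnegrE//.
exact: le_trans (normr_ge0 _) (ke y).
Qed.

Variable M : R.
Hypothesis kM : forall x, `|k x| <= M.

Let M0 : 0 <= M. Proof. exact: le_trans (normr_ge0 _) (kM 0). Qed.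

Lemma conv_bound g x : continuous g -> convol g x ^+ 2 <= M ^+ 2 * inner g g.
Proof.
move=> cg; have cd : continuous (fun y => k (x - y)).
  exact: cts_kr.
apply: le_trans (cauchy_schwarz cptX HI cd cg) _.
apply: ler_wpM2r; first exact: (inner_ge0 HI).
rewrite -(mean_cst HI (M ^+ 2)); apply: (mean_le HI); [exact: ctsM|exact: cts_cst|].
by move=> y; rewrite -expr2 -[_ ^+ 2]real_normK ?num_real// lerXn2r ?nnegrE.
Qed.

Lemma conv_sup_bound g e : continuous g -> (forall x, `|g x| <= e) ->
  forall x, `|convol g x| <= M * e.
Proof.
move=> cg ge x; rewrite -(mean_cst HI (M * e)).
apply: (mean_norm_le HI); [exact: cts_integrand|exact: cts_cst|].
by move=> y; rewrite normrM; apply: ler_pM.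
Qed.

Hypothesis ksym : forall x, k (- x) = k x.

Definition zero_mean g := continuous g /\ I g = 0.

Lemma zero_mean_conv g : zero_mean g -> zero_mean (convol g).
Proof. by move=> [cg g0]; split; [exact: conv_cts|rewrite conv_mean// g0 mulr0]. Qed.

Let gain := [set r | exists g, [/\ zero_mean g, inner g g <= 1 & r = inner (convol g) (convol g)]].

Let L := sup gain.

Let gain_ub : has_sup gain.
Proof.
split.
  exists (inner (convol (fun=> 0)) (convol (fun=> 0))), (fun=> 0); split => //.
    by split; [exact: cts_cst|exact: (mean0 HI)].
  rewrite /inner (_ : (fun _ => _) = fun=> 0) ?(mean0 HI)//.
  by apply/funext => x; rewrite mulr0.
exists (M ^+ 2) => _ [g [[cg _] g1 ->]].
rewrite -[leRHS](mean_cst HI); apply: (mean_le HI); [|exact: cts_cst|].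
  by apply: ctsM; exact: conv_cts.
move=> x; rewrite -expr2; apply: le_trans (conv_bound x cg) _.
by apply: ler_piMr => //; exact: sqr_ge0.
Qed.

Let conv_le g : zero_mean g -> inner (convol g) (convol g) <= L * inner g g.
Proof.
move=> [cg g0].
have [gg0|gn0] := eqVneq (inner g g) 0.
  rewrite gg0 mulr0 /inner (_ : (fun _ => _) = fun=> 0) ?(mean0 HI)//.
  apply/funext => x; rewrite (_ : convol g x = 0) ?mulr0//.
  rewrite -[RHS](mean0 HI); congr I; apply/funext => y.
  by rewrite (inner_eq0 cptX HI cg gg0) mulr0.
have gp : 0 < inner g g by rewrite lt_neqAle eq_sym gn0 (inner_ge0 HI).
pose s := (Num.sqrt (inner g g))^-1.
have s2 : s ^+ 2 = (inner g g)^-1 by rewrite exprVn sqr_sqrtr// ltW.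
have sE h : continuous h -> inner (fun x => s * h x) (fun x => s * h x) = s ^+ 2 * inner h h.
  by move=> ch; rewrite innerZl//; [rewrite innerC innerZl// mulrA|exact: ctsZ].
rewrite -ler_pdivrMr// mulrC -s2 -sE; last exact: conv_cts.
apply: sup_ubound; first by case: gain_ub.
exists (fun x => s * g x); split => //; last by rewrite convZ.
  by split; [exact: ctsZ|rewrite (meanZ HI)// g0 mulr0].
by rewrite sE// s2 mulVf.
Qed.

Variable g0 : X -> R.
Hypothesis g0Z : zero_mean g0.
Hypothesis g0n0 : exists x, convol g0 x != 0.

Let L0 : 0 < L.
Proof.
have cg0 := proj1 g0Z.
have h : 0 < inner (convol g0) (convol g0).
  have [x gx] := g0n0; have cc := conv_cts cg0.
  apply: (mean_gt0 cptX HI (x0 := x)); [exact: ctsM| |by rewrite mulf_neq0].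
  by move=> y; rewrite -expr2 sqr_ge0.
have := lt_le_trans h (conv_le g0Z); have := inner_ge0 HI cg0.
by rewrite le_eqVlt => /orP[/eqP <-|gg0]; [rewrite mulr0 ltxx|rewrite pmulr_lgt0].
Qed.

Let near_max d : 0 < d -> exists g,
  [/\ zero_mean g, inner g g <= 1, L / 2 < inner (convol g) (convol g) &
      forall x, `|convol (convol (convol g)) x - L * convol g x| <= d].
Proof.
(* The expansion below bounds the defect of the eigenvalue equation by [L * e]
   in mean square, and one more convolution makes this a uniform bound. *)
move=> d0; pose e := Num.min (L / 2) (d ^+ 2 / ((M ^+ 2 + 1) * L)).
have M1 : 0 < M ^+ 2 + 1 by rewrite ltr_wpDl// sqr_ge0.
have e0 : 0 < e by rewrite lt_min !divr_gt0// ?exprn_gt0// mulr_gt0.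
have [_ [g [Zg g1 ->] Lg]] := sup_adherent e0 gain_ub; rewrite -/L in Lg.
have Zcg := zero_mean_conv Zg; have Zccg := zero_mean_conv Zcg.
have [cg _] := Zg; have [ccg _] := Zcg; have [cccg _] := Zccg.
exists g; split => //.
  by apply: le_lt_trans Lg; have : e <= L / 2 by [rewrite ge_min lexx]; lra.
move=> x; rewrite -ler_sqr ?nnegrE// ?(ltW d0)// real_normK ?num_real//.
have -> : convol (convol (convol g)) x - L * convol g x =
          convol (fun y => convol (convol g) y - L * g y) x by rewrite convBZ.
have cb : continuous (fun y => convol (convol g) y - L * g y) by apply: ctsB => //; exact: ctsZ.
apply: le_trans (conv_bound x cb) _; rewrite innerBZ// [inner (convol (convol g)) g](conv_sym ksym)//.
have h1 := conv_le Zcg.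
set a := inner (convol g) (convol g) in Lg h1 *; set b := inner _ _ in h1 *.
have h2 : b - L * a *+ 2 + L ^+ 2 * inner g g <= L * e.
  have : L ^+ 2 * inner g g <= L ^+ 2 by apply: ler_piMr => //; exact: sqr_ge0.
  have : L * (L - e) <= L * a by rewrite ler_wpM2l// ltW.
  by move: h1; rewrite expr2 mulrBr mulr2n; lra.
apply: (@le_trans _ _ ((M ^+ 2 + 1) * (L * e))).
  apply: le_trans (ler_wpM2l (sqr_ge0 M) h2) _.
  by rewrite ler_wpM2r ?lerDl// mulr_ge0// ltW.
rewrite mulrA mulrC -ler_pdivlMr; last exact: mulr_gt0.
by rewrite ge_min lexx orbT.
Qed.

(** The square of the convolution operator is self-adjoint and compact on functions
    of mean zero, so its norm is an eigenvalue; the number [l] is that norm. *)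
Theorem conv_eigenfunction : exists l h,
  [/\ 0 < l, zero_mean h, exists x, h x != 0 & convol (convol h) = fun x => l * h x].
Proof.
have dn n : 0 < (n.+1%:R : R)^-1 by rewrite invr_gt0.
have [g_ g_P] := choice (fun n => near_max (dn n)).
have gZ n : zero_mean (g_ n) by case: (g_P n).
have cg n : continuous (convol (g_ n)) by apply: conv_cts; case: (gZ n).
have hb n x : `|convol (g_ n) x| <= M.
  rewrite -ler_sqr ?nnegrE// real_normK ?num_real//.
  have [[cgn _] g1 _ _] := g_P n; apply: le_trans (conv_bound x cgn) _.
  by apply: ler_piMr => //; exact: sqr_ge0.
have [|h ch Hh] := equicontinuous_cluster cptX hb.
  move=> e e0; apply: filterS (compact_group_uniform cptX ck e0) => v Hv n x.
  have [[cgn _] g1 _ _] := g_P n.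
  rewrite -ler_sqr ?nnegrE// ?(ltW e0)// real_normK ?num_real//.
  apply: le_trans (conv_modulus cgn (e := e) _) _.
    by move=> y; have := Hv (x - y); rewrite addrAC.
  by apply: ler_piMr => //; exact: sqr_ge0.
have small a b : 0 <= b -> (forall e, 0 < e -> `|a| <= b * e) -> a = 0 :> R.
  move=> b0 H; apply/eqP; rewrite -normr_le0; apply/ler_addgt0Pr => e e0.
  have b1 : 0 < b + 1 by rewrite ltr_wpDl.
  have := H (e / (b + 1)) (divr_gt0 e0 b1); move/le_trans; apply.
  by rewrite add0r mulrA ler_pdivrMr// mulrC ler_pM2l// lerDl.
exists L, h; split => //.
- split => //; apply: (small _ 1) => // e e0; rewrite mul1r.
  have [n _ Hn] := Hh e 0%N e0.
  have -> : I h = - (I (convol (g_ n)) - I h).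
    by have [_ ->] := zero_mean_conv (gZ n); rewrite sub0r opprK.
  by rewrite normrN; exact: (mean_dist_le HI).
- apply: contrapT => /forallNP h0.
  have hE x : h x = 0 by apply/eqP/negP => hx; apply: (h0 x); apply/negP.
  pose e := Num.min 1 (L / 2).
  have e0 : 0 < e by rewrite lt_min ltr01 divr_gt0.
  have [n _ Hn] := Hh e 0%N e0; have [_ _ + _] := g_P n; apply/negP; rewrite -leNgt.
  rewrite -(mean_cst HI (L / 2)); apply: (mean_le HI); [exact: ctsM|exact: cts_cst|].
  move=> x; have := Hn x; rewrite hE subr0 => Hx.
  rewrite -expr2 -[_ ^+ 2]real_normK ?num_real//.
  have e1 : e <= 1 by rewrite ge_min lexx.
  have e2 : e <= L / 2 by rewrite ge_min lexx orbT.
  apply: le_trans e2; rewrite expr2 -[leRHS]mulr1.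
  by apply: ler_pM => //; exact: le_trans Hx e1.
- apply/funext => x; apply/eqP; rewrite -subr_eq0; apply/eqP.
  apply: (small _ (M * M + 1 + L)) => [|e e0].
    by rewrite !addr_ge0// ?mulr_ge0// ltW.
  have [N _ HN] := @near_infty_natSinv_lt R (PosNum e0).
  have [n Nn Hn] := Hh e N e0.
  have [[cgn _] _ _ Hx] := g_P n.
  have e1 : `|convol (convol (convol (g_ n))) x - L * convol (g_ n) x| <= e.
    by apply: le_trans (Hx x) _; apply: ltW; exact: (HN n Nn).
  have e2 : `|convol (convol (convol (g_ n))) x - convol (convol h) x| <= M * (M * e).
    have cd : continuous (fun y => convol (g_ n) y - 1 * h y).
      by apply: ctsB => //; exact: ctsZ.
    have := conv_sup_bound (e := M * e) (conv_cts cd).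
    rewrite convBZ// convBZ; [|exact: conv_cts..].
    move=> H; have {H} := H _ x; rewrite mul1r; apply.
    have := conv_sup_bound (e := e) cd; rewrite convBZ//; apply.
    by move=> y; rewrite mul1r.
  have e3 : `|L * convol (g_ n) x - L * h x| <= L * e.
    by rewrite -mulrBr normrM gtr0_norm// ler_pM2l.
  move: e1 e2 e3; rewrite !ler_norml !mulrDl mul1r -!mulrA.
  by move=> /andP[? ?] /andP[? ?] /andP[? ?]; apply/andP; split; lra.
Qed.

End Convolution.

(** * Nondegenerate kernels and commuting matrices *)

Section Kernel.
Variables (R : realType) (X : topologicalZmodType).
Hypothesis hausX : hausdorff_space X.
Hypothesis cptX : compact [set: X].
Variable I : (X -> R) -> R.
Hypothesis HI : invariant_mean I.

Lemma continuous_bounded (f : X -> R) : continuous f -> exists M, forall x, `|f x| <= M.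
Proof.
move=> cf; have : compact (f @` setT).
  by apply: continuous_compact => //; exact: continuous_subspaceT.
move=> /compact_bounded [M [Mr HM]]; exists (M + 1) => x.
by apply: (HM (M + 1)); [rewrite ltrDl|exists x].
Qed.

(** A kernel concentrated so close to [0] that convolution hardly changes a given
    function of mean zero cannot annihilate it. *)
Lemma exists_nondegenerate_kernel (a : X) : a != 0 -> exists k g,
  [/\ continuous k, forall x, k (- x) = k x, zero_mean I g & exists x : X, convol I k g x != 0].
Proof.
move=> an0.
have [u [cu u0 u01 _ uV]] : exists u : X -> R,
    [/\ continuous u, forall x, 0 <= u x, u 0 = 1, forall x, u (- x) = u x
      & forall x, u x != 0 -> (~` [set a]) x].
  apply: symmetric_bump => //; apply: open_nbhs_nbhs; split.
    by apply: closed_openC; exact/accessible_closed_set1/hausdorff_accessible.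
  by move=> /= e; move/eqP: an0; rewrite -e.
have ua : u a = 0 by apply/eqP/negP => /negP /uV; apply.
pose g x := u x - I u.
have cg : continuous g by apply: ctsB => //; exact: cts_cst.
have Zg : zero_mean I g.
  by split=> //; rewrite (meanB HI)//; [rewrite (mean_cst HI) subrr|exact: cts_cst].
have [x0 gx0] : exists x0, g x0 != 0.
  (* [g] takes two distinct values, at [0] and at [a] *)
  have [e|] := eqVneq (g 0) 0; last by exists 0.
  exists a; rewrite /g ua sub0r oppr_eq0; apply/eqP => Iu.
  by move: e; rewrite /g u01 Iu subr0 => /eqP; rewrite oner_eq0.
have g2 : 0 < `|g x0| / 2 by rewrite divr_gt0// normr_gt0.
have [k [ck k0 k01 ks kV]] := symmetric_bump R hausX cptX (compact_group_uniform cptX cg g2).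
exists k, g; split=> //; exists x0; apply/eqP => c0.
have ckr : continuous (fun y => k (x0 - y)).
  apply: (@cts_comp _ _ _ (fun y : X => x0 - y)) => // y.
  by apply: cvg_subg; [exact: cvg_cst|exact: cvg_id].
have : 0 < g x0 ^+ 2 / 2 * I (fun y => k (x0 - y)).
  apply: mulr_gt0; first by rewrite divr_gt0// exprn_even_gt0.
  by apply: (mean_gt0 cptX HI (x0 := x0)) => //; rewrite subrr k01 oner_eq0.
suff : g x0 ^+ 2 / 2 * I (fun y => k (x0 - y)) <= g x0 * convol I k g x0.
  by rewrite c0 mulr0 leNgt => /negP.
have ckg : continuous (fun y => k (x0 - y) * g y) by exact: ctsM.
rewrite /convol -!(meanZ HI)//; apply: (mean_le HI); [exact: ctsZ..|].
move=> y; have [->|kn0] := eqVneq (k (x0 - y)) 0; first by rewrite mul0r !mulr0.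
have := kV (y - x0); rewrite -ks opprB => /(_ kn0) /(_ x0).
rewrite [x0 + _]addrC subrK => H; rewrite mulrCA mulrC.
apply: ler_wpM2l => //; have := ler_pM (normr_ge0 _) (normr_ge0 _) (lexx `|g x0|) H.
rewrite -normrM ler_norml => /andP[+ _]; rewrite mulrA -expr2 real_normK ?num_real//.
by rewrite mulrBr -expr2; lra.
Qed.

End Kernel.

Section CommonEigenvector.

(** The finite version extends to arbitrary families by induction on the dimension:
    a member that is not scalar has a proper eigenspace, preserved by the others. *)
Lemma common_eigenvector_family (C : numClosedFieldType) (T : Type) n (A : T -> 'M[C]_n) :
  (0 < n)%N -> (forall s t, comm_mx (A s) (A t)) ->
  exists2 v : 'rV_n, v != 0 & forall t, stablemx v (A t).
Proof.
have [m nm] := ubnP n; elim: m n nm A => [//|m IH] n nm A n0 Ac.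
have [[t [a [ea rk]]]|small] := pselect (exists t a,
    eigenvalue (A t) a /\ (\rank (eigenspace (A t) a) < n)%N).
  have st s : stablemx (eigenspace (A t) a) (A s).
    by apply: comm_mx_stable_eigenspace; exact: Ac.
  have [||s s'|v vn0 vP] := IH (\rank (eigenspace (A t) a)) _
     (fun s => restrictmx (eigenspace (A t) a) (A s)).
  - exact: leq_trans rk _.
  - by rewrite lt0n mxrank_eq0.
  - by rewrite /comm_mx -!conjmxM ?inE ?stablemx_row_base ?st// Ac.
  - exists (v *m row_base (eigenspace (A t) a)).
      by rewrite mulmx_free_eq0 ?row_base_free.
    by move=> s; rewrite -stablemx_restrict ?vP// st.
exists (const_mx 1).
  by apply/negP => /eqP/rowP/(_ (Ordinal n0)); rewrite !mxE => /eqP; rewrite oner_eq0.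
move=> t; have [a ea] := eigenvalue_closed (A t) n0.
have full : row_full (eigenspace (A t) a).
  rewrite /row_full eqn_leq rank_leq_col /= leqNgt; apply/negP => rk.
  by apply: small; exists t, a.
by apply/eigenvectorP; exists a; rewrite submx_full.
Qed.

End CommonEigenvector.

(** * Eigenspaces of a convolution operator *)

Lemma complex_sum_scale (R : rcfType) (J : Type) (s : seq J) (z : J -> R[i]%C) (m : J -> R) :
  \sum_(j <- s) z j * (m j)%:C%C =
  ((\sum_(j <- s) complex.Re (z j) * m j) +i* (\sum_(j <- s) complex.Im (z j) * m j))%C.
Proof.
elim: s => [|j s IH]; first by rewrite !big_nil.
rewrite !big_cons IH; case: (z j) => a b.
by apply/eqP; rewrite eq_complex /= !mulr0 subr0 add0r !eqxx.
Qed.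

Section Eigenspace.
Variables (R : realType) (X : topologicalZmodType).
Hypothesis hausX : hausdorff_space X.
Hypothesis cptX : compact [set: X].
Variable I : (X -> R) -> R.
Hypothesis HI : invariant_mean I.
Variable k : X -> R.
Hypothesis ck : continuous k.
Hypothesis ksym : forall x, k (- x) = k x.
Variable l : R.
Hypothesis l0 : 0 < l.

Local Notation inner := (inner I).
Local Notation conv := (convol I k).

Definition eigenfun (h : X -> R) := zero_mean I h /\ conv (conv h) = fun x => l * h x.

Lemma eigenfun_cts h : eigenfun h -> continuous h. Proof. by case=> [[]]. Qed.

Lemma eigenfunZ c h : eigenfun h -> eigenfun (fun x => c * h x).
Proof.
move=> [[ch h0] hE]; split.
  by split; [exact: ctsZ|rewrite (meanZ HI)// h0 mulr0].
rewrite convZ// convZ//; last exact: conv_cts.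
by rewrite hE; apply/funext => x; rewrite mulrCA.
Qed.

Lemma eigenfunD f h : eigenfun f -> eigenfun h -> eigenfun (fun x => f x + h x).
Proof.
move=> [[cf f0] fE] [[ch h0] hE]; split.
  by split; [exact: ctsD|rewrite (meanD HI)// f0 h0 addr0].
rewrite convD// convD//; [|exact: conv_cts..].
by rewrite hE fE; apply/funext => x; rewrite mulrDr.
Qed.

Lemma eigenfun0 : eigenfun (fun=> 0).
Proof.
have c0 : conv (fun=> 0) = fun=> 0.
  by apply/funext => x; rewrite /convol -[RHS](mean0 HI); congr I; apply/funext => y; rewrite mulr0.
by split; [split; [exact: cts_cst|exact: mean0]|rewrite !c0; apply/funext => x; rewrite mulr0].
Qed.

Lemma eigenfun_comb n (c : 'I_n -> R) (h : 'I_n -> X -> R) :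
  (forall i, eigenfun (h i)) -> eigenfun (fun x => \sum_i c i * h i x).
Proof.
move=> hE; elim: (index_enum _) => [|i s IH].
  by under eq_fun do rewrite big_nil; exact: eigenfun0.
by under eq_fun do rewrite big_cons; apply: eigenfunD => //; exact: eigenfunZ.
Qed.

Lemma eigenfun_translate a h : eigenfun h -> eigenfun (fun x => h (x + a)).
Proof.
move=> [[ch h0] hE].
have ca (f : X -> R) : continuous f -> continuous (fun x => f (x + a)).
  move=> cf; apply: (@cts_comp _ _ _ (fun x : X => x + a)) => // x.
  by apply: cvg_addg; [exact: cvg_id|exact: cvg_cst].
split; first by split; [exact: ca|rewrite (mean_translate HI)].
rewrite (conv_translate HI)// (conv_translate HI)//; last exact: conv_cts.
by rewrite hE.
Qed.

Definition orthonormal n (h : 'I_n -> X -> R) :=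
  (forall i, eigenfun (h i)) /\ forall i j, inner (h i) (h j) = (i == j)%:R.

Lemma inner_comb n (c : 'I_n -> R) (h : 'I_n -> X -> R) g : continuous g ->
  (forall i, continuous (h i)) ->
  inner (fun x => \sum_i c i * h i x) g = \sum_i c i * inner (h i) g.
Proof.
move=> cg ch; rewrite /inner.
transitivity (I (fun x => \sum_i c i * (h i x * g x))).
  by congr I; apply/funext => x; rewrite mulr_suml; apply: eq_bigr => i _; rewrite mulrA.
rewrite (mean_sum HI); last by move=> i; apply: ctsZ; exact: ctsM.
by apply: eq_bigr => i _; rewrite (meanZ HI)//; exact: ctsM.
Qed.

(** Bessel's inequality. *)
Lemma orthonormal_bessel n (h : 'I_n -> X -> R) q : orthonormal h -> continuous q ->
  \sum_i inner q (h i) ^+ 2 <= inner q q.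
Proof.
move=> [hE ho] cq; have ch i := eigenfun_cts (hE i).
pose P x := \sum_i inner q (h i) * h i x.
have cP : continuous P by exact: eigenfun_cts (eigenfun_comb _ hE).
have Ph : inner P q = \sum_i inner q (h i) ^+ 2.
  by rewrite inner_comb//; apply: eq_bigr => i _; rewrite innerC expr2.
have PP : inner P P = \sum_i inner q (h i) ^+ 2.
  rewrite inner_comb//; apply: eq_bigr => i _; rewrite expr2; congr (_ * _).
  rewrite innerC inner_comb// (bigD1 i)//= ho eqxx mulr1 big1 ?addr0// => j ji.
  by rewrite ho (negbTE ji) mulr0.
have cd : continuous (fun x => q x - 1 * P x) by apply: ctsB => //; exact: ctsZ.
have := inner_ge0 HI cd; rewrite (innerBZ HI)// [inner q P]innerC Ph PP.
by rewrite expr1n !mul1r mulr2n; lra.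
Qed.

(** The value of an eigenfunction at [x] is a multiple of its inner product with a
    bounded function, so Bessel bounds the sum of the squares of an orthonormal
    family at each [x]; the mean of this sum is the size of the family. *)
Lemma orthonormal_bound : exists N, forall n (h : 'I_n -> X -> R), orthonormal h -> (n <= N)%N.
Proof.
have [M kM] := continuous_bounded cptX ck.
have M0 : 0 <= M by exact: le_trans (normr_ge0 _) (kM 0).
pose B := (M * M) ^+ 2 / l ^+ 2.
have [N NB] : exists N : nat, B <= N%:R.
  by exists (Num.bound B); apply: ltW; apply: archi_boundP; rewrite divr_ge0 ?sqr_ge0// exprn_ge0// ltW.
exists N => n h ho; have [hE hi] := ho; have ch i := eigenfun_cts (hE i).
rewrite -(ler_nat R); apply: le_trans NB.
have -> : n%:R = I (fun x => \sum_i h i x * h i x).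
  rewrite (mean_sum HI); last by move=> i; exact: ctsM.
  under eq_bigr => i _ do rewrite -/(inner _ _) hi eqxx.
  by rewrite sumr_const card_ord.
rewrite -(mean_cst HI B); apply: (mean_le HI); [by apply: cts_sum => i; exact: ctsM|exact: cts_cst|].
move=> x; rewrite /B ler_pdivlMr ?exprn_gt0// mulr_suml.
have ckx : continuous (fun y => k (x - y)).
  apply: (@cts_comp _ _ _ (fun y : X => x - y)) => // y.
  by apply: cvg_subg; [exact: cvg_cst|exact: cvg_id].
pose q := conv (fun y => k (x - y)).
have cq : continuous q by exact: conv_cts.
apply: (@le_trans _ _ (inner q q)).
  apply: le_trans (orthonormal_bessel ho cq); apply: ler_sum => i _.
  have [_ /(congr1 (@^~ x))] := hE i.
  have -> : conv (conv (h i)) x = inner q (h i).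
    by rewrite /q (conv_sym hausX cptX HI).
  by move=> ->; rewrite exprMn mulrC expr2.
rewrite -(mean_cst HI ((M * M) ^+ 2)); apply: (mean_le HI); [exact: ctsM|exact: cts_cst|].
move=> y; rewrite -expr2 -[_ ^+ 2]real_normK ?num_real// lerXn2r ?nnegrE ?mulr_ge0//.
exact: conv_sup_bound.
Qed.

(** A maximal orthonormal family spans, since the normalized defect of its
    expansion could be added to it. *)
Lemma orthonormal_basis : (exists h x, eigenfun h /\ h x != 0) ->
  exists n (h : 'I_n.+1 -> X -> R), orthonormal h /\
    forall f, eigenfun f -> forall x, f x = \sum_i inner f (h i) * h i x.
Proof.
move=> [f0 [x0 [f0E f0x]]].
pose P n := `[< exists h : 'I_n -> X -> R, orthonormal h >].
have [N NP] := orthonormal_bound.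
have P0 : exists n, P n.
  by exists 0%N; apply/asboolP; exists (fun=> fun=> 0); split => -[].
have PN n : P n -> (n <= N)%N by move=> /asboolP[h /NP].
case: (ex_maxnP P0 PN) => n /asboolP[h ho] nmax.
have [hE hi] := ho; have ch i := eigenfun_cts (hE i).
have span f : eigenfun f -> forall x, f x = \sum_i inner f (h i) * h i x.
  move=> fE x; have cf := eigenfun_cts fE; apply/eqP; rewrite -subr_eq0; apply/eqP.
  pose p x := \sum_i inner f (h i) * h i x.
  have pE : eigenfun p by exact: eigenfun_comb.
  pose g x := f x + (-1) * p x.
  have gE : eigenfun g by apply: eigenfunD => //; exact: eigenfunZ.
  have cg := eigenfun_cts gE.
  have gh i : inner g (h i) = 0.
    rewrite /g innerDl//; [|exact: (eigenfun_cts (eigenfunZ _ pE))].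
    rewrite innerZl//; last exact: eigenfun_cts pE.
    rewrite inner_comb// (bigD1 i)//= hi eqxx mulr1 big1 ?addr0; last first.
      by move=> j ji; rewrite hi (negbTE ji) mulr0.
    by rewrite mulN1r subrr.
  suff gg : inner g g = 0.
    by have := inner_eq0 cptX HI cg gg x; rewrite /g mulN1r.
  apply/eqP; apply: contraT => ggn0.
  have gp : 0 < inner g g by rewrite lt_neqAle eq_sym ggn0 (inner_ge0 HI).
  pose s := (Num.sqrt (inner g g))^-1.
  have s2 : s * s * inner g g = 1.
    by rewrite -expr2 exprVn sqr_sqrtr ?mulVf// ltW.
  (* the normalized defect is put in front of the family *)
  pose h' (i : 'I_n.+1) := if unlift ord0 i is Some j then h j else fun x => s * g x.
  have : P n.+1.
    apply/asboolP; exists h'; split.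
      by move=> i; rewrite /h'; case: unliftP => [j _|_]; [exact: hE|exact: eigenfunZ].
    move=> i j; rewrite /h'; case: unliftP => [i' ->|->]; case: unliftP => [j' ->|->].
    - by rewrite hi (inj_eq lift_inj).
    - by rewrite innerC innerZl// gh mulr0 eq_sym (negbTE (neq_lift _ _)).
    - by rewrite innerZl// gh mulr0 (negbTE (neq_lift _ _)).
    - rewrite innerZl//; last exact: ctsZ.
      by rewrite innerC innerZl// mulrA s2 eqxx.
  by move=> /nmax; rewrite ltnn.
case: n => [|n] in h ho nmax hE hi ch span *.
  by move: f0x; rewrite (span _ f0E) big_ord0 eqxx.
by exists n, h.
Qed.

(** Translations act on the eigenspace by commuting real matrices.  The functions
    [f] and [g] are the real and imaginary parts of the combination of the basis
    given by a common complex eigenvector, and [c a], [s a] are those of its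
    eigenvalue for the translation by [a]. *)
Lemma eigenfun_rotation : (exists h x, eigenfun h /\ h x != 0) ->
  exists (f g c s : X -> R), [/\ eigenfun f, eigenfun g, exists x, f x ^+ 2 + g x ^+ 2 != 0 &
    forall x a, f (x + a) = c a * f x - s a * g x /\ g (x + a) = s a * f x + c a * g x].
Proof.
move=> /orthonormal_basis[n [h [ho span]]].
have [hE hi] := ho; have ch i := eigenfun_cts (hE i).
pose tr a i x := h i (x + a).
have trE a i : eigenfun (tr a i) by exact: eigenfun_translate.
pose M a : 'M[R]_n.+1 := \matrix_(i, j) inner (tr a i) (h j).
have trM a i x : h i (x + a) = \sum_j M a i j * h j x.
  by rewrite -/(tr a i x) span//; apply: eq_bigr => j _; rewrite mxE.
have MD a b : M (a + b) = M a *m M b.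
  apply/matrixP => i j; rewrite !mxE.
  have -> : tr (a + b) i = fun x => \sum_k0 M a i k0 * tr b k0 x.
    apply/funext => x; rewrite /tr -trM; congr (h i _).
    by rewrite -addrA [b + a]addrC.
  rewrite inner_comb//; last by move=> k0; exact: eigenfun_cts (trE _ _).
  by apply: eq_bigr => k0 _; rewrite !mxE.
pose MC a : 'M[R[i]%C]_n.+1 := map_mx (real_complex R) (M a).
have MCc a b : comm_mx (MC a) (MC b).
  by rewrite /comm_mx -!map_mxM -!MD addrC.
have [v vn0 vs] := common_eigenvector_family (ltn0Sn n) MCc.
have vE a : exists z, v *m MC a = z *: v by apply/sub_rVP; exact: vs.
have [chi chiP] := choice vE.
pose f x := \sum_i complex.Re (v ord0 i) * h i x.
pose g x := \sum_i complex.Im (v ord0 i) * h i x.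
exists f, g, (fun a => complex.Re (chi a)), (fun a => complex.Im (chi a)); split.
- exact: eigenfun_comb.
- exact: eigenfun_comb.
- apply: contrapT => /forallNP fg0.
  have fg x : f x = 0 /\ g x = 0.
    have /negP := fg0 x; rewrite negbK paddr_eq0 ?sqr_ge0// !sqrf_eq0.
    by move=> /andP[/eqP ? /eqP ?].
  move/eqP: vn0; apply; apply/rowP => i; rewrite mxE.
  have e (c : 'I_n.+1 -> R) : (forall x, \sum_i c i * h i x = 0) -> c i = 0.
    move=> c0; have : inner (fun x => \sum_i c i * h i x) (h i) = 0.
      rewrite -[RHS](mean0 HI); congr I; apply/funext => x; rewrite c0 mul0r //.
    rewrite inner_comb// (bigD1 i)//= hi eqxx mulr1 big1 ?addr0//.
    by move=> j ji; rewrite hi (negbTE ji) mulr0.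
  have := e (fun i => complex.Re (v ord0 i)) (fun x => (fg x).1).
  have := e (fun i => complex.Im (v ord0 i)) (fun x => (fg x).2).
  by case: (v ord0 i) => a b /= -> ->.
- move=> x a.
  (* the eigenvector equation, split into real and imaginary parts below *)
  have key j : ((\sum_i complex.Re (v ord0 i) * M a i j) +i* (\sum_i complex.Im (v ord0 i) * M a i j))%C
      = chi a * v ord0 j.
    have /rowP/(_ j) := chiP a; rewrite [LHS]mxE [RHS]mxE => <-.
    by rewrite -complex_sum_scale; apply: eq_bigr => i _; rewrite [MC a i j]mxE.
  have keyR j : \sum_i complex.Re (v ord0 i) * M a i j =
      complex.Re (chi a) * complex.Re (v ord0 j) - complex.Im (chi a) * complex.Im (v ord0 j).
    by have /(congr1 (@complex.Re R)) := key j => /= ->; case: (chi a) (v ord0 j) => [? ?] [].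
  have keyI j : \sum_i complex.Im (v ord0 i) * M a i j =
      complex.Im (chi a) * complex.Re (v ord0 j) + complex.Re (chi a) * complex.Im (v ord0 j).
    have /(congr1 (@complex.Im R)) := key j => /= ->.
    by case: (chi a) (v ord0 j) => [? ?] [? ?] /=; rewrite addrC.
  have E (w : 'I_n.+1 -> R) : \sum_i w i * h i (x + a) = \sum_j (\sum_i w i * M a i j) * h j x.
    under eq_bigr do rewrite trM mulr_sumr.
    rewrite exchange_big; apply: eq_bigr => j _.
    by rewrite mulr_suml; apply: eq_bigr => i _; rewrite mulrA.
  rewrite /f /g !E; split.
    under eq_bigr do rewrite keyR mulrBl -!mulrA.
    by rewrite sumrB !mulr_sumr.
  under eq_bigr do rewrite keyI mulrDl -!mulrA.
  by rewrite big_split !mulr_sumr.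
Qed.

End Eigenspace.

(** * Characters with values in the reals modulo the integers *)

Section Angle.
Variable R : realType.
Implicit Types t a b : R.

Lemma cos_period t (n : int) : cos (2 * pi * (t + n%:~R)) = cos (2 * pi * t).
Proof.
have pn (u : R) (m : nat) : cos (2 * pi * (u + m%:R)) = cos (2 * pi * u).
  elim: m => [|m IH]; first by rewrite addr0.
  have -> : 2 * pi * (u + m.+1%:R) = 2 * pi * (u + m%:R) + pi *+ 2.
    by rewrite -natr1 mulr2n; ring.
  by rewrite cosD2pi.
case: n => m; first exact: pn.
rewrite NegzE mulrNz; have := pn (t - m.+1%:R) m.+1.
by rewrite subrK => ->.
Qed.

Lemma cos_eq1_int t : cos (2 * pi * t) = 1 -> t \is a Num.int.
Proof.
have p0 : 0 < 2 * pi :> R by rewrite mulr_gt0 ?pi_gt0.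
have n0 := floor_le t; have n1 := floorD1_gt t.
set n := Num.floor t in n0 n1.
have -> : t = (t - n%:~R) + n%:~R by rewrite subrK.
rewrite cos_period; set u := t - n%:~R.
have u0 : 0 <= u by rewrite subr_ge0.
have u1 : u < 1 by rewrite ltrBlDr addrC -intrD1.
move=> cu; suff -> : u = 0 by rewrite add0r intr_int.
have itv (v : R) : 0 <= v -> v <= 1 / 2 -> 2 * pi * v \in `[0, pi].
  move=> v0 v2; rewrite in_itv /= mulr_ge0 ?(ltW p0)//=.
  by have := ler_wpM2l (ltW p0) v2; lra.
have z0 : (0 : R) \in `[0, pi] by rewrite in_itv /= lexx pi_ge0.
have inj (v : R) : 0 <= v -> v <= 1 / 2 -> cos (2 * pi * v) = 1 -> v = 0.
  move=> v0 v2 cv; have cv0 : cos (2 * pi * v) = cos 0 by rewrite cos0.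
  have /eqP := cos_inj (itv _ v0 v2) z0 cv0.
  by rewrite mulf_eq0 gt_eqF//= => /eqP.
have [u2|u2] := leP u (1 / 2); first exact: inj.
have : 1 - u = 0; last lra.
apply: inj; [lra|lra|].
have -> : 2 * pi * (1 - u) = - (2 * pi * (u + (-1)%:~R)) by rewrite mulrN1z; ring.
by rewrite cosN cos_period.
Qed.

Lemma angle_of_rotation a b : a ^+ 2 + b ^+ 2 = 1 ->
  exists t, [/\ cos (2 * pi * t) = a, sin (2 * pi * t) = b & `|t| <= 1 / 2].
Proof.
move=> ab.
have a1 : -1 <= a <= 1.
  by rewrite -ler_norml -(@ler_pXn2r _ 2) ?nnegrE// expr1n real_normK ?num_real//; have := sqr_ge0 b; lra.
have p0 : 0 < 2 * pi :> R by rewrite mulr_gt0 ?pi_gt0.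
have ac : cos (acos a) = a by apply: acosK.
have as_ : sin (acos a) = `|b|.
  by rewrite sin_acos// (_ : 1 - a ^+ 2 = b ^+ 2) ?sqrtr_sqr//; lra.
have al : acos a <= pi by exact: acos_lepi.
have a0 : 0 <= acos a by exact: acos_ge0.
have tE (u : R) : 2 * pi * (u / (2 * pi)) = u by rewrite mulrC divfK// gt_eqF.
have tn (u : R) : `|u| = acos a -> `|u / (2 * pi)| <= 1 / 2.
  move=> uE; rewrite normrM uE gtr0_norm ?invr_gt0// ler_pdivrMr//.
  by apply: le_trans al _; lra.
have [b0|b0] := leP 0 b.
  exists (acos a / (2 * pi)); rewrite tE ac as_ ger0_norm//; split=> //.
  by apply: tn; rewrite ger0_norm.
exists (- acos a / (2 * pi)); rewrite tE cosN sinN ac as_ ltr0_norm// opprK; split=> //.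
by apply: tn; rewrite normrN ger0_norm.
Qed.

(** Closeness of the cosine to [1] controls the angle, which stands for the
    continuity of the angle near the trivial rotation. *)
Lemma small_angle e : 0 < e -> e <= 1 / 2 -> exists2 d, 0 < d &
  forall t, `|t| <= 1 / 2 -> 1 - d <= cos (2 * pi * t) -> `|t| <= e.
Proof.
move=> e0 e2; have p0 : 0 < 2 * pi :> R by rewrite mulr_gt0 ?pi_gt0.
have itv t : 0 <= t -> t <= 1 / 2 -> 2 * pi * t \in `[0, pi].
  move=> t0 t2; rewrite in_itv /= mulr_ge0 ?(ltW p0)//=.
  by have := ler_wpM2l (ltW p0) t2; lra.
have z0 : (0 : R) \in `[0, pi] by rewrite in_itv /= lexx pi_ge0.
have c1 : cos (2 * pi * e) < 1.
  by rewrite -[ltRHS](cos0 R) ltr_cos// ?itv ?(ltW e0)// mulr_gt0.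
exists ((1 - cos (2 * pi * e)) / 2); first by rewrite divr_gt0// subr_gt0.
move=> t t2 ct; rewrite leNgt; apply/negP => et.
have : cos (2 * pi * `|t|) < cos (2 * pi * e).
  by rewrite ltr_cos ?itv ?(ltW e0)// ltr_pM2l.
have -> : cos (2 * pi * `|t|) = cos (2 * pi * t).
  by have [/ger0_norm-> //|/ltr0_norm->] := leP 0 t; rewrite mulrN cosN.
by move: ct c1; lra.
Qed.

End Angle.

Section Character.
Variables (R : realType) (X : topologicalZmodType).

(** A character with values in the reals modulo the integers, described by an
    arbitrary real-valued lift, so that integer combinations of characters are
    combinations of real functions. *)
Definition character (r : X -> R) : Prop :=
  (forall x y, r (x + y) - r x - r y \is a Num.int) /\
  (forall e, 0 < e -> \forall x \near (0 : X), exists n : int, `|r x - n%:~R| <= e).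

Hypothesis hausX : hausdorff_space X.
Hypothesis cptX : compact [set: X].
Variable I : (X -> R) -> R.
Hypothesis HI : invariant_mean I.

(** By Bernoulli's inequality, a value above [1] would have unbounded powers. *)
Lemma multiplicative_bounded_le1 (p : X -> R) M : (forall a, 0 <= p a) ->
  (forall a b, p (a + b) = p a * p b) -> (forall a, p a <= M) -> forall a, p a <= 1.
Proof.
move=> p0 pM pB a; rewrite leNgt; apply/negP => pa.
have H n : 1 + (p a - 1) * n.+1%:R <= p (a *+ n.+1).
  elim: n => [|n IH]; first by rewrite mulr1 addrC subrK.
  rewrite mulrS pM; apply: le_trans (ler_wpM2l (p0 a) IH).
  rewrite -natr1; set u : R := n.+1%:R.
  have : 0 <= (p a - 1) ^+ 2 * u by rewrite mulr_ge0 ?sqr_ge0.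
  by rewrite expr2; lra.
have d0 : 0 < p a - 1 by rewrite subr_gt0.
have M0 : 0 <= M / (p a - 1) by rewrite divr_ge0 ?(ltW d0)// (le_trans (p0 a)).
have := archi_boundP M0; set N := Num.bound _.
rewrite ltr_pdivrMr// => HN; have := le_trans (H N) (pB _).
by rewrite -natr1 mulrDr mulr1; lra.
Qed.

(** The eigenvalues of the translations form a continuous family of rotations; it
    is not constant, since an invariant function of mean zero vanishes. *)
Lemma rotation_exists (a0 : X) : a0 != 0 -> exists c s : X -> R,
  [/\ continuous c, forall x y, c (x + y) = c x * c y - s x * s y,
      forall x y, s (x + y) = s x * c y + c x * s y,
      forall x, c x ^+ 2 + s x ^+ 2 = 1 & exists x, c x != 1].
Proof.
move=> a0n; have [k [g0 [ck ks Zg [x1 gx1]]]] := exists_nondegenerate_kernel hausX cptX HI a0n.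
have [M kM] := continuous_bounded cptX ck.
have [l [h [l0 Zh [x2 hx2] hE]]] :=
  conv_eigenfunction hausX cptX HI ck kM ks Zg (ex_intro _ x1 gx1).
have [|f [g [c [s [[[cf f0] _] [[cg g0'] _] [x0 N0] fgE]]]]] :=
  eigenfun_rotation hausX cptX HI ck ks l0.
  by exists h, x2.
pose N := f x0 ^+ 2 + g x0 ^+ 2; rewrite -/N in N0.
(* the rotation is determined by its effect on one nonzero vector, which
   makes it continuous and additive in the angle *)
have cE a : c a = (f (x0 + a) * f x0 + g (x0 + a) * g x0) / N.
  by have [-> ->] := fgE x0 a; rewrite /N in N0 *; field.
have sE a : s a = (g (x0 + a) * f x0 - f (x0 + a) * g x0) / N.
  by have [-> ->] := fgE x0 a; rewrite /N in N0 *; field.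
have ctr (q : X -> R) : continuous q -> continuous (fun a => q (x0 + a)).
  move=> cq; apply: (@cts_comp _ _ _ (fun x : X => x0 + x)) => // x.
  by apply: cvg_addg; [exact: cvg_cst|exact: cvg_id].
have cc : continuous c.
  have -> : c = fun a => N^-1 * (f x0 * f (x0 + a) + g x0 * g (x0 + a)).
    by apply/funext => a; rewrite cE; ring.
  by apply: ctsZ; apply: ctsD; apply: ctsZ; exact: ctr.
have cs : continuous s.
  have -> : s = fun a => N^-1 * (f x0 * g (x0 + a) - g x0 * f (x0 + a)).
    by apply/funext => a; rewrite sE; ring.
  by apply: ctsZ; apply: ctsB; apply: ctsZ; exact: ctr.
have cD x y : c (x + y) = c x * c y - s x * s y.
  rewrite cE addrA; have [-> ->] := fgE (x0 + x) y; have [-> ->] := fgE x0 x.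
  by rewrite /N in N0 *; field.
have sD x y : s (x + y) = s x * c y + c x * s y.
  rewrite sE addrA; have [-> ->] := fgE (x0 + x) y; have [-> ->] := fgE x0 x.
  by rewrite /N in N0 *; field.
have c00 : c 0 = 1 by rewrite cE addr0 -!expr2 divff.
have s00 : s 0 = 0 by rewrite sE addr0 [g x0 * _]mulrC subrr mul0r.
pose p a := c a ^+ 2 + s a ^+ 2.
have p0 a : 0 <= p a by rewrite addr_ge0 ?sqr_ge0.
have pM a b : p (a + b) = p a * p b by rewrite /p cD sD; ring.
have cp : continuous p by rewrite /p; apply: ctsD; apply: ctsM.
have [B pB] := continuous_bounded cptX cp.
have p1 a : p a <= 1.
  by apply: (multiplicative_bounded_le1 (M := B)) => // b; apply: le_trans (pB b); exact: ler_norm.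
have pE a : p a = 1.
  apply/eqP; rewrite eq_le p1 /=.
  have : p a * p (- a) = 1.
    by rewrite -pM (_ : a + - a = 0) ?subrr// /p c00 s00 expr1n expr0n addr0.
  by move=> <-; apply: ler_piMr.
exists c, s; split => //.
apply: contrapT => /forallNP c1.
have c1' x : c x = 1 by apply/eqP/negP => /negP; exact: c1.
have s0 x : s x = 0.
  by have := pE x; rewrite /p c1' expr1n => /eqP; rewrite addrC -subr_eq0 addrK sqrf_eq0 => /eqP.
have zero q : continuous q -> I q = 0 -> (forall x, q (x0 + x) = q x0) -> q x0 = 0 :> R.
  move=> cq q0 qx; rewrite -q0 -[LHS](mean_cst HI); congr I; apply/funext => x.
  by rewrite -(qx (x - x0)) addrC subrK.
have fx0 : f x0 = 0.
  apply: zero => // x; have [-> _] := fgE x0 x.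
  by rewrite c1' s0 mul0r subr0 mul1r.
have gx0 : g x0 = 0.
  apply: zero => // x; have [_ ->] := fgE x0 x.
  by rewrite c1' s0 mul0r add0r mul1r.
by move/eqP: N0; apply; rewrite /N fx0 gx0 expr0n addr0.
Qed.

Theorem nontrivial_character (a0 : X) : a0 != 0 ->
  exists r : X -> R, character r /\ exists x, r x \isn't a Num.int.
Proof.
move=> /rotation_exists[c [s [cc cD sD cs1 [x1 cx1]]]].
have [r rP] := choice (fun x => angle_of_rotation (cs1 x)).
exists r; split; last first.
  exists x1; apply/negP => /intrP[n rn]; have [c1 _ _] := rP x1.
  by move: cx1; rewrite -c1 rn -[n%:~R]add0r cos_period mulr0 cos0 eqxx.
have c0 : c 0 = 1.
  have := cs1 0; have := cD 0 0; have := sD 0 0; rewrite addr0 => h1 h2 h3.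
  have /eqP : (c 0 - 1) * (2 * c 0 + 1) = 0.
    rewrite (_ : _ * _ = (c 0 ^+ 2 + s 0 ^+ 2 - 1) + (c 0 * c 0 - s 0 * s 0 - c 0)); last by ring.
    by rewrite h3 -h2 !subrr addr0.
  rewrite mulf_eq0 => /orP[/eqP/eqP|/eqP cN]; first by rewrite subr_eq0 => /eqP.
  have cE : c 0 = - (1 / 2) by lra.
  have s0 : s 0 = 0 by rewrite cE in h1; lra.
  by move: h2; rewrite cE s0; lra.
split.
  move=> x y; apply: cos_eq1_int.
  have [cx sx _] := rP x; have [cy sy _] := rP y; have [cxy sxy _] := rP (x + y).
  rewrite !mulrBr -addrA -opprD cosB cosD sinD cx sx cy sy cxy sxy cD sD.
  rewrite (_ : _ + _ = (c x ^+ 2 + s x ^+ 2) * (c y ^+ 2 + s y ^+ 2)); last by ring.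
  by rewrite !cs1 mulr1.
move=> e e0; have e20 : 0 < Num.min e (1 / 2) by rewrite lt_min e0 divr_gt0.
have e21 : Num.min e (1 / 2) <= 1 / 2 by rewrite ge_min lexx orbT.
have [d d0 dP] := small_angle e20 e21.
have d1 : 1 - d < c 0 by rewrite c0; lra.
apply: filterS (cvgr_gt _ (cc 0) _ d1) => x cx; exists 0; rewrite subr0.
have [cE _ r2] := rP x; apply: le_trans (dP _ r2 _) _; last by rewrite ge_min lexx.
by rewrite cE ltW.
Qed.

End Character.

(** * Linear dependence of two characters *)

Section Centered.
Variable R : realType.
Implicit Types t u e : R.

(** The representative of a real number modulo the integers in the interval of
    length one centered at zero. *)
Definition centered t := t - (Num.floor (t + 1 / 2))%:~R.

Lemma centered_int t : t - centered t \is a Num.int.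
Proof. by rewrite opprB addrC subrK intr_int. Qed.

Lemma centered_half t : `|centered t| <= 1 / 2.
Proof.
have := floor_le (t + 1 / 2); have := floorD1_gt (t + 1 / 2).
by rewrite intrD /centered ler_norml; set z := _%:~R; move=> *; apply/andP; split; lra.
Qed.

Lemma int_transfer t u : u \is a Num.int -> t = u -> t \is a Num.int.
Proof. by move=> + ->. Qed.

Lemma int_small t : t \is a Num.int -> `|t| < 1 -> t = 0.
Proof.
move=> /intrP[n ->]; rewrite -intr_norm (_ : 1 = 1%:~R)// ltr_int => n1.
by have -> : n = 0 by lia.
Qed.

Lemma centered_uniq t u : t - u \is a Num.int -> `|u| < 1 / 2 -> centered t = u.
Proof.
move=> tu u2; apply/eqP; rewrite -subr_eq0; apply/eqP/int_small.
  by apply: (int_transfer (rpredB tu (centered_int t))); ring.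
have := centered_half t; move: u2; rewrite !ltr_norml ler_norml.
by move=> /andP[? ?] /andP[? ?]; apply/andP; split; lra.
Qed.

Lemma centered_eq0 t : (centered t == 0) = (t \is a Num.int).
Proof.
apply/eqP/idP => [t0|ti]; first by have := centered_int t; rewrite t0 subr0.
by apply: centered_uniq; rewrite ?subr0// normr0 divr_gt0.
Qed.

Lemma centered_congr t u : t - u \is a Num.int -> `|centered u| < 1 / 2 -> centered t = centered u.
Proof.
move=> tu u2; apply: centered_uniq => //.
by apply: (int_transfer (rpredD tu (centered_int u))); ring.
Qed.

(** Dirichlet's pigeonhole argument on the multiples of [t] modulo the integers. *)
Lemma dirichlet_approximation t (L : nat) : (1 < L)%N ->
  exists j, [/\ (0 < j)%N, (j <= L)%N & `|centered (t *+ j)| < L%:R^-1].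
Proof.
case: L => // L L1; have Lp : 0 < L.+1%:R :> R by rewrite ltr0n.
pose fr u := u - (Num.floor u)%:~R.
have fr0 u : 0 <= fr u by rewrite subr_ge0 floor_le.
have fr1 u : fr u < 1 by rewrite ltrBlDr addrC -[1]/(1%:~R) -intrD floorD1_gt.
pose box (i : 'I_L.+2) : 'I_L.+1 := inord (Num.truncn (L.+1%:R * fr (t *+ i))).
have boxE i : box i = Num.truncn (L.+1%:R * fr (t *+ i)) :> nat.
  rewrite /box inordK// -(ltr_nat R); apply: (@le_lt_trans _ _ (L.+1%:R * fr (t *+ i))).
    by rewrite truncn_le mulr_ge0// ltW.
  by rewrite -[ltRHS]mulr1 ltr_pM2l.
have /injectivePn[i [j ij bij]] : ~~ injectiveb box.
  by apply/negP => /injectiveP/leq_card; rewrite !card_ord ltnn.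
wlog ltij : i j ij bij / (i < j)%N => [H|].
  have [ji|ji|/val_inj e] := ltngtP i j; [exact: (H i j)|apply: (H j i) => //|].
    by rewrite eq_sym.
  by rewrite e eqxx in ij.
exists (j - i)%N; split; [by rewrite subn_gt0|by rewrite leq_subLR; have := ltn_ord j; lia|].
have d : `|fr (t *+ j) - fr (t *+ i)| < L.+1%:R^-1.
  have /(congr1 val) /= := bij; rewrite !boxE => e.
  have ge0 u : 0 <= L.+1%:R * fr u by rewrite mulr_ge0// ltW.
  have h1 := truncn_itv (ge0 (t *+ i)); have h2 := truncn_itv (ge0 (t *+ j)).
  rewrite -e in h2; move: h1 h2 => /andP[h1 h2] /andP[h3 h4].
  rewrite -(ltr_pM2l Lp) divff ?gt_eqF// -[X in X * `|_|]gtr0_norm// -normrM mulrBr.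
  by rewrite -[X in _ < X]natr1 in h2 h4; rewrite ltr_norml; apply/andP; split; lra.
rewrite (centered_uniq (u := fr (t *+ j) - fr (t *+ i)))//.
  rewrite mulrnBr ?(ltnW ltij)// /fr.
  apply: (int_transfer (rpredB (intr_int R (Num.floor (t *+ j))) (intr_int R (Num.floor (t *+ i))))); ring.
apply: lt_le_trans d _; rewrite -div1r ler_pdivrMr// mulrC mulrA mulr1.
by rewrite ler_pdivlMr// mul1r ler_nat.
Qed.

End Centered.

Section CharacterTheory.
Variables (R : realType) (X : topologicalZmodType).
Implicit Types (r chi psi : X -> R) (x y : X) (e : R) (n : int).

Lemma characterD r x y : character r -> r (x + y) - (r x + r y) \is a Num.int.
Proof. by move=> [rD _]; rewrite opprD addrA. Qed.

Lemma character0 r : character r -> r 0 \is a Num.int.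
Proof. by move=> /(characterD 0 0); rewrite addr0 opprD addrA subrr sub0r rpredN. Qed.

Lemma characterN r x : character r -> r (- x) - - r x \is a Num.int.
Proof.
move=> rc; have := rpredB (character0 rc) (characterD x (- x) rc).
by rewrite subrr opprB addrC subrK opprK addrC.
Qed.

Lemma characterB r x y : character r -> r (x - y) - (r x - r y) \is a Num.int.
Proof.
move=> rc; apply: (int_transfer (rpredD (characterD x (- y) rc) (characterN y rc))); ring.
Qed.

Lemma characterMn r x m : character r -> r (x *+ m) - r x *+ m \is a Num.int.
Proof.
move=> rc; elim: m => [|m IH]; first by rewrite !mulr0n subr0 character0.
rewrite !mulrS; apply: (int_transfer (rpredD (characterD x (x *+ m) rc) IH)); ring.
Qed.

Lemma characterMz r x n : character r -> r (x *~ n) - r x *~ n \is a Num.int.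
Proof.
move=> rc; case: n => m; first exact: characterMn.
rewrite NegzE !mulrNz -!pmulrn.
apply: (int_transfer (rpredB (characterN (x *+ m.+1) rc) (characterMn x m.+1 rc))); ring.
Qed.

Lemma character_sum r (J : Type) (s : seq J) (F : J -> X) : character r ->
  r (\sum_(j <- s) F j) - \sum_(j <- s) r (F j) \is a Num.int.
Proof.
move=> rc; elim: s => [|j s IH]; first by rewrite !big_nil subr0 character0.
rewrite !big_cons; apply: (int_transfer (rpredD (characterD (F j) (\sum_(j <- s) F j) rc) IH)); ring.
Qed.

Lemma character_add chi psi : character chi -> character psi ->
  character (fun x => chi x + psi x).
Proof.
move=> [c1 c2] [p1 p2]; split.
  move=> x y; apply: (int_transfer (rpredD (c1 x y) (p1 x y))); ring.
move=> e e0; have e2 : 0 < e / 2 by rewrite divr_gt0.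
apply: filterS2 (c2 _ e2) (p2 _ e2) => x [n Hn] [m Hm]; exists (n + m); rewrite intrD.
by move: Hn Hm; rewrite !ler_norml => /andP[? ?] /andP[? ?]; apply/andP; split; lra.
Qed.

Lemma character_scale chi n : character chi -> character (fun x => n%:~R * chi x).
Proof.
move=> [c1 c2]; split.
  move=> x y; have := rpredM (intr_int R n) (c1 x y).
  by rewrite !mulrBr.
move=> e e0; have n0 : 0 < `|n|%:~R + 1 :> R by rewrite ltr_wpDl// ler0z.
apply: filterS (c2 _ (divr_gt0 e0 n0)) => x [m Hm]; exists (n * m).
rewrite intrM -mulrBr normrM; apply: le_trans (ler_wpM2l (normr_ge0 _) Hm) _.
rewrite mulrA ler_pdivrMr// mulrC ler_pM2l// -intr_norm.
by rewrite lerDl.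
Qed.

Lemma character_comp r (h : X -> X) : character r -> continuous h ->
  (forall x y, h (x + y) = h x + h y) -> character (fun x => r (h x)).
Proof.
move=> [c1 c2] ch hD; have h0 : h 0 = 0.
  by apply: (addrI (h 0)); rewrite -hD !addr0.
split; first by move=> x y; rewrite hD.
by move=> e e0; have := ch 0; rewrite /continuous_at h0 => /(_ _ (c2 e e0)).
Qed.

Lemma character_near r x e : character r -> 0 < e ->
  \forall y \near x, `|centered (r y - r x)| <= e.
Proof.
move=> rc e0; pose d := Num.min e (1 / 4).
have d0 : 0 < d by rewrite lt_min e0 divr_gt0.
have [de d4] : d <= e /\ d <= 1 / 4 by rewrite !ge_min !lexx orbT.
apply: filterS (near_subg x (rc.2 _ d0)) => y [n Hn].
have -> : centered (r y - r x) = r (y - x) - n%:~R; last exact: le_trans Hn de.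
apply: centered_uniq; last by apply: le_lt_trans Hn _; lra.
by apply: (int_transfer (rpredB (intr_int R n) (characterB y x rc))); ring.
Qed.

Lemma character_kernel_closed r : character r -> closed [set x | r x \is a Num.int].
Proof.
move=> rc x clx; rewrite /= -centered_eq0 -normr_le0; apply/ler_addgt0Pr => e e0.
rewrite add0r; have [y [/= ry cy]] := clx _ (character_near x rc e0).
apply: le_trans cy; have [e2|e2] := leP (1 / 2) `|centered (r y - r x)|.
  exact: le_trans (centered_half _) e2.
rewrite (_ : centered (r x) = - centered (r y - r x)) ?normrN//.
apply: centered_uniq; last by rewrite normrN.
apply: (int_transfer (rpredB ry (centered_int (r y - r x)))); ring.
Qed.

Definition subgroup (K : set X) := K 0 /\ (forall x y, K x -> K y -> K (x - y)).

Lemma subgroupN K x : subgroup K -> K x -> K (- x).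
Proof. by move=> [K0 KB] Kx; rewrite -sub0r; exact: KB. Qed.

Lemma subgroupD K x y : subgroup K -> K x -> K y -> K (x + y).
Proof. by move=> sK Kx Ky; rewrite -[y]opprK; apply: sK.2 => //; exact: subgroupN. Qed.

Lemma subgroupMn K x m : subgroup K -> K x -> K (x *+ m).
Proof.
move=> sK Kx; elim: m => [|m IH]; first by rewrite mulr0n; case: sK.
by rewrite mulrS; exact: subgroupD.
Qed.

Lemma subgroupMz K x n : subgroup K -> K x -> K (x *~ n).
Proof.
move=> sK Kx; case: n => m; first exact: subgroupMn.
by rewrite NegzE mulrNz; apply: subgroupN => //; exact: subgroupMn.
Qed.

Lemma character_kernel_subgroup r : character r -> subgroup [set x | r x \is a Num.int].
Proof.
move=> rc; split; first exact: character0.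
move=> x y /= rx ry; apply: (int_transfer (rpredD (characterB x y rc) (rpredB rx ry))); ring.
Qed.

(** The circle has no nontrivial subgroup near its neutral element: multiples of a
    small nonzero value eventually leave the quarter. *)
Lemma character_small_subgroup r K : character r -> subgroup K ->
  (forall x, K x -> `|centered (r x)| < 1 / 4) -> forall x, K x -> r x \is a Num.int.
Proof.
move=> rc sK Ksmall x Kx; rewrite -centered_eq0.
have H m : centered (r (x *+ m)) = centered (r x) *+ m.
  elim: m => [|m IH]; first by rewrite !mulr0n; apply/eqP; rewrite centered_eq0 character0.
  rewrite mulrS [RHS]mulrS -IH; apply: centered_uniq.
    apply: (int_transfer (rpredD (characterD x (x *+ m) rc)
      (rpredD (centered_int (r x)) (centered_int (r (x *+ m)))))); ring.
  have := Ksmall _ Kx; have := Ksmall _ (subgroupMn m sK Kx); rewrite !ltr_norml.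
  by move=> /andP[? ?] /andP[? ?]; apply/andP; split; lra.
apply: contraT => c0; have cp : 0 < `|centered (r x)| by rewrite normr_gt0.
have := archi_boundP (ltW (divr_gt0 ltr01 cp)); set N := Num.bound _.
rewrite ltr_pdivrMr// => HN; have := Ksmall _ (subgroupMn N sK Kx).
by rewrite H normrMn -mulr_natl; lra.
Qed.

Section Dependence.
Hypothesis cptX : compact [set: X].
Variables (K : set X) (chi psi : X -> R).
Hypotheses (clK : closed K) (sK : subgroup K).
Hypotheses (cchi : character chi) (cpsi : character psi).
Hypothesis ker_sub : forall x, K x -> chi x \is a Num.int -> psi x \is a Num.int.

Let a x := centered (chi x).
Let b x := centered (psi x).

Let small_dom : exists d, [/\ 0 < d, d <= 1 / 8 &
   forall x, K x -> `|a x| <= d -> `|b x| <= 1 / 8].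
Proof.
apply: contrapT => /forallNP nd.
(* otherwise bad points would accumulate at a point of the kernel of [chi] *)
have bad (m : nat) : exists x, [/\ K x, `|a x| <= m.+1%:R^-1 & 1 / 8 < `|b x| ].
  apply: contrapT => /forallNP H; apply: (nd (Num.min (1 / 8) m.+1%:R^-1)); split.
  - by rewrite lt_min divr_gt0//= invr_gt0.
  - by rewrite ge_min lexx.
  - move=> x Kx; rewrite le_min => /andP[_ ax]; rewrite leNgt; apply/negP => bx.
    by apply: (H x).
have [x_ x_P] := choice bad.
have [x [_ clx]] := @cptX (x_ @ \oo) _ filterT.
have tailF N : (x_ @ \oo) (x_ @` [set m | (N <= m)%N]).
  by exists N => // m Nm; exists m.
have Kx : K x.
  by apply: clK => U /(clx _ _ (tailF 0%N)) [_ [[m _ <-] Um]]; exists (x_ m); split=> //; case: (x_P m).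
have chix : chi x \is a Num.int.
  rewrite -centered_eq0 -normr_le0; apply/ler_addgt0Pr => e e0; rewrite add0r.
  pose d := Num.min (e / 2) (1 / 8).
  have d0 : 0 < d by rewrite lt_min !divr_gt0.
  have [de d8] : d <= e / 2 /\ d <= 1 / 8 by rewrite !ge_min !lexx orbT.
  have [N _ HN] := @near_infty_natSinv_lt R (PosNum d0).
  have [_ [[m Nm <-] Hm]] := clx _ _ (tailF N) (character_near x cchi d0).
  have [_ am _] := x_P m; have ad : `|a (x_ m)| <= d by apply: le_trans am (ltW _); exact: HN m Nm.
  rewrite (_ : centered (chi x) = a (x_ m) - centered (chi (x_ m) - chi x)).
    by apply: le_trans (ler_normB _ _) _; lra.
  apply: centered_uniq; last by apply: le_lt_trans (ler_normB _ _) _; lra.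
  apply: (int_transfer (rpredB (centered_int (chi (x_ m))) (centered_int (chi (x_ m) - chi x)))).
  by rewrite /a; ring.
have psix := ker_sub Kx chix.
have e0 : 0 < 1 / 16 :> R by rewrite divr_gt0.
have [_ [[m _ <-] Hm]] := clx _ _ (tailF 0%N) (character_near x cpsi e0).
have [_ _] := x_P m; apply/negP; rewrite -leNgt.
rewrite (_ : b (x_ m) = centered (psi (x_ m) - psi x)); first by apply: le_trans Hm _; lra.
apply: centered_uniq; last by apply: le_lt_trans Hm _; lra.
apply: (int_transfer (rpredD psix (centered_int (psi (x_ m) - psi x)))); ring.
Qed.

(** When [chi] takes no small nonzero value on [K], its values on [K] modulo the
    integers have bounded order by Dirichlet, so a factorial kills them. *)
Lemma dependence_discrete d : 0 < d -> (forall x, K x -> `|a x| < d -> a x = 0) ->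
  exists2 l, (0 < l)%N & forall x, K x -> psi x *+ l \is a Num.int.
Proof.
move=> d0 dK; pose L := (Num.bound d^-1).+2.
have Ld : L%:R^-1 <= d.
  rewrite invf_ple ?posrE ?ltr0n//; have := archi_boundP (ltW (_ : 0 < d^-1)).
  rewrite invr_gt0 => /(_ d0) /ltW h; apply: le_trans h _; rewrite ler_nat /L; lia.
exists L`!; first exact: fact_gt0.
move=> x Kx; have [j [j0 jL cj]] := @dirichlet_approximation _ (chi x) L isT.
have chij : chi (x *+ j) \is a Num.int.
  rewrite -centered_eq0; apply/eqP/dK; first exact: subgroupMn.
  have jh : `|centered (chi x *+ j)| < 1 / 2.
    by apply: lt_le_trans cj _; rewrite div1r lef_pV2 ?posrE// ler_nat.
  rewrite /a (centered_congr (characterMn x j cchi) jh); exact: lt_le_trans cj Ld.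
have := ker_sub (subgroupMn j sK Kx) chij => psij.
have /dvdnP[q ->] : (j %| L`!)%N by apply: dvdn_fact; rewrite j0.
rewrite mulnC mulrnA rpredMn//.
apply: (int_transfer (rpredB psij (characterMn x j cpsi))); ring.
Qed.

(** When [chi] takes arbitrarily small nonzero values on [K], the lift of [psi] is
    proportional to that of [chi] near the kernel; running once around the circle
    in small steps shows that the slope is an integer. *)
Lemma dependence_dense : (forall d, 0 < d -> exists2 x, K x & 0 < a x < d) ->
  exists q : int, forall x, K x -> psi x - q%:~R * chi x \is a Num.int.
Proof.
move=> dense; have [d [d0 d8 dP]] := small_dom.
have aD x y : `|a x + a y| < 1 / 2 -> a (x + y) = a x + a y.
  move=> h; apply: centered_uniq => //.
  apply: (int_transfer (rpredD (characterD x y cchi) (rpredD (centered_int (chi x)) (centered_int (chi y))))).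
  by rewrite /a; ring.
have bD x y : `|b x + b y| < 1 / 2 -> b (x + y) = b x + b y.
  move=> h; apply: centered_uniq => //.
  apply: (int_transfer (rpredD (characterD x y cpsi) (rpredD (centered_int (psi x)) (centered_int (psi y))))).
  by rewrite /b; ring.
have aN x : `|a x| < 1 / 2 -> a (- x) = - a x.
  move=> h; apply: centered_uniq; last by rewrite normrN.
  apply: (int_transfer (rpredB (characterN x cchi) (centered_int (chi x)))).
  by rewrite /a; ring.
have bN x : `|b x| < 1 / 2 -> b (- x) = - b x.
  move=> h; apply: centered_uniq; last by rewrite normrN.
  apply: (int_transfer (rpredB (characterN x cpsi) (centered_int (psi x)))).
  by rewrite /b; ring.
have mult y N : K y -> `|a y| *+ N <= d -> a (y *+ N) = a y *+ N /\ b (y *+ N) = b y *+ N.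
  move=> Ky; elim: N => [|N IH] hN.
    by rewrite !mulr0n; split; apply/eqP; rewrite centered_eq0 character0.
  have hN' : `|a y| *+ N <= d by apply: le_trans hN; rewrite mulrS lerDr.
  have hy : `|a y| <= d by apply: le_trans hN; rewrite mulrS lerDl mulrn_wge0.
  have [eA eB] := IH hN'.
  have KN := subgroupMn N sK Ky.
  have b1 := dP _ Ky hy; have b2 : `|b (y *+ N)| <= 1 / 8.
    by apply: dP => //; rewrite eA normrMn.
  rewrite !mulrS -eA -eB; split.
    by apply: aD; rewrite eA -mulrS normrMn; apply: le_lt_trans hN _; lra.
  by apply: bD; apply: le_lt_trans (ler_normD _ _) _; lra.
have aMbound y : K y -> 0 < a y -> a y <= d -> `|b y| <= a y / (4 * d).
  move=> Ky y0 yd; have q0 : 0 <= d / a y by rewrite divr_ge0// ltW.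
  pose N := Num.truncn (d / a y); have /andP[n1 n2] := truncn_itv q0; rewrite -/N in n1 n2.
  have N1 : (1 <= N)%N by rewrite truncn_ge_nat// ler_pdivlMr// mul1r.
  have nd : `|a y| *+ N <= d by rewrite gtr0_norm// -mulr_natl -ler_pdivlMr.
  have [eA eB] := mult _ _ Ky nd.
  have : `|b (y *+ N)| <= 1 / 8.
    by apply: dP; [exact: subgroupMn|rewrite eA normrMn].
  rewrite eB normrMn -mulr_natl => h.
  have N2 : d <= 2 * N%:R * a y.
    rewrite -ler_pdivrMr//; apply: le_trans (ltW n2) _.
    by rewrite -natr1; move: N1; rewrite -(ler_nat R); lra.
  rewrite ler_pdivlMr; last by rewrite mulr_gt0.
  have := ler_wpM2l (normr_ge0 (b y)) N2; have := ler_wpM2r (ltW y0) h; lra.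
have ker0 x : K x -> a x = 0 -> b x = 0.
  by move=> Kx /eqP; rewrite centered_eq0 => /(ker_sub Kx) h; apply/eqP; rewrite centered_eq0.
(* Subtract from [x] the multiple of [y] that leaves a remainder smaller than
   [y]: the slopes of [psi] over [chi] at [x] and [y] nearly agree. *)
have approx x y : K x -> K y -> 0 <= a x -> a x <= d -> 0 < a y -> a y <= d ->
    `|b x * a y - a x * b y| <= a y ^+ 2 / (2 * d).
  move=> Kx Ky x0 xd y0 yd; have q0 : 0 <= a x / a y by rewrite divr_ge0// ltW.
  pose m := Num.truncn (a x / a y); have /andP[m1 m2] := truncn_itv q0; rewrite -/m in m1 m2.
  rewrite ler_pdivlMr// in m1; rewrite ltr_pdivrMr// -natr1 mulrDl mul1r in m2.
  have md : `|a y| *+ m <= d by rewrite gtr0_norm// -mulr_natl; exact: le_trans m1 xd.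
  have [eA eB] := mult _ _ Ky md.
  have bm : `|b (y *+ m)| <= 1 / 8.
    by apply: dP; [exact: subgroupMn|rewrite eA normrMn].
  have bx : `|b x| <= 1 / 8 by apply: dP => //; rewrite ger0_norm.
  have bm' : `|m%:R * b y| <= 1 / 8 by rewrite mulr_natl -eB.
  have mchi := rpredMn m (centered_int (chi y)); rewrite -mulr_natl in mchi.
  have mpsi := rpredMn m (centered_int (psi y)); rewrite -mulr_natl in mpsi.
  have nchi := characterMn y m cchi; rewrite -mulr_natl in nchi.
  have npsi := characterMn y m cpsi; rewrite -mulr_natl in npsi.
  have aw : a (x - y *+ m) = a x - m%:R * a y.
    apply: centered_uniq; last by rewrite ltr_norml; apply/andP; split; lra.
    apply: (int_transfer (rpredD (rpredB (characterB x (y *+ m) cchi) (rpredD nchi mchi))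
      (centered_int (chi x)))).
    by rewrite /a; ring.
  have bw : b (x - y *+ m) = b x - m%:R * b y.
    apply: centered_uniq; last by apply: le_lt_trans (ler_normB _ _) _; lra.
    apply: (int_transfer (rpredD (rpredB (characterB x (y *+ m) cpsi) (rpredD npsi mpsi))
      (centered_int (psi x)))).
    by rewrite /b; ring.
  have Kw : K (x - y *+ m) by apply: sK.2 => //; exact: subgroupMn.
  have d40 : 0 < 4 * d by rewrite mulr_gt0.
  have bws : `|b (x - y *+ m)| <= a y / (4 * d).
    have [w0|wn0] := eqVneq (a (x - y *+ m)) 0.
      by rewrite ker0// normr0 divr_ge0// ltW.
    have wp : 0 < a (x - y *+ m) by rewrite lt_neqAle eq_sym wn0 aw subr_ge0.
    apply: le_trans (aMbound _ Kw wp _) _; first by rewrite aw; lra.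
    by rewrite ler_pM2r ?invr_gt0// aw; lra.
  have by_ := aMbound _ Ky y0 yd.
  have -> : b x * a y - a x * b y =
      a y * b (x - y *+ m) - a (x - y *+ m) * b y by rewrite aw bw; ring.
  apply: le_trans (ler_normB _ _) _; rewrite !normrM (gtr0_norm y0).
  have wy : `|a (x - y *+ m)| <= a y by rewrite aw ler_norml; apply/andP; split; lra.
  have h1 := ler_wpM2l (ltW y0) bws.
  have h2 := ler_pM (normr_ge0 _) (normr_ge0 _) wy by_.
  apply: le_trans (lerD h1 h2) _; rewrite le_eqVlt; apply/orP; left; apply/eqP.
  by field; rewrite gt_eqF.
have [x1 Kx1 /andP[x10 x1d]] := dense d d0.
pose c := b x1 / a x1.
have lin x : K x -> 0 <= a x -> a x <= d -> b x = c * a x.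
  move=> Kx x0 xd; suff H : b x * a x1 - b x1 * a x = 0.
    have -> : b x = (b x * a x1) / a x1 by rewrite mulfK// gt_eqF.
    by move/eqP: H; rewrite subr_eq0 => /eqP ->; rewrite /c mulrAC.
  apply/eqP; rewrite -normr_le0; apply/ler_addgt0Pr => e e0; rewrite add0r.
  have [y Ky /andP[y0 ye]] := dense (Num.min e d) (ltac:(by rewrite lt_min e0)).
  move: ye; rewrite lt_min => /andP[ye yd].
  have h1 := approx x y Kx Ky x0 xd y0 (ltW yd).
  have h2 := approx x1 y Kx1 Ky (ltW x10) (ltW x1d) y0 (ltW yd).
  apply: le_trans (ltW ye); rewrite -(ler_pM2l y0) -[X in X * `|_|](gtr0_norm y0) -normrM.
  have -> : a y * (b x * a x1 - b x1 * a x) =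
     a x1 * (b x * a y - a x * b y) - a x * (b x1 * a y - a x1 * b y) by ring.
  apply: le_trans (ler_normB _ _) _; rewrite !normrM (ger0_norm x0) (gtr0_norm x10).
  have sd : 0 <= a y ^+ 2 / (2 * d) by rewrite divr_ge0 ?sqr_ge0// mulr_ge0// ltW.
  have h3 := ler_pM (ltW x10) (normr_ge0 _) (ltW x1d) h1.
  have h4 := ler_pM x0 (normr_ge0 _) xd h2.
  apply: le_trans (lerD h3 h4) _; rewrite le_eqVlt; apply/orP; left; apply/eqP.
  by field; rewrite gt_eqF.
have bx1 := lin _ Kx1 (ltW x10) (ltW x1d).
(* [N.+1] steps of length [a x1] go just beyond one full turn *)
have cint : c \is a Num.int.
  have q0 : 0 <= 1 / a x1 by rewrite divr_ge0// ltW.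
  pose N := Num.truncn (1 / a x1); have /andP[n1 n2] := truncn_itv q0; rewrite -/N in n1 n2.
  rewrite ler_pdivlMr// in n1; rewrite ltr_pdivrMr// in n2.
  have Ns : N.+1%:R * a x1 <= 1 + a x1 by rewrite -natr1 mulrDl mul1r lerD2r.
  have aN1 : a (x1 *+ N.+1) = N.+1%:R * a x1 - 1.
    apply: centered_uniq; last by rewrite ltr_norml; apply/andP; split; lra.
    have := rpredMn N.+1 (centered_int (chi x1)); rewrite -mulr_natl => h.
    apply: (int_transfer (rpredD (rpredD (characterMn x1 N.+1 cchi) h) (rpred1 _))).
    by rewrite -mulr_natl /a; ring.
  have bN1 : b (x1 *+ N.+1) = c * (N.+1%:R * a x1 - 1).
    by rewrite lin ?aN1//; [exact: subgroupMn|lra|lra].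
  have := rpredMn N.+1 (centered_int (psi x1)); rewrite -mulr_natl -/(b x1) bx1 => h.
  apply: (int_transfer (rpredB (centered_int (psi (x1 *+ N.+1)))
    (rpredD (characterMn x1 N.+1 cpsi) h))).
  by rewrite -/(b _) bN1 -mulr_natl; ring.
have /intrP[q qc] := cint; exists q => z Kz; rewrite -qc.
pose m := Num.floor (a z / a x1); have /andP[m1 m2] := floor_itv (a z / a x1).
rewrite -/m ler_pdivlMr// in m1; rewrite -/m intrD ltr_pdivrMr// mulrDl mul1r in m2.
have mchi := rpredM (intr_int R m) (centered_int (chi x1)).
have mpsi := rpredM (intr_int R m) (centered_int (psi x1)).
have zmchi := characterMz x1 m cchi; have zmpsi := characterMz x1 m cpsi.
rewrite -mulrzl in zmchi; rewrite -mulrzl in zmpsi.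
have aw : a (z - x1 *~ m) = a z - m%:~R * a x1.
  apply: centered_uniq; last by rewrite ltr_norml; apply/andP; split; lra.
  apply: (int_transfer (rpredD (rpredB (characterB z (x1 *~ m) cchi) (rpredD zmchi mchi)) (centered_int (chi z)))).
  by rewrite /a; ring.
have bw : b (z - x1 *~ m) = c * (a z - m%:~R * a x1).
  by rewrite lin ?aw//; [apply: sK.2 => //; exact: subgroupMz|lra|lra].
have cchiz := rpredM cint (centered_int (chi z)).
rewrite -/(b x1) bx1 in mpsi.
apply: (int_transfer (rpredB (rpredD (rpredB (centered_int (psi (z - x1 *~ m)))
  (characterB z (x1 *~ m) cpsi)) (rpredD zmpsi mpsi)) cchiz)).
by rewrite -/(b _) bw /a; ring.
Qed.

(** A closed subgroup of the circle is finite or everything, and the continuous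
    endomorphisms of the circle are the integers. *)
Theorem character_dependence : exists (l : nat) (q : int),
  (0 < l)%N /\ forall x, K x -> psi x *+ l - q%:~R * chi x \is a Num.int.
Proof.
have [dense|/existsNP[d /not_implyP[d0 nd]]] :=
  pselect (forall d, 0 < d -> exists2 x, K x & 0 < a x < d).
  by have [q Hq] := dependence_dense dense; exists 1%N, q.
have [||l l0 Hl] := @dependence_discrete (Num.min d (1 / 2)).
- by rewrite lt_min d0 divr_gt0.
- move=> x Kx; rewrite lt_min => /andP[ad a2]; apply/eqP; apply: contraT => an0.
  exfalso; apply: nd; have [a0|a0] := leP 0 (a x).
    by exists x => //; rewrite lt_neqAle eq_sym an0 a0/= -(ger0_norm a0).
  exists (- x); first exact: subgroupN.
  suff -> : a (- x) = - a x by rewrite oppr_gt0 a0/= -(ltr0_norm a0).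
  apply: centered_uniq; last by rewrite normrN.
  apply: (int_transfer (rpredB (characterN x cchi) (centered_int (chi x)))).
  by rewrite /a; ring.
by exists l, 0; split=> // x Kx; rewrite mul0r subr0; exact: Hl.
Qed.

End Dependence.
End CharacterTheory.

(** * Characters that vanish on a common kernel *)

Section CharacterSpan.
Variables (R : realType) (X : topologicalZmodType).
Hypothesis cptX : compact [set: X].
Variable chi_ : nat -> X -> R.
Hypothesis chi_char : forall i, character (chi_ i).

Let K n := [set x | forall i, (i < n)%N -> chi_ i x \is a Num.int].

Let clK n : closed (K n).
Proof.
have -> : K n = \bigcap_(i in [set i | (i < n)%N]) [set x | chi_ i x \is a Num.int].
  by apply/seteqP; split => x H i; exact: H.
by apply: closed_bigI => i _; exact: character_kernel_closed.
Qed.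

Let sK n : subgroup (K n).
Proof.
split; first by move=> i _; exact: character0.
by move=> x y Kx Ky i ni; apply: (character_kernel_subgroup (chi_char i)).2; [exact: Kx|exact: Ky].
Qed.

(** Induction on the number of characters: on the common kernel of the others, a
    multiple of [psi] is a multiple of the last one. *)
Lemma character_span_finite n (psi : X -> R) : character psi ->
  (forall x, K n x -> psi x \is a Num.int) ->
  exists (l : nat) (q : nat -> int), (0 < l)%N /\
    forall x, psi x *+ l - \sum_(i < n) (q i)%:~R * chi_ i x \is a Num.int.
Proof.
elim: n psi => [|n IH] psi cpsi Hpsi.
  exists 1%N, (fun=> 0); split=> // x; rewrite big_ord0 subr0 mulr1n.
  by apply: Hpsi => i.
have [|l [q [l0 Hq]]] := character_dependence cptX (@clK n) (sK n) (chi_char n) cpsi.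
  move=> x Kx cx; apply: Hpsi => i; rewrite ltnS leq_eqVlt => /orP[/eqP->//|]; exact: Kx.
pose psi' x := l%:~R * psi x + (- q)%:~R * chi_ n x.
have cpsi' : character psi' by apply: character_add; exact: character_scale.
have [|l' [q' [l'0 Hq']]] := IH psi' cpsi'.
  by move=> x /Hq; rewrite /psi' intrN mulNr -pmulrn mulr_natl.
exists (l * l')%N, (fun i => if (i == n)%N then q *+ l' else q' i); split.
  by rewrite muln_gt0 l0.
move=> x; rewrite big_ord_recr/= eqxx.
under eq_bigr => i _ do rewrite (ltn_eqF (ltn_ord i)).
have e1 : psi x *+ (l * l') = l'%:R * (l%:R * psi x) by rewrite !mulr_natl mulrnA.
have e2 : (q *+ l')%:~R = q%:~R * l'%:R :> R by rewrite rmorphMn /= mulr_natr.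
have e3 : psi' x *+ l' = l'%:R * (l%:R * psi x - q%:~R * chi_ n x).
  by rewrite mulr_natl /psi' intrN mulNr.
by rewrite e1 e2; apply: (int_transfer (Hq' x)); rewrite e3; ring.
Qed.

(** Otherwise, by compactness, a point where [psi] is far from the integers would
    survive in the intersection of all kernels. *)
Lemma character_span_compact (psi : X -> R) : character psi ->
  (forall x, (forall i, chi_ i x \is a Num.int) -> psi x \is a Num.int) ->
  exists n, forall x, K n x -> psi x \is a Num.int.
Proof.
move=> cpsi Hpsi; apply: contrapT => /forallNP nK.
have bad n : exists x, K n x /\ 1 / 4 <= `|centered (psi x)|.
  apply: contrapT => /forallNP H; apply: (nK n) => x Kx.
  apply: (character_small_subgroup cpsi (sK n)) => // y Ky; rewrite ltNge; apply/negP => hy.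
  by apply: (H y).
have [x_ x_P] := choice bad.
have [x [_ clx]] := @cptX (x_ @ \oo) _ filterT.
have tailF N : (x_ @ \oo) (x_ @` [set m | (N <= m)%N]).
  by exists N => // m Nm; exists m.
have psix : psi x \is a Num.int.
  apply: Hpsi => i; apply: (character_kernel_closed (chi_char i)) => U.
  move=> /(clx _ _ (tailF i.+1)) [_ [[m im <-] Um]]; exists (x_ m); split=> //.
  by have [Km _] := x_P m; exact: Km.
have e0 : 0 < 1 / 8 :> R by rewrite divr_gt0.
have [_ [[m _ <-] Hm]] := clx _ _ (tailF 0%N) (character_near x cpsi e0).
have [_] := x_P m; apply/negP; rewrite -ltNge.
rewrite (_ : centered (psi (x_ m)) = centered (psi (x_ m) - psi x)).
  by apply: le_lt_trans Hm _; lra.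
apply: centered_uniq; last by apply: le_lt_trans Hm _; lra.
apply: (int_transfer (rpredD psix (centered_int (psi (x_ m) - psi x)))); ring.
Qed.

Lemma character_span (psi : X -> R) : character psi ->
  (forall x, (forall i, chi_ i x \is a Num.int) -> psi x \is a Num.int) ->
  exists (l n : nat) (q : nat -> int), (0 < l)%N /\
    forall x, psi x *+ l - \sum_(i < n) (q i)%:~R * chi_ i x \is a Num.int.
Proof.
move=> cpsi /(character_span_compact cpsi)[n /(character_span_finite cpsi)[l [q Hq]]].
by exists l, n, q.
Qed.

End CharacterSpan.

Section FiniteSubgroup.
Variable X : zmodType.

(** The bound [N] serves all sequences at once, which yields a common exponent. *)
Lemma finite_set_repeat (T : choiceType) (H : set T) : finite_set H -> exists N : nat,
  forall u : nat -> T, (forall n, H (u n)) -> exists i j, [/\ (i < j)%N, (j <= N)%N & u i = u j].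
Proof.
move=> /finite_seqP[s Hs]; exists (size s) => u Hu.
have : ~~ uniq (mkseq u (size s).+1).
  apply/negP => un; have : (size (mkseq u (size s).+1) <= size s)%N.
    apply: uniq_leq_size => // x /mapP[i _ ->].
    by have := Hu i; rewrite Hs.
  by rewrite size_mkseq ltnn.
case: s Hs => [|x0 s] Hs; first by have := Hu 0%N; rewrite Hs.
move=> /(uniqPn x0)[i [j [ij]]]; rewrite size_mkseq => js.
rewrite !nth_mkseq//; last exact: ltn_trans ij js.
by exists i, j; split.
Qed.

Lemma finite_subgroup_exponent (H : set X) : finite_set H ->
  (forall x (n : nat), H x -> H (x *+ n)) -> exists2 m, (0 < m)%N & forall x, H x -> x *+ m = 0.
Proof.
move=> /finite_set_repeat[N HN] HM; exists N`!; first exact: fact_gt0.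
move=> x Hx; have [i [j [ij jN e]]] := HN (fun n => x *+ n) (fun n => HM x n Hx).
have ji : x *+ (j - i) = 0 by rewrite mulrnBr ?(ltnW ij)// e subrr.
have /dvdnP[q ->] : (j - i %| N`!)%N.
  by apply: dvdn_fact; rewrite subn_gt0 ij /=; lia.
by rewrite mulnC mulrnA ji mul0rn.
Qed.

End FiniteSubgroup.

Lemma continuous_bijection_inverse (X : topologicalType) (f g : X -> X) :
  hausdorff_space X -> compact [set: X] -> cancel f g -> cancel g f ->
  continuous f -> continuous g.
Proof.
move=> hX cX fg gf cf; apply/continuous_closedP => C clC.
have -> : g @^-1` C = f @` C.
  apply/seteqP; split => x /=; first by move=> Cx; exists (g x).
  by move=> [y Cy <-]; rewrite fg.
apply: compact_closed => //; apply: continuous_compact; first exact: continuous_subspaceT.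
by apply: subclosed_compact cX _ => //.
Qed.

(** * Integer polynomials in an automorphism *)

Section IntegerPowers.
Variables (X : zmodType) (alpha beta : X -> X).
Hypothesis aD : forall x y, alpha (x + y) = alpha x + alpha y.
Hypotheses (ab : cancel alpha beta) (ba : cancel beta alpha).

Definition zpow (n : int) (x : X) : X :=
  match n with Posz m => iter m alpha x | Negz m => iter m.+1 beta x end.

Lemma zpow0 x : zpow 0 x = x. Proof. by []. Qed.

Lemma zpowS n x : zpow (n + 1) x = alpha (zpow n x).
Proof.
case: n => [m|[|m]]; first by rewrite (_ : Posz m + 1 = Posz m.+1)//; lia.
  by rewrite /= ba.
by rewrite (_ : Negz m.+1 + 1 = Negz m) /= ?ba//; lia.
Qed.

Lemma zpowP n x : zpow (n - 1) x = beta (zpow n x).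
Proof. by rewrite -[in RHS](subrK 1 n) zpowS ab. Qed.

Lemma zpow_ind (P : int -> Prop) : P 0 -> (forall n, P n -> P (n + 1)) ->
  (forall n, P n -> P (n - 1)) -> forall n, P n.
Proof.
move=> P0 PS PP; case; elim=> [|m IH].
- exact: P0.
- by rewrite (_ : Posz m.+1 = Posz m + 1); [exact: PS|lia].
- by rewrite (_ : Negz 0 = 0 - 1); [exact: PP|lia].
- by rewrite (_ : Negz m.+1 = Negz m - 1); [exact: PP|lia].
Qed.

Lemma zpow_add m n x : zpow (m + n) x = zpow m (zpow n x).
Proof.
elim/zpow_ind: m => [|m IH|m IH]; first by rewrite add0r.
  by rewrite addrAC !zpowS IH.
by rewrite addrAC !zpowP IH.
Qed.

Lemma zpowC m n x : zpow m (zpow n x) = zpow n (zpow m x).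
Proof. by rewrite -!zpow_add addrC. Qed.

Lemma zpow1 x : zpow 1 x = alpha x. Proof. by []. Qed.

Lemma zpowD n x y : zpow n (x + y) = zpow n x + zpow n y.
Proof.
have bD u v : beta (u + v) = beta u + beta v by rewrite -[u in LHS]ba -[v in LHS]ba -aD ab.
elim/zpow_ind: n => [//|n IH|n IH]; first by rewrite !zpowS IH aD.
by rewrite !zpowP IH bD.
Qed.

Lemma zpow_0 n : zpow n 0 = 0.
Proof. by apply: (addrI (zpow n 0)); rewrite -zpowD !addr0. Qed.

Lemma zpowN n x : zpow n (- x) = - zpow n x.
Proof. by apply: (addrI (zpow n x)); rewrite -zpowD !subrr zpow_0. Qed.

Lemma zpowMn n x m : zpow n (x *+ m) = zpow n x *+ m.
Proof. by elim: m => [|m IH]; rewrite ?mulr0n ?zpow_0// !mulrS zpowD IH. Qed.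

Lemma zpowMz n x z : zpow n (x *~ z) = zpow n x *~ z.
Proof. by case: z => m; rewrite ?NegzE ?mulrNz -?pmulrn ?zpowN zpowMn. Qed.

Lemma zpow_sum n (J : Type) (s : seq J) (F : J -> X) :
  zpow n (\sum_(j <- s) F j) = \sum_(j <- s) zpow n (F j).
Proof. by elim: s => [|j s IH]; rewrite ?big_nil ?zpow_0// !big_cons zpowD IH. Qed.

Implicit Types (p q : {poly int}) (x y : X).

Definition poly_act (p : {poly int}) (x : X) : X := \sum_(i < size p) zpow i x *~ p`_i.

Local Notation act := poly_act.

Lemma actE n (p : {poly int}) x : (size p <= n)%N -> act p x = \sum_(i < n) zpow i x *~ p`_i.
Proof.
move=> pn; rewrite /poly_act (big_ord_widen n (fun i => zpow (Posz i) x *~ p`_i) pn) big_mkcond /=.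
apply: eq_bigr => i _; case: ltnP => // h.
by rewrite nth_default// mulr0z.
Qed.

Lemma act0 x : act 0 x = 0. Proof. by rewrite /poly_act size_poly0 big_ord0. Qed.

Lemma actD p q x : act (p + q) x = act p x + act q x.
Proof.
pose n := maxn (size p) (size q).
rewrite !(@actE n) ?leq_maxl ?leq_maxr//; last exact: size_polyD.
by rewrite -big_split; apply: eq_bigr => i _; rewrite coefD mulrzDr.
Qed.

Lemma actZ c p x : act (c *: p) x = act p x *~ c.
Proof.
rewrite (@actE (size p)) ?size_scale_leq// /poly_act mulrz_suml; apply: eq_bigr => i _.
by rewrite coefZ mulrzA mulrzAC.
Qed.

Lemma actN p x : act (- p) x = - act p x.
Proof. by rewrite -scaleN1r actZ mulrN1z. Qed.

Lemma act_sum (J : Type) (s : seq J) (F : J -> {poly int}) x :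
  act (\sum_(j <- s) F j) x = \sum_(j <- s) act (F j) x.
Proof. by elim: s => [|j s IH]; rewrite ?big_nil ?act0// !big_cons actD IH. Qed.

Lemma act_monomial n x : act 'X^n x = zpow n x.
Proof.
rewrite /poly_act size_polyXn big_ord_recr /= big1 ?add0r ?coefXn ?eqxx ?mulr1z//.
by move=> i _; rewrite coefXn ltn_eqF// mulr0z.
Qed.

Lemma act_zpow p n x : act p (zpow n x) = zpow n (act p x).
Proof. by rewrite /poly_act zpow_sum; apply: eq_bigr => i _; rewrite zpowMz zpowC. Qed.

Lemma actDr p x y : act p (x + y) = act p x + act p y.
Proof. by rewrite /poly_act -big_split; apply: eq_bigr => i _; rewrite zpowD mulrzDl. Qed.

Lemma act_monomialM n p x : act ('X^n * p) x = zpow n (act p x).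
Proof.
rewrite -[p]coefK poly_def mulr_sumr !act_sum zpow_sum; apply: eq_bigr => i _.
by rewrite -scalerAr -exprD !actZ !act_monomial PoszD zpow_add zpowMz.
Qed.

Lemma actM p q x : act (p * q) x = act p (act q x).
Proof.
rewrite -{1}[p]coefK poly_def mulr_suml act_sum [RHS]/poly_act; apply: eq_bigr => i _.
by rewrite -scalerAl actZ act_monomialM.
Qed.

End IntegerPowers.

Section ContinuousPowers.
Variables (X : topologicalZmodType) (alpha beta : X -> X).
Hypotheses (ab : cancel alpha beta) (ba : cancel beta alpha).
Hypotheses (ac : continuous alpha) (bc : continuous beta).

Local Notation zpow := (zpow alpha beta).
Local Notation act := (poly_act alpha beta).

Lemma zpow_cts n : continuous (zpow n).
Proof.
elim/zpow_ind: n => [|n IH|n IH]; first exact: cts_id.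
  rewrite (_ : zpow (n + 1) = alpha \o zpow n); last by apply/funext => x; rewrite (zpowS ba).
  by move=> x; apply: continuous_comp; [exact: IH|exact: ac].
rewrite (_ : zpow (n - 1) = beta \o zpow n); last by apply/funext => x; rewrite (zpowP ab ba).
by move=> x; apply: continuous_comp; [exact: IH|exact: bc].
Qed.

Lemma act_cts (p : {poly int}) : continuous (act p).
Proof.
rewrite /poly_act; elim: (index_enum _) => [|i s IH].
  by rewrite (_ : (fun x => _) = fun=> 0); [exact: cts_cstg|apply/funext => x; rewrite big_nil].
rewrite (_ : (fun x => _) = fun x => zpow i x *~ p`_i + \sum_(j <- s) zpow j x *~ p`_j);
  last by apply/funext => x; rewrite big_cons.
apply: cts_addg => //.
have cMn m : continuous (fun x => zpow i x *+ m).
  elim: m => [|m IHm].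
    by rewrite (_ : (fun x => _) = fun=> 0); [exact: cts_cstg|apply/funext => x; rewrite mulr0n].
  rewrite (_ : (fun x => _) = fun x => zpow i x + zpow i x *+ m); last by apply/funext => x; rewrite mulrS.
  by apply: cts_addg => //; exact: zpow_cts.
case: (p`_i) => m; first exact: cMn.
by apply: cts_oppg; exact: cMn.
Qed.

End ContinuousPowers.

(** * Sequences tending to zero *)

Section VanishingSequences.
Variable R : realType.

Definition vanishing (u : int -> R) : Prop :=
  forall e, 0 < e -> exists N : nat, forall n : int, (N <= `|n|)%N -> u n <= e.

Lemma vanishingD (u v w : int -> R) : vanishing u -> vanishing v ->
  (forall n, w n <= u n + v n) -> vanishing w.
Proof.
move=> hu hv wuv e e0; have e2 : 0 < e / 2 by rewrite divr_gt0.
have [N HN] := hu _ e2; have [M HM] := hv _ e2; exists (maxn N M) => n.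
rewrite geq_max => /andP[/HN h1 /HM h2]; apply: le_trans (wuv n) _; lra.
Qed.

Lemma vanishingZ c (u : int -> R) : 0 <= c -> vanishing u -> vanishing (fun n => c * u n).
Proof.
move=> c0 hu e e0; have c1 : 0 < c + 1 by rewrite ltr_wpDl.
have [N HN] := hu _ (divr_gt0 e0 c1); exists N => n /HN h.
apply: le_trans (ler_wpM2l c0 h) _; rewrite mulrA ler_pdivrMr// mulrC ler_pM2l//.
by rewrite lerDl.
Qed.

Lemma vanishing_shift m (u : int -> R) : vanishing u -> vanishing (fun n => u (n + m)).
Proof.
move=> hu e e0; have [N HN] := hu _ e0; exists (N + `|m|)%N => n hn.
by apply: HN; lia.
Qed.

Local Notation kact p d n := (\sum_(i < size p) p`_i * d (n + Posz i)).

Let kactE k (p : {poly R[i]%C}) (d : int -> R[i]%C) n : (size p <= k)%N ->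
  kact p d n = \sum_(i < k) p`_i * d (n + Posz i).
Proof.
move=> pk; rewrite (big_ord_widen k (fun i => p`_i * d (n + Posz i)) pk) big_mkcond /=.
by apply: eq_bigr => i _; case: ltnP => // h; rewrite nth_default// mul0r.
Qed.

(** According to whether the modulus of the ratio exceeds [1], the modulus of the
    sequence is monotone one way or the other, and it tends to [0] at both ends. *)
Lemma vanishing_geometric (l : R[i]%C) (d : int -> R[i]%C) :
  vanishing (fun n => normc (d n)) -> (forall n, d (n + 1) = l * d n) -> forall n, d n = 0.
Proof.
move=> vd dl n; apply/eq0_normc/eqP; rewrite eq_le; apply/andP; split; last first.
  by case: (d n) => a b; exact: sqrtr_ge0.
have nc0 (z : R[i]%C) : 0 <= normc z by case: z => a b; exact: sqrtr_ge0.
apply/ler_addgt0Pr => e e0; rewrite add0r; have [N HN] := vd _ e0.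
have [l1|l1] := leP (normc l) 1.
  have H (m : nat) k : normc (d (k + m%:Z)) <= normc (d k).
    elim: m => [|m IH]; first by rewrite addr0.
    rewrite (_ : k + m.+1%:Z = (k + m%:Z) + 1); last by lia.
    by rewrite dl normcM; apply: le_trans IH; rewrite ler_piMl.
  have := H (N + `|n|)%N (n - (N + `|n|)%N%:Z); rewrite subrK => h.
  by apply: le_trans h _; apply: HN; lia.
have H (m : nat) k : normc (d k) <= normc (d (k + m%:Z)).
  elim: m => [|m IH]; first by rewrite addr0.
  rewrite (_ : k + m.+1%:Z = (k + m%:Z) + 1); last by lia.
  by rewrite dl normcM; apply: le_trans IH _; rewrite ler_peMl// ltW.
apply: le_trans (H (N + `|n|)%N n) _; apply: HN; lia.
Qed.

(** Peel off one complex root at a time: the difference [d (n + 1) - l * d n] is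
    killed by the cofactor. *)
Lemma vanishing_killed_complex (p : {poly R[i]%C}) (d : int -> R[i]%C) : p != 0 ->
  vanishing (fun n => normc (d n)) -> (forall n, kact p d n = 0) -> forall n, d n = 0.
Proof.
have [k pk] := ubnP (size p); elim: k p pk d => // k IH p pk d p0 vd dp.
have [s1|s1] := eqVneq (size p) 1%N.
  move=> n; have := dp n; rewrite s1 big_ord_recl big_ord0 addr0 /= addr0 => /eqP.
  rewrite mulf_eq0 => /orP[c0|/eqP//]; exfalso.
  by move: p0; rewrite -lead_coef_eq0 lead_coefE s1 /= c0.
have /closed_rootP[l /factor_theorem[q pq]] := s1.
have q0 : q != 0 by apply: contraNneq p0 => q0; rewrite pq q0 mul0r.
have sp : size p = (size q).+1 by rewrite pq size_Mmonic ?monicXsubC// size_XsubC addn2.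
pose e n := d (n + 1) - l * d n.
have e0 : forall n, e n = 0.
  apply: (IH q) => //; first by move: pk; rewrite sp ltnS.
  - apply: (vanishingD (vanishing_shift 1 vd) (vanishingZ (c := normc l) _ vd)).
      by case: l {pq e} => a b; exact: sqrtr_ge0.
    by move=> n; rewrite -normcM -[normc (l * _)]normcN; exact: le_normcD.
  - move=> n; transitivity (kact p d n); last exact: dp.
    rewrite (@kactE (size q).+1 p) ?sp//.
    have -> : p = q * 'X - l *: q by rewrite pq mulrBr [q * l%:P]mulrC mul_polyC.
    under [RHS]eq_bigr do rewrite coefB coefMX coefZ mulrBl.
    rewrite sumrB [X in _ = X - _]big_ord_recl /= mul0r add0r big_ord_recr /= [q`_(size q)]nth_default// mulr0 mul0r addr0.
    rewrite -sumrB; apply: eq_bigr => i _; rewrite /e mulrBr; congr (_ - _).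
      by rewrite add0n; congr (_ * d _); rewrite /bump leq0n add1n -addn1 PoszD addrA.
    by rewrite mulrCA mulrA.
by apply: (@vanishing_geometric l) => // n; apply/eqP; rewrite -subr_eq0; apply/eqP; exact: e0.
Qed.

End VanishingSequences.

(** * Summation by parts for two-sided sequences *)

Section Sequences.
Variable R : realType.
Implicit Types (s t : int -> R) (p q f : {poly int}) (n c : int).

Definition seq_shift s : int -> R := fun n => s (n + 1).
Definition seq_unshift s : int -> R := fun n => s (n - 1).

Let shiftK : cancel seq_shift seq_unshift.
Proof. by move=> s; apply/funext => n; rewrite /seq_unshift /seq_shift subrK. Qed.

Let unshiftK : cancel seq_unshift seq_shift.
Proof. by move=> s; apply/funext => n; rewrite /seq_unshift /seq_shift addrK. Qed.

Let shiftD s t : seq_shift (s + t) = seq_shift s + seq_shift t. Proof. by []. Qed.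

Local Notation szpow := (@zpow (int -> R) seq_shift seq_unshift).
Local Notation sact := (@poly_act (int -> R) seq_shift seq_unshift).

Lemma zpow_shift m s n : szpow m s n = s (n + m).
Proof.
elim/zpow_ind: m n => [|m IH|m IH] n; first by rewrite addr0.
  by rewrite (zpowS unshiftK) /seq_shift IH; congr s; lia.
by rewrite (zpowP shiftK unshiftK) /seq_unshift IH; congr s; lia.
Qed.

Lemma mulrz_seq s c n : (s *~ c) n = s n *~ c.
Proof.
have H m : (s *+ m) n = s n *+ m.
  by elim: m => [//|m IH]; rewrite !mulrS -IH.
case: c => m; first exact: H.
by rewrite NegzE !mulrNz -!pmulrn -H.
Qed.

Lemma act_seqE p s n : sact p s n = \sum_(i < size p) s (n + Posz i) *~ p`_i.
Proof.
rewrite /poly_act fct_sumE; apply: eq_bigr => i _.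
by rewrite mulrz_seq zpow_shift.
Qed.

Lemma act_cons p c s : sact (p * 'X + c%:P) s = sact p (seq_shift s) + s *~ c.
Proof.
rewrite actD (actM shiftD shiftK unshiftK) -['X]expr1 act_monomial.
congr (_ + _); rewrite -[c%:P]mulr1 mul_polyC -(expr0 'X) actZ act_monomial //.
Qed.

Definition bounded_seq s := exists B, forall n, `|s n| <= B.

Lemma bounded_act p s : bounded_seq s -> bounded_seq (sact p s).
Proof.
move=> [B HB]; exists (\sum_(i < size p) B * `|p`_i|%:~R) => n.
rewrite act_seqE; apply: le_trans (ler_norm_sum _ _ _) _; apply: ler_sum => i _.
by rewrite -mulrzr normrM -intr_norm ler_wpM2r ?ler0z.
Qed.

Lemma vanishing_seq_shift s : vanishing (fun n => `|s n|) -> vanishing (fun n => `|seq_shift s n|).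
Proof. exact: vanishing_shift. Qed.

(** The truncation to the times between [- L] and [L] of the convolution of [t] and
    [s] at [c]. *)
Definition pairing (L : nat) t s c := \sum_(0 <= i < L.*2.+1) t (i%:Z - L%:Z) * s (c - (i%:Z - L%:Z)).

(** The truncated sum telescopes, leaving two boundary terms of size at most a bound
    of [s] times a far value of [t]. *)
Lemma pairing_shift t s c : vanishing (fun n => `|t n|) -> bounded_seq s ->
  (pairing L (seq_shift t) s c - pairing L t (seq_shift s) c) @[L --> \oo] --> (0 : R).
Proof.
move=> vt [B HB]; have E L : pairing L (seq_shift t) s c - pairing L t (seq_shift s) c =
    t (L%:Z + 1) * s (c - L%:Z) - t (- L%:Z) * s (c + L%:Z + 1).
  rewrite /pairing -sumrB.
  pose h (i : nat) := t (i%:Z - L%:Z) * s (c - (i%:Z - L%:Z) + 1).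
  rewrite (eq_bigr (fun i => h i.+1 - h i)) => [|i _].
    rewrite telescope_sumr// /h; congr (t _ * s _ - t _ * s _); lia.
  by rewrite /h /seq_shift; congr (t _ * s _ - t _ * s _); lia.
apply/cvgr0Pnorm_le => e e0.
have B0 : 0 <= B by exact: le_trans (normr_ge0 _) (HB 0).
have B1 : 0 < 2 * (B + 1) by rewrite mulr_gt0// ltr_wpDl.
have [N HN] := vt _ (divr_gt0 e0 B1); exists N => // L /= NL; rewrite E.
have h1 : `|t (L%:Z + 1)| <= e / (2 * (B + 1)) by apply: HN; lia.
have h2 : `|t (- L%:Z)| <= e / (2 * (B + 1)) by apply: HN; lia.
apply: le_trans (ler_normB _ _) _; rewrite !normrM.
have k1 := ler_pM (normr_ge0 _) (normr_ge0 _) h1 (HB (c - L%:Z)).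
have k2 := ler_pM (normr_ge0 _) (normr_ge0 _) h2 (HB (c + L%:Z + 1)).
apply: le_trans (lerD k1 k2) _.
by rewrite -mulrDr mulrAC ler_pdivrMr// ler_pM2l//; lra.
Qed.

(** Summation by parts: up to boundary terms that tend to zero, a polynomial in the
    shift moves from one factor of the pairing to the other. *)
Lemma pairing_act p t s c : vanishing (fun n => `|t n|) -> bounded_seq s ->
  (pairing L (sact p t) s c - pairing L t (sact p s) c) @[L --> \oo] --> (0 : R).
Proof.
elim/poly_ind: p t => [|p a IH] t vt bs.
  rewrite (_ : (fun L => _) = fun=> 0); first exact: cvg_cst.
  apply/funext => L; rewrite /pairing !act0 -sumrB big1// => i _.
  by rewrite mul0r mulr0 subrr.
pose u L := pairing L (sact p (seq_shift t)) s c - pairing L (seq_shift t) (sact p s) c.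
pose v L := pairing L (seq_shift t) (sact p s) c - pairing L t (seq_shift (sact p s)) c.
have uv : (fun L => u L + v L) @ \oo --> (0 + 0 : R).
  apply: cvgD; first exact: IH (vanishing_seq_shift vt) bs.
  exact: pairing_shift vt (bounded_act p bs).
rewrite addr0 in uv; rewrite (_ : (fun L => _) = (fun L => u L + v L))//.
apply/funext => L; rewrite /u /v.
rewrite /pairing -!sumrB -big_split; apply: eq_bigr => i _; rewrite !act_cons.
have -> : sact p (seq_shift s) = seq_shift (sact p s).
  by have := act_zpow shiftD shiftK unshiftK p 1 s.
have ev (x y : int -> R) m : (x + y *~ a) m = x m + y m *~ a by rewrite -mulrz_seq.
pose a' : R := a%:~R; have mz (x : R) : x *~ a = x * a' by rewrite mulrzr.
by rewrite !ev !mz /=; ring.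
Qed.

Definition unit_impulse : int -> R := fun n => (n == 0)%:R.

(** Applied to the impulse, a polynomial displays its coefficients, so finitely
    supported integer sequences are translates of such values. *)
Lemma act_impulse p n : sact p unit_impulse n = if 0 <= - n then (p`_`|n|)%:~R else 0.
Proof.
rewrite act_seqE /unit_impulse; case: ifP => n0.
  have [pn|pn] := ltnP `|n| (size p).
    rewrite (bigD1 (Ordinal pn))//= (_ : n + _ = 0) ?eqxx; last by lia.
    rewrite big1 ?addr0// => i; rewrite -val_eqE /= => ni.
    by rewrite (_ : (n + _ == 0) = false) ?mul0rz//; lia.
  rewrite nth_default// big1// => i _.
  by rewrite (_ : (n + _ == 0) = false) ?mul0rz//; have := ltn_ord i; lia.
by rewrite big1// => i _; rewrite (_ : (n + _ == 0) = false) ?mul0rz//; lia.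
Qed.

End Sequences.

(** * Recurrent sequences with integral defect *)

Section Companion.
Variable R : realType.
Implicit Types (s t : int -> R) (p q f : {poly int}) (n c : int).

Local Notation seq_shift := (@seq_shift R).
Local Notation seq_unshift := (@seq_unshift R).
Local Notation szpow := (@zpow (int -> R) seq_shift seq_unshift).
Local Notation sact := (@poly_act (int -> R) seq_shift seq_unshift).

Let shiftK : cancel seq_shift seq_unshift.
Proof. by move=> s; apply/funext => n; rewrite /seq_unshift /seq_shift subrK. Qed.

Let unshiftK : cancel seq_unshift seq_shift.
Proof. by move=> s; apply/funext => n; rewrite /seq_unshift /seq_shift addrK. Qed.

Let shiftD s t : seq_shift (s + t) = seq_shift s + seq_shift t. Proof. by []. Qed.

Lemma act_seq_boundE k p s n : (size p <= k)%N ->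
  sact p s n = \sum_(i < k) s (n + Posz i) *~ p`_i.
Proof.
move=> pk; rewrite (@actE (int -> R) seq_shift seq_unshift k p s pk) fct_sumE; apply: eq_bigr => i _.
by rewrite mulrz_seq zpow_shift.
Qed.

Lemma act_mulrz p s c : sact p (s *~ c) = sact p s *~ c.
Proof.
apply/funext => n; rewrite mulrz_seq !act_seqE mulrz_suml; apply: eq_bigr => i _.
by rewrite mulrz_seq mulrzAC.
Qed.

Lemma vanishing_act p t : vanishing (fun n => `|t n|) -> vanishing (fun n => `|sact p t n|).
Proof.
move=> vt e e0; pose B := \sum_(i < size p) `|(p`_i)%:~R| : R.
have B0 : 0 <= B by apply: sumr_ge0.
have B1 : 0 < B + 1 by rewrite ltr_wpDl.
have [N HN] := vt _ (divr_gt0 e0 B1); exists (N + size p)%N => n Nn.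
rewrite act_seqE; apply: le_trans (ler_norm_sum _ _ _) _.
apply: (@le_trans _ _ (\sum_(i < size p) e / (B + 1) * `|(p`_i)%:~R|)).
  apply: ler_sum => i _; rewrite -mulrzr normrM ler_wpM2r//.
  by apply: HN; have := ltn_ord i; lia.
rewrite -mulr_sumr -/B mulrAC ler_pdivrMr// ler_pM2l//; lra.
Qed.

Lemma vanishing_int_support (v : int -> R) : vanishing (fun n => `|v n|) ->
  (forall n, v n \is a Num.int) -> exists N : nat, forall n, (N <= `|n|)%N -> v n = 0.
Proof.
move=> vv vi; have e0 : 0 < 1 / 2 :> R by rewrite divr_gt0.
have [N HN] := vv _ e0; exists N => n /HN h; apply: int_small => //; lra.
Qed.

(** The sequence [f(S) t] is integral and tends to [0], so it has finite support.  The
    coefficients of [V] list it backwards, because the pairing is a convolution. *)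
Lemma companion_exists f s t : bounded_seq s -> sact f s = 0 ->
  vanishing (fun n => `|t n|) -> (forall n, sact f t n \is a Num.int) ->
  exists V (N : nat), sact V s = 0 /\ sact f t = szpow (- N%:Z) (sact V (@unit_impulse R)).
Proof.
move=> bs fs vt vi; set v := sact f t in vi *.
have [N HN] : exists N : nat, forall n, (N <= `|n|)%N -> v n = 0.
  exact: vanishing_int_support (vanishing_act f vt) vi.
pose V (L : nat) : {poly int} := \poly_(j < L.*2.+1) Num.floor (v (L%:Z - j%:Z)).
have fl n : (Num.floor (v n))%:~R = v n by have := vi n; rewrite intrEfloor => /eqP.
exists (V N), N; split; last first.
  apply/funext => n; rewrite zpow_shift act_impulse; case: ifP => h; last by rewrite HN//; lia.
  rewrite coef_poly; case: ifP => k; last by rewrite HN//; lia.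
  by rewrite fl; congr v; lia.
(* a wider window only multiplies the polynomial by a power of the variable *)
have VE L : (N <= L)%N -> V L = 'X^(L - N) * V N.
  move=> NL; apply/polyP => j; rewrite coefXnM !coef_poly.
  case: ifP => h1; case: ifP => h2.
  - by rewrite HN ?floor0//; lia.
  - case: ifP => h3; first by congr (Num.floor (v _)); lia.
    by rewrite HN ?floor0//; lia.
  - by [].
  - by case: ifP => h3 //; exfalso; lia.
apply/funext => m; pose c := m + N%:Z.
have pE L : (N <= L)%N -> pairing L v s c = sact (V N) s m.
  move=> NL; have -> : sact (V N) s m = sact (V L) s (c - L%:Z).
    rewrite (VE L NL) (act_monomialM shiftD shiftK unshiftK) zpow_shift; congr (sact _ _ _); rewrite /c; lia.
  rewrite (act_seq_boundE (k := L.*2.+1)) ?size_poly//.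
  rewrite /pairing big_nat_rev big_mkord; apply: eq_bigr => i _ /=.
  rewrite coef_poly ltn_ord -mulrzr fl mulrC; congr (s _ * v _); have := ltn_ord i; lia.
have := pairing_act f c vt bs; rewrite fs => h.
apply/eqP; rewrite -normr_le0; apply/ler_addgt0Pr => e e0; rewrite add0r.
move/cvgr0Pnorm_le: h => /(_ e e0) [M _ HM].
have := HM (maxn M N) (leq_maxl _ _); rewrite /= pE ?leq_maxr//.
rewrite (_ : pairing _ t 0 c = 0) ?subr0//.
by rewrite /pairing big1// => i _; rewrite mulr0.
Qed.

Lemma vanishing_killed f (d : int -> R) : f != 0 -> vanishing (fun n => `|d n|) ->
  sact f d = 0 -> d = 0.
Proof.
move=> f0 vd fd; pose dC n : R[i]%C := (d n)%:C%C.
pose fC : {poly R[i]%C} := map_poly intr f.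
have sf : size fC = size f by rewrite size_map_inj_poly// => a b /intr_inj.
have H : forall n, dC n = 0.
  apply: (@vanishing_killed_complex _ fC).
  - by rewrite -size_poly_eq0 sf size_poly_eq0.
  - move=> e /vd[N HN]; exists N => n /HN; rewrite /dC /normc /= expr0n addr0.
    by rewrite sqrtr_sqr.
  - move=> n; transitivity ((sact f d n)%:C%C); last by rewrite fd.
    rewrite act_seqE rmorph_sum /= sf; apply: eq_bigr => i _.
    by rewrite coef_map_id0//= rmorphMz mulrC mulrzr.
by apply/funext => n; have := H n => /(congr1 (@complex.Re R)).
Qed.

(** Both [f] and [V] kill [s], so they are not coprime, and [f] divides [V] up to a
    constant [c]; the quotient gives the integer sequence that [c t] equals. *)
Theorem homoclinic_lift_rational f s t :
  (forall g, g %| f -> size g != 1%N -> g %= f)%R -> f != 0 -> s <> 0 ->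
  bounded_seq s -> sact f s = 0 ->
  vanishing (fun n => `|t n|) -> (forall n, sact f t n \is a Num.int) ->
  exists2 c, c != 0 & forall n, t n *~ c \is a Num.int.
Proof.
move=> fmin f0 s0 bs fs vt vi.
have [V [N [Vs vE]]] := companion_exists bs fs vt vi.
have [cop|ncop] := boolP (coprimep f V).
  have /Pdiv.Idomain.Bezout_coprimepP[[u w] /eqpP[[c1 c2] /andP[/= c1n c2n] e]] := cop.
  exfalso; apply: s0; apply/funext => n.
  have /(congr1 (fun p => sact p s n)) := e.
  rewrite !actZ actD !(actM shiftD shiftK unshiftK) fs Vs.
  have a0 p : sact p 0 = 0 by rewrite -[0](mulr0z (0 : int -> R)) act_mulrz mulr0z.
  rewrite !a0 addr0 mul0rz -(expr0 'X) act_monomial mulrz_seq => /esym /eqP.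
  by rewrite mulrz_eq0 (negbTE c2n) => /eqP.
have /Pdiv.Idomain.dvdpP[[c q] /= cn cE] : f %| V.
  have gf := fmin _ (dvdp_gcdl f V) ncop.
  by rewrite -(eqp_dvdl _ gf) dvdp_gcdr.
exists c => //.
pose h := szpow (- N%:Z) (sact q (@unit_impulse R)).
have hE : sact f h = sact f t *~ c.
  rewrite vE /h (act_zpow shiftD shiftK unshiftK) -(actM shiftD shiftK unshiftK) mulrC -cE.
  by rewrite actZ (zpowMz shiftD shiftK unshiftK).
have d0 : t *~ c - h = 0.
  apply: (vanishing_killed f0).
    apply: (vanishingD (u := fun n => `|c|%:~R * `|t n|) (v := fun n => `|h n|)).
    - by apply: vanishingZ => //; rewrite ler0z.
    - move=> e e0; exists (N + size q)%N => n Nn.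
      rewrite /h zpow_shift act_impulse; case: ifP => k; last by rewrite normr0 ltW.
      by rewrite nth_default ?mulr0z ?normr0 ?(ltW e0)//; move: (size q) Nn => m Nn; lia.
    - move=> n; have -> : (t *~ c - h) n = t n *~ c - h n by rewrite -mulrz_seq.
      apply: le_trans (ler_normB _ _) _; rewrite lerD2r -mulrzr normrM mulrC.
      by rewrite intr_norm.
  have -> : t *~ c - h = t *~ c + h *~ (-1) by rewrite mulrN1z.
  by rewrite (actDr shiftD shiftK unshiftK) !act_mulrz hE mulrN1z subrr.
move=> n; rewrite -mulrz_seq (_ : t *~ c = h).
  rewrite /h zpow_shift act_impulse; case: ifP => _; [exact: intr_int|exact: rpred0].
by apply/eqP; rewrite -subr_eq0 d0.
Qed.

End Companion.

(** * Homoclinic points of irreducible automorphisms *)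

Section IrreducibleAutomorphism.
Variables (R : realType) (X : topologicalZmodType).
Hypotheses (hausX : hausdorff_space X) (cptX : compact [set: X]).
Variables (alpha beta : X -> X).
Hypothesis aD : forall x y, alpha (x + y) = alpha x + alpha y.
Hypotheses (ab : cancel alpha beta) (ba : cancel beta alpha).
Hypotheses (ac : continuous alpha) (bc : continuous beta).
Hypothesis irr : forall H : set X, subgroup H -> closed H ->
  (forall x, H x <-> H (alpha x)) -> H <> setT -> finite_set H.

Local Notation zpow := (zpow alpha beta).
Local Notation act := (poly_act alpha beta).

Implicit Types (x y : X) (f p q : {poly int}) (n c : int).

Let zpowDx n x y : zpow n (x + y) = zpow n x + zpow n y.
Proof. exact: (zpowD aD ab ba). Qed.

Lemma exponent_of_proper (H : set X) : subgroup H -> closed H ->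
  (forall x, H x <-> H (alpha x)) -> H <> setT ->
  exists2 m, (0 < m)%N & forall x, H x -> x *+ m = 0.
Proof.
move=> sH cH aH HT; apply: finite_subgroup_exponent; first exact: irr.
by move=> x n; exact: subgroupMn.
Qed.

Definition homoclinic x := forall U : set X, nbhs (0 : X) U ->
  exists N : nat, forall n, (N <= `|n|)%N -> U (zpow n x).

(** Close to [0] a finite set contains no point other than [0]. *)
Lemma homoclinic_finite (H : set X) x : finite_set H -> (forall n, H (zpow n x)) ->
  homoclinic x -> x = 0.
Proof.
move=> fH Hx hx; have fin : finite_set (H `\` [set 0]) by exact: finite_setD.
have U0 : nbhs (0 : X) (~` (H `\` [set 0])).
  apply: open_nbhs_nbhs; split; last by move=> [_ /=]; apply.
  by apply: closed_openC; apply: (iffLR accessible_finite_set_closed) => //; exact: hausdorff_accessible.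
have [N HN] := hx _ U0; have /not_andP[h|/contrapT z0] := HN N%:Z (leqnn _).
  by exfalso; apply: h; exact: Hx.
have := zpow_add ab ba (- N%:Z) N%:Z x.
by rewrite addNr zpow0 (z0 : zpow N%:Z x = 0) (zpow_0 aD ab ba).
Qed.

Lemma mulrn_continuous (m : nat) : continuous (fun x : X => x *+ m).
Proof.
elim: m => [|m IH].
  by rewrite (_ : (fun x => _) = fun=> 0); [exact: cts_cstg|apply/funext => x; rewrite mulr0n].
rewrite (_ : (fun x => _) = fun x => x + x *+ m); last by apply/funext => x; rewrite mulrS.
by apply: cts_addg => //; exact: cts_id.
Qed.

Lemma torsion_closed (m : nat) : closed [set x : X | x *+ m = 0].
Proof.
rewrite (_ : [set x | _] = (fun x : X => x *+ m) @^-1` [set 0])//.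
apply: closed_comp; first by move=> x _; exact: mulrn_continuous.
exact/accessible_closed_set1/hausdorff_accessible.
Qed.

Variable r : X -> R.
Hypothesis rc : character r.
Hypothesis rn : exists x, r x \isn't a Num.int.

Lemma character_zpow n : character (fun x => r (zpow n x)).
Proof. by apply: character_comp => //; exact: zpow_cts. Qed.

Lemma kernels_closed (J : Type) (chi : J -> X -> R) : (forall j, character (chi j)) ->
  closed [set x | forall j, chi j x \is a Num.int].
Proof.
move=> cc; have -> : [set x | forall j, chi j x \is a Num.int] =
    \bigcap_(j in setT) [set x | chi j x \is a Num.int].
  by apply/seteqP; split => x H j; [move=> _; exact: H|exact: H].
by apply: closed_bigI => j _; exact: character_kernel_closed.
Qed.

Lemma kernels_subgroup (J : Type) (chi : J -> X -> R) : (forall j, character (chi j)) ->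
  subgroup [set x | forall j, chi j x \is a Num.int].
Proof.
move=> cc; split; first by move=> j; exact: character0.
by move=> x y Kx Ky j; apply: (character_kernel_subgroup (cc j)).2; [exact: Kx|exact: Ky].
Qed.

Definition relation p := forall x, r (act p x) \is a Num.int.

(** The points along whose orbits [r] is constant modulo the integers form a finite
    subgroup or everything.  If it is finite, some multiple of [r] vanishes on it,
    and a further multiple is a combination of the characters
    [r] o [alpha^n (alpha - 1)].  The difference is a polynomial relation; it is
    nonzero because the combination vanishes at [1] and the multiple does not. *)
Lemma relation_exists : exists2 p, p != 0 & relation p.
Proof.
pose chi n x := r (zpow n (alpha x - x)).
have cchi n : character (chi n).
  apply: (@character_comp R X (fun x => r (zpow n x)) (fun x => alpha x - x)).
  - exact: character_zpow.
  - by move=> x; apply: cvg_subg; [exact: ac|exact: cvg_id].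
  - by move=> x y; rewrite aD opprD addrACA.
pose H := [set x | forall n, chi n x \is a Num.int].
have chiS n x : chi n (alpha x) = chi (n + 1) x.
  have aB u v : alpha (u - v) = alpha u - alpha v.
    by rewrite aD; congr (_ + _); exact: (zpowN aD ab ba 1 v).
  by rewrite /chi (zpow_add ab ba n 1) zpow1 aB.
have [HT|HT] := pselect (H = setT).
  exists ('X - 1); first by rewrite -size_poly_eq0 -polyC1 size_XsubC.
  move=> x; have : H x by rewrite HT.
  move=> /(_ 0); rewrite /chi zpow0 actD actN.
  by rewrite -{1}['X]expr1 -(expr0 'X) !act_monomial.
have sH : subgroup H by exact: kernels_subgroup.
have cH : closed H by exact: kernels_closed.
have aH x : H x <-> H (alpha x).
  split=> Hx n; first by rewrite chiS; exact: Hx.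
  by have := Hx (n - 1); rewrite chiS subrK.
have [m m0 Hm] := exponent_of_proper sH cH aH HT.
(* an enumeration of the integers, to index the characters by natural numbers *)
pose e (i : nat) : int := odflt 0 (unpickle i).
have eK n : e (pickle n) = n by rewrite /e pickleK.
have [|l [k [q [l0 Hq]]]] := character_span cptX (fun i => cchi (e i)) (character_scale m%:Z rc).
  move=> x Hx; have hx : H x by move=> n; rewrite -(eK n); exact: Hx.
  have := characterMn x m rc; rewrite (Hm _ hx) => h.
  apply: (int_transfer (rpredB (character0 rc) h)); rewrite -mulr_natl /=; ring.
(* negative powers of [alpha] are cleared by evaluating at [alpha^N x] *)
pose N := (\sum_(i < k) `|e i|)%N.
have eN (i : 'I_k) : (`|e i| <= N)%N by rewrite /N (bigD1 i)//= leq_addr.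
pose p : {poly int} := (l * m)%:Z *: 'X^N - \sum_(i < k) q i *: ('X^`|N%:Z + e i| * ('X - 1)).
exists p.
  have : p.[1] != 0; last by apply: contraNneq => ->; rewrite horner0.
  rewrite /p hornerD hornerN hornerZ hornerXn expr1n mulr1 horner_sum big1 ?subr0.
    by rewrite eqz_nat -lt0n muln_gt0 l0.
  by move=> i _; rewrite hornerZ hornerM -polyC1 hornerXsubC subrr !mulr0.
move=> x; pose d := alpha x - x; pose y i := zpow (N%:Z + e i) d.
have aE (i : 'I_k) : act (q i *: ('X^`|N%:Z + e i| * ('X - 1))) x = y i *~ q i.
  rewrite actZ (act_monomialM aD ab ba) actD actN -['X]expr1 -(expr0 'X) !act_monomial.
  by congr (zpow _ _ *~ _); have := eN i; lia.
have pE : act p x = zpow N x *~ (l * m)%:Z - \sum_(i < k) y i *~ q i.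
  by rewrite /p actD actN actZ act_monomial act_sum; congr (_ - _); apply: eq_bigr => i _; exact: aE.
have chiE i : chi (e i) (zpow N x) = r (y i).
  rewrite /chi -(zpow1 alpha beta (zpow N x)) (zpowC ab ba) zpow1 -(zpowN aD ab ba) -zpowDx.
  by rewrite -(zpow_add ab ba) addrC.
have h1 := characterB (zpow N x *~ (l * m)%:Z) (\sum_(i < k) y i *~ q i) rc.
have h2 := characterMz (zpow N x) (l * m)%:Z rc.
have h3 := character_sum (index_enum 'I_k) (fun i : 'I_k => y i *~ q i) rc.
have h4 : \sum_(i < k) (r (y i *~ q i) - (q i)%:~R * r (y i)) \is a Num.int.
  by apply: rpred_sum => i _; rewrite mulrzl; exact: characterMz.
have := Hq (zpow N x); under eq_bigr do rewrite chiE; move=> h5.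
rewrite sumrB in h4.
have e5 : m%:Z%:~R * r (zpow N x) *+ l = r (zpow N x) *~ (l * m)%:Z.
  by rewrite -!pmulrn mulr_natl -mulrnA mulnC.
rewrite pE; rewrite e5 in h5.
apply: (int_transfer (rpredD (rpredB (rpredD h1 h2) (rpredD h3 h4)) h5)); ring.
Qed.

Lemma relation_of_multiple p (m : nat) : (0 < m)%N ->
  (forall x, act p x *+ m = 0) -> relation (m%:Z *: p).
Proof. by move=> m0 H x; rewrite actZ -pmulrn H; exact: character0. Qed.

(** Let [f] be [q g] up to a constant.  If [g(alpha)] is onto then [q] is a smaller
    relation; otherwise its image has a finite exponent [m], and [m g] is a
    relation, no smaller than [f]. *)
Lemma minimal_relation_prime f : f != 0 -> relation f ->
  (forall p, p != 0 -> relation p -> (size f <= size p)%N) ->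
  forall g, (g %| f)%R -> size g != 1%N -> (g %= f)%R.
Proof.
move=> f0 rf fmin g gf sg; have g0 : g != 0.
  by apply: contraTneq gf => ->; rewrite dvd0p.
rewrite -dvdp_size_eqp// eqn_leq (dvdp_leq f0 gf) /=.
have /Pdiv.Idomain.dvdpP[[c q] /= c0 cE] := gf.
have q0 : q != 0.
  by apply: contraNneq f0 => q0; move/eqP: cE; rewrite q0 mul0r scale_poly_eq0 (negbTE c0).
pose D := range (act g).
have actB u v : act g (u - v) = act g u - act g v.
  apply/eqP; rewrite eq_sym subr_eq -(actDr aD ab ba) subrK //.
have sD : subgroup D.
  split; first by exists 0 => //; apply: (addrI (act g 0)); rewrite -(actDr aD ab ba) !addr0.
  by move=> _ _ [u _ <-] [v _ <-]; exists (u - v).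
have cD : closed D.
  apply: compact_closed => //; apply: continuous_compact => //.
  by apply: continuous_subspaceT; exact: (act_cts ab ba ac bc).
have aDD x : D x <-> D (alpha x).
  split=> [[u _ <-]|[u _ ux]].
    by exists (alpha u) => //; exact: (act_zpow aD ab ba g 1 u).
  exists (beta u) => //; rewrite -[LHS]ab -[RHS]ab -ux; congr beta.
  by rewrite -[in RHS](ba u); apply/esym; exact: (act_zpow aD ab ba g 1 (beta u)).
have [DT|DT] := pselect (D = setT).
  have rq : relation q.
    move=> x; have [u _ <-] : D x by rewrite DT.
    rewrite -(actM aD ab ba) -cE actZ.
    have := characterMz (act f u) c rc; have := rf u => h1 h2.
    have h3 := rpredM (intr_int R c) h1; rewrite mulrzl in h3.
    by have := rpredD h2 h3; rewrite subrK.
  have := fmin _ q0 rq; have : size (c *: f) = size f by rewrite size_scale.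
  rewrite cE size_mul// => <-.
  have : (0 < size g)%N by rewrite lt0n size_poly_eq0.
  by move: sg; move: (size g) (size q) => a b; lia.
have [m m0 Hm] := exponent_of_proper sD cD aDD DT.
have mz : m%:Z != 0 by rewrite eqz_nat -lt0n.
have := fmin (m%:Z *: g); rewrite scale_poly_eq0 (negbTE mz) g0 size_scale//; apply=> //.
by apply: relation_of_multiple => // x; apply: Hm; exists x.
Qed.

Local Notation sact := (@poly_act (int -> R) (@seq_shift R) (@seq_unshift R)).

Definition orbit_lift x : int -> R := fun n => centered (r (zpow n x)).

(** Modulo the integers, the left-hand side is [r] at [f(alpha)] of a point of the
    orbit. *)
Lemma orbit_lift_relation f x n : relation f -> sact f (orbit_lift x) n \is a Num.int.
Proof.
move=> rf; rewrite act_seqE.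
have h1 := rf (zpow n x); rewrite /poly_act in h1.
have h2 := character_sum (index_enum 'I_(size f))
  (fun i : 'I_(size f) => zpow i (zpow n x) *~ f`_i) rc.
have h3 : \sum_(i < size f) (r (zpow i (zpow n x) *~ f`_i) - orbit_lift x (n + Posz i) *~ f`_i) \is a Num.int.
  apply: rpred_sum => i _; rewrite -(zpow_add ab ba) [(i%:Z + n)%R]addrC.
  have k1 := characterMz (zpow (n + i%:Z) x) f`_i rc.
  have k2 := rpredM (intr_int R f`_i) (centered_int (r (zpow (n + i%:Z) x))).
  rewrite mulrBr !mulrzl in k2.
  by apply: (int_transfer (rpredD k1 k2)); rewrite /orbit_lift; ring.
rewrite sumrB in h3.
apply: (int_transfer (rpredB (rpredB h1 h2) h3)); ring.
Qed.

Let F := [set y | forall n, r (zpow n y) \is a Num.int].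

Lemma kernel_subgroup : subgroup F.
Proof. by apply: kernels_subgroup => n; exact: character_zpow. Qed.

Lemma kernel_finite : finite_set F.
Proof.
apply: irr; first exact: kernel_subgroup.
- by apply: kernels_closed => n; exact: character_zpow.
- move=> x; rewrite -(zpow1 alpha beta); split=> Fx n.
    by rewrite -(zpow_add ab ba); exact: Fx.
  by have := Fx (n - 1); rewrite -(zpow_add ab ba) subrK.
- move=> FT; have [x /negP] := rn; apply.
  by have Fx : F x by [rewrite FT]; exact: (Fx 0).
Qed.

(** If the lift along the orbit is smaller than the reciprocal of the sum of the
    coefficients of [f], the integers [f(S) s n] have absolute value below [1].  The
    lift vanishes identically only on a finite subgroup, which is avoided. *)
Lemma neutral_sequence f :
  (forall U : set X, nbhs (0 : X) U -> exists2 z, z != 0 & forall n, U (zpow n z)) ->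
  relation f -> exists s : int -> R, [/\ bounded_seq s, s <> 0 & sact f s = 0].
Proof.
move=> nonexp rf; pose B := \sum_(i < size f) `|(f`_i)%:~R| : R.
have B0 : 0 <= B by apply: sumr_ge0.
have B1 : 0 < 2 * (B + 1) by rewrite mulr_gt0// ltr_wpDl.
pose e := (2 * (B + 1))^-1; have e0 : 0 < e by rewrite invr_gt0.
have e2 : e <= 1 / 2 by rewrite div1r lef_pV2 ?posrE//; lra.
have fin : finite_set (F `\` [set 0]) by apply: finite_setD; exact: kernel_finite.
have U0 : nbhs (0 : X) (~` (F `\` [set 0])).
  apply: open_nbhs_nbhs; split; last by move=> [_ /=]; apply.
  by apply: closed_openC; apply: (iffLR accessible_finite_set_closed) => //; exact: hausdorff_accessible.
have [z z0 Uz] := nonexp _ (filterI U0 (character_near 0 rc e0)).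
have sE n : `|orbit_lift z n| <= e.
  have [_ h] := Uz n; rewrite /orbit_lift.
  have [b|b] := ltP e (1 / 2); last exact: le_trans (centered_half _) b.
  rewrite (_ : centered (r (zpow n z)) = centered (r (zpow n z) - r 0))//.
  apply: centered_congr; first by rewrite opprB addrC subrK; exact: character0.
  exact: le_lt_trans h b.
exists (orbit_lift z); split.
- by exists e.
- move=> s0; move/eqP: z0; apply; have [nF _] := Uz 0.
  have Fz : F z by move=> n; rewrite -centered_eq0; apply/eqP; exact: (congr1 (@^~ n) s0).
  by apply: contrapT => zn0; apply: nF.
- apply/funext => n; apply: int_small; first exact: orbit_lift_relation.
  rewrite act_seqE; apply: le_lt_trans (ler_norm_sum _ _ _) _.
  apply: (@le_lt_trans _ _ (\sum_(i < size f) e * `|(f`_i)%:~R|)).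
    by apply: ler_sum => i _; rewrite -mulrzr normrM ler_wpM2r.
  rewrite -mulr_sumr -/B /e mulrC ltr_pdivrMr//; lra.
Qed.

(** The lift of [r] along the orbit of [x] becomes integral after multiplication by
    some [c], so a multiple of [x] lies in the finite subgroup on which [r] vanishes
    along orbits, hence is [0]; and the torsion of a given exponent is finite too,
    since otherwise [f] would be constant and could not kill [s]. *)
Theorem homoclinic_trivial x :
  (forall U : set X, nbhs (0 : X) U -> exists2 z, z != 0 & forall n, U (zpow n z)) ->
  homoclinic x -> x = 0.
Proof.
move=> nonexp hx.
pose P k := `[< exists p, [/\ p != 0, relation p & size p = k] >].
have [p p0 rp] := relation_exists.
have exP : exists k, P k by exists (size p); apply/asboolP; exists p.
case: (ex_minnP exP) => k /asboolP[f [f0 rf fk]] kmin.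
have fmin q : q != 0 -> relation q -> (size f <= size q)%N.
  by move=> q0 rq; rewrite fk; apply: kmin; apply/asboolP; exists q.
have [s [bs s0 fs]] := neutral_sequence nonexp rf.
have vt : vanishing (fun n => `|orbit_lift x n|).
  move=> e e0; have [N HN] := hx _ (character_near 0 rc (ltac:(rewrite lt_min e0 divr_gt0//) : 0 < Num.min e (1 / 4))).
  exists N => n /HN h; rewrite /orbit_lift.
  have [h1 h2] : Num.min e (1 / 4) <= e /\ Num.min e (1 / 4) <= 1 / 4 by rewrite !ge_min !lexx orbT.
  rewrite (centered_congr (u := r (zpow n x) - r 0)); first exact: le_trans h h1.
    by rewrite opprB addrC subrK; exact: character0.
  apply: le_lt_trans h _; apply: le_lt_trans h2 _; lra.
have [c c0 Hc] := homoclinic_lift_rational (minimal_relation_prime f0 rf fmin) f0 s0 bs fs vt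
  (fun n => orbit_lift_relation x n rf).
pose m := `|c|%N; have m0 : (0 < m)%N by rewrite absz_gt0.
have Fxm : F (x *+ m).
  move=> n; rewrite (zpowMn aD ab ba).
  have h1 := characterMn (zpow n x) m rc.
  have h2 := rpredMn m (centered_int (r (zpow n x))).
  have h3 : orbit_lift x n *+ m \is a Num.int.
    have := Hc n; rewrite -mulrzl => h; rewrite -mulr_natl /m.
    have [cp|cn] := leP 0 c.
      have cz : `|c|%N%:Z = c by lia.
      by have -> : (`|c|%N)%:R = c%:~R :> R by rewrite -{2}cz.
    have cz : `|c|%N%:Z = - c by lia.
    have -> : (`|c|%N)%:R = (- c)%:~R :> R by rewrite -cz.
    by rewrite intrN mulNr rpredN.
  rewrite mulrnBl in h2.
  apply: (int_transfer (rpredD (rpredD h1 h2) h3)); rewrite /orbit_lift; ring.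
have hmul : homoclinic (x *+ m).
  move=> U U0; have cM : (fun y : X => y *+ m) @ (0 : X) --> (0 : X).
    by have := @mulrn_continuous m 0; rewrite /continuous_at mul0rn.
  have [N HN] := hx _ (cM _ U0); exists N => n /HN h.
  by rewrite (zpowMn aD ab ba).
have Fz y : F y -> forall n, F (zpow n y).
  by move=> Fy n k0; rewrite -(zpow_add ab ba); exact: Fy.
have xm0 : x *+ m = 0 by apply: (homoclinic_finite kernel_finite (Fz _ Fxm) hmul).
pose T := [set y : X | y *+ m = 0].
have Tz y : T y -> forall n, T (zpow n y).
  by move=> Ty n; rewrite /T /= -(zpowMn aD ab ba) (Ty : _ = 0) (zpow_0 aD ab ba).
have [TT|TT] := pselect (T = setT); last first.
  apply: (@homoclinic_finite T) => //; last exact: Tz.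
  apply: irr => //; last 1 first.
  - move=> y; split => Ty; first exact: (Tz y Ty 1).
    by have := Tz _ Ty (-1); rewrite -(zpow1 alpha beta y) -(zpow_add ab ba) addNr.
  - by split; [rewrite /T /= mul0rn|move=> u v /= Tu Tv; rewrite /T /= mulrnBl Tu Tv subrr].
  - exact: torsion_closed.
exfalso; have rm : relation (m%:Z *: 1).
  apply: relation_of_multiple => // y; have : T (act 1 y) by rewrite TT.
  by [].
have m1 : m%:Z *: (1 : {poly int}) != 0.
  by rewrite scale_poly_eq0 oner_eq0 orbF eqz_nat -lt0n.
have := fmin _ m1 rm; rewrite size_scale ?eqz_nat -?lt0n// size_poly1 => f1.
have /size_poly1P[a a0 fa] : size f == 1%N by rewrite eqn_leq f1 lt0n size_poly_eq0.
apply: s0; apply/funext => n; have /(congr1 (@^~ n)) := fs.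
rewrite fa act_seqE size_polyC a0 big_ord_recl big_ord0 coefC /= addr0 addr0 => /eqP.
by rewrite mulrz_eq0 (negbTE a0) => /eqP.
Qed.

End IrreducibleAutomorphism.

(** * Shifts of finite type *)

Section Shifts.
Variable A : countType.

(** Otherwise points outside [W] that agree with [q] on longer and longer windows
    would converge to [q]. *)
Lemma nbhs_full_shift_cylinder (q : full_shift A) (W : set (full_shift A)) :
  nbhs q W -> exists M : nat, forall u : full_shift A,
    (forall j : int, (`|j| <= M)%N -> u j = q j) -> W u.
Proof.
move=> qW; apply: contrapT => /forallNP H.
have bad (M : nat) : exists u : full_shift A,
    (forall j : int, (`|j| <= M)%N -> u j = q j) /\ ~ W u.
  have /existsNP[u /not_implyP[h1 h2]] := H M; by exists u.
have [u_ uP] := choice bad.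
have cu : u_ @ \oo --> q.
  apply/cvg_sup => j U; rewrite nbhsE => Uq.
  case: Uq => O [[B _ <-] Bq] OU.
  exists `|j|%N => //; move=> M jM; apply: OU.
  by rewrite /= (proj1 (uP M)).
have [M _ /(_ M (leqnn _))] := cu _ qW.
exact: (proj2 (uP M)).
Qed.

Lemma irreducible_matrix_rev (P : rel A) : irreducible_matrix P ->
  irreducible_matrix (fun a b => P b a).
Proof.
move=> Pirr a a'; have [s [s0 Ps sl]] := Pirr a' a.
case: s s0 Ps sl => // x s _ Ps sl; exists (rev (belast a' (x :: s))).
split; first by rewrite /= rev_cons; case: (rev _).
  by rewrite -[in path _ a]sl rev_path.
by rewrite /= rev_cons last_rcons.
Qed.

(** Follow a path from [b] to the origin of [q], then [q] itself. *)
Lemma right_extension (P : rel A) (q : nat -> A) b : irreducible_matrix P ->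
  (forall i, P (q i) (q i.+1)) -> exists (x : nat -> A) (L : nat),
  [/\ x 0%N = b, forall i, P (x i) (x i.+1) & forall i, (L <= i)%N -> x i = q (i - L)%N].
Proof.
move=> Pirr qP; have [s [s0 Ps sl]] := Pirr b (q 0%N).
exists (fun i => if (i < size s)%N then nth b (b :: s) i else q (i - size s)%N), (size s).
split.
- by case: s s0 Ps sl.
- move=> i; case: ltnP => h1; case: ltnP => h2.
  + by have /(pathP b)/(_ i h1) := Ps.
  + have e : i.+1 = size s by apply/eqP; rewrite eqn_leq h1 h2.
    rewrite e subnn -sl (last_nth b) -e /=.
    by have /(pathP b)/(_ i h1) := Ps.
  + by have := leq_trans (ltnW h2) h1; rewrite ltnn.
  + by rewrite subSn.
- by move=> i; rewrite leqNgt => /negbTE ->.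
Qed.

Lemma periodic_point (P : rel A) (a : A) : irreducible_matrix P ->
  exists (q : int -> A) (m : nat), [/\ (0 < m)%N, forall n, P (q n) (q (n + 1)) &
    forall n, q n = q (n %% m%:Z)%Z].
Proof.
move=> Pirr; have [s [s0 Ps sl]] := Pirr a a.
have m0 : (0 < size s)%N by case: s s0 {Ps sl}.
exists (fun n => nth a s `|(n %% (size s)%:Z)%Z|%N), (size s); split=> //.
  move=> n; set m := size s.
  have mz : m%:Z != 0 by rewrite eqz_nat -lt0n.
  have i0 := modz_ge0 n mz; have i1 := ltz_pmod n (_ : 0 < m%:Z).
  have {i1} i1 : (n %% m)%Z < m%:Z by apply: i1; rewrite ltz_nat.
  rewrite -modzDml; set i := (n %% m)%Z in i0 i1 *.
  have [im|im] := ltP (i + 1) m%:Z.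
    have -> : ((i + 1) %% m)%Z = i + 1 by rewrite modz_small// im andbT; lia.
    have h : (`|i|.+1 < size s)%N by rewrite -/m; lia.
    have -> : absz (i + 1) = (absz i).+1 by lia.
    by have /(pathP a)/(_ _ h) := Ps.
  have -> : i + 1 = m%:Z by lia.
  rewrite modzz /=; have -> : `|i|%N = (size s).-1 by rewrite -/m; lia.
  rewrite nth_last (_ : last a s = a)//.
  by have /(pathP a)/(_ 0%N m0) := Ps.
by move=> n; rewrite modz_mod.
Qed.

Variable P : rel A.
Hypothesis Pirr : irreducible_matrix P.

(** Keep [y] on a window and continue along [q] on both sides; to the left, this is
    an extension to the right for the reversed graph. *)
Lemma sft_graft (q : int -> A) (y : full_shift A) (N : nat) :
  (forall n, P (q n) (q (n + 1))) -> sft P y -> exists y' : full_shift A,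
  [/\ sft P y', forall n : int, (`|n| <= N)%N -> y' n = y n &
    exists (c c' : int) (L : nat), (forall n : int, L%:Z <= n -> y' n = q (n + c)) /\
      (forall n : int, n <= - L%:Z -> y' n = q (n + c'))].
Proof.
move=> qP yP.
have qr (i : nat) : P (q i%:Z) (q i.+1%:Z).
  by have := qP i%:Z; rewrite (_ : i%:Z + 1 = i.+1%:Z)//; lia.
have ql (i : nat) : P (q (- i.+1%:Z)) (q (- i%:Z)).
  by have := qP (- i.+1%:Z); rewrite (_ : - i.+1%:Z + 1 = - i%:Z)//; lia.
have [xr [Lr [r0 rP rq]]] :=
  @right_extension P (fun i => q i%:Z) (y N%:Z) Pirr qr.
have [xl [Ll [l0 lP lq]]] :=
  @right_extension _ (fun i => q (- i%:Z)) (y (- N%:Z)) (irreducible_matrix_rev Pirr) ql.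
pose y' : full_shift A := fun n => if N%:Z <= n then xr (absz (n - N%:Z))
  else if n <= - N%:Z then xl (absz (- N%:Z - n)) else y n.
have yr n : N%:Z <= n -> y' n = xr (absz (n - N%:Z)) by rewrite /y' => ->.
(* the two clauses of the definition overlap when the window is one point *)
have yl n : n <= - N%:Z -> y' n = xl (absz (- N%:Z - n)).
  move=> nN; rewrite /y' nN; case: ifP => // Nn.
  have -> : absz (n - N%:Z) = 0%N by lia.
  have -> : absz (- N%:Z - n) = 0%N by lia.
  by rewrite r0 l0; congr y; lia.
have yin n : (`|n| <= N)%N -> y' n = y n.
  move=> nN; have [e|n1] := eqVneq n N%:Z.
    by rewrite yr ?e// subrr r0.
  have [e|n2] := eqVneq n (- N%:Z); first by rewrite yl ?e// subrr l0.
  rewrite /y' (_ : (N%:Z <= n) = false); last by lia.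
  by rewrite (_ : (n <= - N%:Z) = false)//; lia.
exists y'; split=> //.
- move=> n; have [h1|h1] := leP N%:Z n.
    rewrite !yr//; last by lia.
    by rewrite (_ : absz (n + 1 - N%:Z)%R = (absz (n - N%:Z)%R).+1); [exact: rP|lia].
  have [h2|h2] := leP (n + 1) (- N%:Z).
    rewrite !yl//; last by lia.
    by rewrite (_ : absz (- N%:Z - n)%R = (absz (- N%:Z - (n + 1))%R).+1); [exact: lP|lia].
  by rewrite !yin; [exact: yP|lia|lia].
- exists (- N%:Z - Lr%:Z), (N%:Z + Ll%:Z), (N + Lr + Ll)%N; split=> n hn.
    rewrite yr; last by lia.
    by rewrite rq; [congr q; lia|lia].
  rewrite yl; last by lia.
  by rewrite lq; [congr q; lia|lia].
Qed.

End Shifts.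

(** * Codings of an irreducible automorphism *)

Section Coding.
Variables (X : topologicalZmodType) (alpha beta : X -> X).
Hypothesis hausX : hausdorff_space X.
Hypothesis aD : forall x y, alpha (x + y) = alpha x + alpha y.
Hypotheses (ab : cancel alpha beta) (ba : cancel beta alpha).
Variables (A : countType) (P : rel A) (phi : full_shift A -> X).
Hypothesis Pirr : irreducible_matrix P.
Hypothesis phi_cont : {within sft P, continuous phi}.
Hypothesis phi_equiv : forall y, sft P y -> phi (shift_map y) = alpha (phi y).

Local Notation zpow := (zpow alpha beta).

Lemma coding_local (q : full_shift A) (V : set X) : sft P q -> nbhs (phi q) V ->
  exists M : nat, forall u, sft P u -> (forall j : int, (`|j| <= M)%N -> u j = q j) ->
    V (phi u).
Proof.
move=> Pq Vq; have /subspace_continuousP/(_ q Pq) := phi_cont.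
move=> /(_ _ Vq) /nbhs_full_shift_cylinder[M HM].
by exists M => u Pu uq; exact: (HM u uq Pu).
Qed.

Lemma coding_local2 (q : full_shift A) (U : set X) : sft P q -> nbhs (0 : X) U ->
  exists M : nat, forall u v, sft P u -> sft P v ->
    (forall j : int, (`|j| <= M)%N -> u j = q j) ->
    (forall j : int, (`|j| <= M)%N -> v j = q j) -> U (phi u - phi v).
Proof.
move=> Pq U0; have := @sub_continuous X (phi q, phi q).
rewrite /continuous_at /= subrr => /(_ _ U0) [[V1 V2] [/= V1q V2q] V12].
have [M1 H1] := coding_local Pq V1q; have [M2 H2] := coding_local Pq V2q.
exists (maxn M1 M2) => u v Pu Pv uq vq; apply: (V12 (phi u, phi v)); split => /=.
  by apply: H1 => // j jM; apply: uq; rewrite leq_max jM.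
by apply: H2 => // j jM; apply: vq; rewrite leq_max jM orbT.
Qed.

Definition translate (n : int) (y : full_shift A) : full_shift A := fun j => y (j + n).

Lemma sft_translate n y : sft P y -> sft P (translate n y).
Proof. by move=> Py j; rewrite /translate addrAC; exact: Py. Qed.

Lemma coding_translate n y : sft P y -> phi (translate n y) = zpow n (phi y).
Proof.
move=> Py; have S k : alpha (phi (translate k y)) = phi (translate (k + 1) y).
  rewrite -phi_equiv; last exact: sft_translate.
  by congr phi; apply/funext => j; rewrite /shift_map /translate; congr y; lia.
elim/zpow_ind: n => [|n IH|n IH].
- by congr phi; apply/funext => j; rewrite /translate addr0.
- by rewrite (zpowS ba) -IH S.
- by rewrite (zpowP ab ba) -IH -[n in RHS](subrK 1) -S ab.
Qed.

Variables (q : int -> A) (m : nat).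
Hypothesis m0 : (0 < m)%N.
Hypothesis qP : forall n, P (q n) (q (n + 1)).
Hypothesis qm : forall n, q n = q (n %% m%:Z)%Z.

Let mz : m%:Z != 0. Proof. by rewrite eqz_nat -lt0n. Qed.

Lemma periodic_residue n k : q (n + k) = q (n + (k %% m%:Z)%Z).
Proof. by rewrite qm [RHS]qm modzDmr. Qed.

Lemma residue_ord (k : int) : exists i : 'I_m, (k %% m%:Z)%Z = i%:Z.
Proof.
have k0 := modz_ge0 k mz; have k1 : (k %% m%:Z)%Z < m%:Z by apply: ltz_pmod; rewrite ltz_nat.
have h : (absz (k %% m%:Z)%Z < m)%N by lia.
by exists (Ordinal h) => /=; lia.
Qed.

(** The translates of the periodic sequence [q] form a finite set, so a window
    suitable for all of them exists. *)
Lemma coding_uniform (U : set X) : nbhs (0 : X) U -> exists M : nat,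
  forall (k : int) u v, sft P u -> sft P v ->
    (forall j : int, (`|j| <= M)%N -> u j = q (j + k) /\ v j = q (j + k)) ->
    U (phi u - phi v).
Proof.
move=> U0.
have Pq k : sft P (fun n => q (n + k)) by move=> n; rewrite addrAC; exact: qP.
have [M_ HM] := choice (fun k => coding_local2 (Pq k) U0).
exists (\sum_(i < m) M_ i%:Z)%N => k u v Pu Pv uv.
have [i ki] := residue_ord k.
have Mi : (M_ i%:Z <= \sum_(i < m) M_ i%:Z)%N by rewrite (bigD1 i)//= leq_addr.
apply: (HM i%:Z) => // j jM.
  by rewrite -ki -periodic_residue; case: (uv j (leq_trans jM Mi)).
by rewrite -ki -periodic_residue; case: (uv j (leq_trans jM Mi)).
Qed.

(** The points asymptotic to [q] with phase [i] to the right and [j] to the left. *)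
Definition asymptotic_class (i j : 'I_m) : set (full_shift A) := [set y | sft P y /\
  exists L : nat, (forall n : int, L%:Z <= n -> y n = q (n + i%:Z)) /\
    (forall n : int, n <= - L%:Z -> y n = q (n + j%:Z))].

Lemma asymptotic_homoclinic i j y y' : asymptotic_class i j y -> asymptotic_class i j y' ->
  homoclinic alpha beta (phi y - phi y').
Proof.
move=> [Py [L [yr yl]]] [Py' [L' [yr' yl']]] U /coding_uniform[M HM].
exists (M + L + L')%N => n nN.
rewrite (zpowD aD ab ba) (zpowN aD ab ba) -!coding_translate//.
have [n0|n0] := leP 0 n.
  apply: (HM (n + i%:Z)); [exact: sft_translate|exact: sft_translate|].
  by move=> k kM; rewrite /translate addrA yr ?yr'//; lia.
apply: (HM (n + j%:Z)); [exact: sft_translate|exact: sft_translate|].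
by move=> k kM; rewrite /translate addrA yl ?yl'//; lia.
Qed.

Lemma asymptotic_dense y (N : nat) : sft P y -> exists i j y',
  asymptotic_class i j y' /\ forall n : int, (`|n| <= N)%N -> y' n = y n.
Proof.
move=> Py; have [y' [Py' yN [c [c' [L [yr yl]]]]]] := sft_graft Pirr N qP Py.
have [i ci] := residue_ord c; have [j cj] := residue_ord c'.
exists i, j, y'; split=> //; split=> //; exists L; split=> n nL.
  by rewrite yr// periodic_residue ci.
by rewrite yl// periodic_residue cj.
Qed.

Lemma coding_finite : (forall x, homoclinic alpha beta x -> x = 0) ->
  finite_set (phi @` sft P).
Proof.
move=> nohom.
pose D := \bigcup_(ij in [set: 'I_m * 'I_m]) (phi @` asymptotic_class ij.1 ij.2).
have fD : finite_set D.
  apply: bigcup_finite => // -[i j] _ /=.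
  have [->|/set0P[y Dy]] := eqVneq (asymptotic_class i j) set0; first by rewrite image_set0.
  apply: (@sub_finite_set _ _ [set phi y]) => // _ [y' Dy' <-] /=.
  apply/eqP; rewrite -subr_eq0; apply/eqP/nohom; exact: asymptotic_homoclinic Dy' Dy.
have cD : closed D.
  by apply: (iffLR accessible_finite_set_closed) => //; exact: hausdorff_accessible.
apply: (sub_finite_set _ fD) => _ [y Py <-].
apply: cD => V /(coding_local Py)[N HN].
have [i [j [y' [Dy' yN]]]] := asymptotic_dense N Py.
exists (phi y'); split; first by exists (i, j) => //; exists y'.
by apply: HN => //; case: Dy'.
Qed.

End Coding.


Theorem corollary4p10
  (X : topologicalZmodType) (hX : compact_connected_group X)
  (alpha : {additive X -> X})
  (alpha_bij : bijective alpha) (alpha_cont : continuous alpha)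
  (R : realType) (mu : probability (borel_group X) R)
  (mu_haar : haar_measure mu)
  (alpha_irr : irreducible_automorphism alpha)
  (alpha_erg : ergodic mu alpha)
  (alpha_nonexp : ~ expansive alpha)
  (A : countType) (P : rel A) (P_irr : irreducible_matrix P)
  (phi : full_shift A -> X)
  (phi_cont : {within sft P, continuous phi})
  (phi_equiv : forall y, sft P y -> phi (shift_map y) = alpha (phi y)) :
  finite_set (phi @` sft P).
Proof.
have [hausX cptX _] := hX.
have [beta ab ba] := alpha_bij.
have aD x y : alpha (x + y) = alpha x + alpha y by exact: raddfD.
have bc : continuous beta by exact: continuous_bijection_inverse ab ba alpha_cont.
have irr (H : set X) : subgroup H -> closed H -> (forall x, H x <-> H (alpha x)) ->
    H <> setT -> finite_set H.
  move=> [H0 HB] cH aH; apply: alpha_irr => //.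
    split; first exact: mem_set.
    by move=> x y /set_mem Hx /set_mem Hy; apply/mem_set; exact: HB.
  apply/seteqP; split=> [_ [x Hx <-]|x Hx]; first by rewrite -aH.
  by exists (beta x); rewrite ?ba//; rewrite aH ba.
have nonexp (U : set X) : nbhs (0 : X) U ->
    exists2 z, z != 0 & forall n, U (zpow alpha beta n z).
  move=> U0; apply: contrapT => noz; apply: alpha_nonexp; exists U => //.
  apply/seteqP; split=> [z Uz|_ -> n _].
    apply: contrapT => /eqP z0; apply: noz; exists z => // -[[|k]|k].
    - by have [u Uu <-] := Uz 0 I.
    - exact: Uz (Negz k) I.
    - have [u Uu <-] := Uz k.+1%:Z I.
      by rewrite -[X in zpow _ _ _ X]/(zpow alpha beta k.+1%:Z u) -(zpow_add ab ba) NegzE addNr.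
  case: n => k; last by have := zpow_0 aD ab ba k.+1%:Z; rewrite /zpow /= => ->; exact: nbhs_singleton.
  exists 0; first exact: nbhs_singleton.
  exact: (zpow_0 aD ab ba k%:Z).
have [z z0 _] := nonexp setT filterT.
have [r [rc rn]] := nontrivial_character hausX cptX
  (haar_integral_invariant cptX (proj1 mu_haar)) z0.
have nohom x : homoclinic alpha beta x -> x = 0.
  exact: (homoclinic_trivial hausX cptX aD ab ba alpha_cont bc irr rc rn nonexp).
have [->|/set0P[y Py]] := eqVneq (sft P) set0; first by rewrite image_set0.
have [q [m [m0 qP qm]]] := periodic_point (y 0) P_irr.
exact: (coding_finite hausX aD ab ba P_irr phi_cont phi_equiv m0 qP qm nohom).
Qed.
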